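(* Let $u,v:[0,T]\to\mathbb{R}$ be Borel measurable functions with $u\in L^1(dt)$ and $v\in L^2(dt)$. Let $g:\Omega\times[0,T]\times\mathbb{R}^m\times\mathbb{R}^{m\times d}\to\mathbb{R}^m$ be measurable, with $\int_0^T|g(s,0,0)|\,ds\in L^2$, and suppose there is a constant $K>0$ such that $$|g(t,y,z)-g(t,y',z')|\le K(|y-y'|+|z-z'|)$$ for all $y,y'\in\mathbb{R}^m$ and $z,z'\in\mathbb{R}^{m\times d}$. Let $\xi\in L^2(\mathbb{R}^m)$ be $\mathcal{F}_T$-measurable. For $i=1,2$ and $n\in\mathbb{N}$, let $\alpha_i^n$ and $\alpha_i$ be deterministic, finite measures supported on $[-T,0]$ such that $$K^2\,\alpha_1^n([-T,0])^2\,\|u\|_{L^1(dt)}^2\le\frac1{25},\qquad K^2\,\alpha_2^n([-T,0])^2\,\|v\|_{L^2(dt)}^2\le\frac1{25}$$ for all $n$, and such that $\alpha_i^n([-T,0])\to\alpha_i([-T,0])$ as $n\to\infty$ for $i=1,2$. Suppose that $\alpha_1^n\le\alpha_1$ for all $n$ (or $\alpha_1\le\alpha_1^n$ for all $n$), and that $\alpha_2^n\le\alpha_2$ for all $n$ (or $\alpha_2\le\alpha_2^n$ for all $n$). Then $$\|Y^n-Y\|_{\mathcal{S}^2(\mathbb{R}^m)}\to0\quad\text{and}\quad\|Z^n-Z\|_{\mathcal{H}^2(\mathbb{R}^{m\times d})}\to0,$$ where $(Y^n,Z^n)$ and $(Y,Z)$ are the solutions in $\mathcal{S}^2(\mathbb{R}^m)\times\mathcal{H}^2(\mathbb{R}^{m\times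 d})$ of the delay BSDE (recalled in the context) with delay measures $(\alpha_1^n,\alpha_2^n)$ and $(\alpha_1,\alpha_2)$, respectively.
   Context: Let $T\in(0,\infty]$ (infinite horizon is allowed), $m,d\in\mathbb{N}$, and let $(\Omega,\mathcal{F},(\mathcal{F}_t)_{t\in[0,T]},P)$ be a filtered probability space whose filtration is generated by a $d$-dimensional Brownian motion $W$, is complete and right-continuous, with $\mathcal{F}=\mathcal{F}_T$. $\Omega\times[0,T]$ carries the predictable $\sigma$-algebra and Euclidean spaces their Borel $\sigma$-algebras; measurability of $g$ is understood with respect to these. Equalities and inequalities between random variables (resp. processes) hold $P$-a.s. (resp. $P\otimes dt$-a.e.). $\mathcal{S}^2(\mathbb{R}^m)$ is the space of predictable continuous $\mathbb{R}^m$-valued processes $X$ with $\|X\|_{\mathcal{S}^2}^2:=E[(\sup_{t\in[0,T]}|X_t|)^2]<\infty$. $\mathcal{H}^2(\mathbb{R}^{m\times d})$ is the space of predictable $\mathbb{R}^{m\times d}$-valued processes $Z$ with $\|Z\|_{\mathcal{H}^2}^2:=E[\int_0^T|Z_u|^2\,du]<\infty$. Processes (and the deterministic functions $u,v$) are extended by $0$ to $[-T,0)$. The spaces $L^1(dt),L^2(dt)$ are with respect to Lebesgue measure on $[0,T]$. All measures are nonnegative measures on $[-\infty,\infty]$ (with its Borel $\sigma$-algebra); $\alpha\le\beta$ means $\alpha(A)\le\beta(A)$ for every measurable set $A$. For measures $\beta_1,\beta_2$ on $[-T,0]$, the delay BSDE with delay measures $(\beta_1,\beta_2)$ is $$Y_t=\xi+\int_t^T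 g\left(s,\int_{-T}^0u(s+r)Y_{s+r}\,\beta_1(dr),\int_{-T}^0v(s+r)Z_{s+r}\,\beta_2(dr)\right)ds-\int_t^TZ_s\,dW_s,\quad t\in[0,T].$$ Under the smallness conditions $K^2\beta_1([-T,0])^2\|u\|_{L^1(dt)}^2\le\frac1{25}$ and $K^2\beta_2([-T,0])^2\|v\|_{L^2(dt)}^2\le\frac1{25}$ it has a unique solution in $\mathcal{S}^2(\mathbb{R}^m)\times\mathcal{H}^2(\mathbb{R}^{m\times d})$. *)

(* Defs.v *)
From HB Require Import structures.
From mathcomp Require Import all_boot all_order all_algebra.
From mathcomp Require Import all_classical all_reals all_analysis.
From mathcomp Require Import measurable_realfun.

Set Implicit Arguments.
Unset Strict Implicit.
Unset Printing Implicit Defensive.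

Import Order.TTheory GRing.Theory Num.Theory.
Import numFieldNormedType.Exports.

Local Open Scope classical_set_scope.
Local Open Scope ring_scope.

(* Conventions.  Time points live in [\bar R], so that the horizon [T] may be
   [+oo] and "t in [0, T]" includes the endpoint [t = +oo].  A process is a
   function [X : \bar R -> Omega -> V]; only its values on [0, T] matter.
   R^m is ['cV[R]_m] and R^(m x d) is ['M[R]_(m, d)], with the Euclidean norm
   [enorm] (the library norm on matrices is the max norm). *)

Section Matrices.
Context {R : realType}.

Definition enorm p q (A : 'M[R]_(p, q)) : R :=
  Num.sqrt (\sum_i \sum_j A i j ^+ 2).

Definition mxRintegral d (X : measurableType d)
    (mu : {measure set X -> \bar R}) (D : set X)
    p q (f : X -> 'M[R]_(p, q)) : 'M[R]_(p, q) :=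
  \matrix_(i, j) (\int[mu]_(x in D) f x i j).

End Matrices.

Section SigmaAlgebras.

Definition borel (V : topologicalType) : set (set V) := <<s [set O | open O] >>.

(* [f], defined on [D], is measurable from the sigma-algebra [G] on [D] to the
   sigma-algebra [H]. *)
Definition measurable_wrt (U V : Type) (D : set U) (G : set (set U))
    (H : set (set V)) (f : U -> V) : Prop :=
  forall B, H B -> G (D `&` f @^-1` B).

Definition prod_sigma (U V : Type) (D : set U) (G : set (set U))
    (E : set V) (H : set (set V)) : set (set (U * V)) :=
  <<s D `*` E, [set C | exists A B, [/\ G A, H B & C = A `*` B]] >>.

End SigmaAlgebras.

Section Time.
Context {R : realType}.

(* The real points of [a, b]: the domain of integration of \int_a^b ... ds. *)
Definition rtime (a b : \bar R) : set R := [set s | (a <= s%:E <= b)%E].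

Definition zero_ext (V : zmodType) (f : \bar R -> V) (t : \bar R) : V :=
  if (0 <= t)%E then f t else 0.

Definition L1norm (T : \bar R) (u : \bar R -> R) : \bar R :=
  (\int[lebesgue_measure]_(s in rtime 0 T) `|u s%:E|%:E)%E.

Definition L2norm (T : \bar R) (v : \bar R -> R) : \bar R :=
  ((\int[lebesgue_measure]_(s in rtime 0 T) ((v s%:E) ^+ 2)%:E) `^ 2^-1)%E.

(* Measures on [-oo, +oo]. *)
Definition measure_le (alpha beta : {finite_measure set \bar R -> \bar R}) :=
  forall A : set (\bar R), measurable A -> (alpha A <= beta A)%E.

Definition supported_on (alpha : {finite_measure set \bar R -> \bar R})
    (D : set (\bar R)) : Prop := (alpha (~` D) = 0)%E.

Definition past (T : \bar R) : set (\bar R) := `[(- T)%E, 0%E].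

End Time.

Section Processes.
Context {R : realType} {disp : measure_display} {Omega : measurableType disp}.
Variable (P : probability Omega R) (T : \bar R).
Variable F : \bar R -> set (set Omega).

Definition random_vector p q (X : Omega -> 'M[R]_(p, q)) : Prop :=
  measurable_wrt setT measurable (@borel _) X.

Definition rvL2norm p q (X : Omega -> 'M[R]_(p, q)) : \bar R :=
  ((\int[P]_w ((enorm (X w)) ^+ 2)%:E) `^ 2^-1)%E.

Definition time_domain : set (Omega * \bar R) :=
  setT `*` [set t | (0 <= t <= T)%E].

Definition predictable_sigma : set (set (Omega * \bar R)) :=
  <<s time_domain,
    [set C | exists2 A, F 0%E A & C = A `*` [set 0%E]] `|`
    [set C | exists A s t, [/\ (0 <= s)%E, (s < t)%E, (t <= T)%E, F s A &
                               C = A `*` [set r | (s < r <= t)%E]]] >>.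

Definition predictable p q (X : \bar R -> Omega -> 'M[R]_(p, q)) : Prop :=
  measurable_wrt time_domain predictable_sigma (@borel _)
    (fun x => X x.2 x.1).

Definition continuous_paths p q (X : \bar R -> Omega -> 'M[R]_(p, q)) : Prop :=
  {ae P, forall w, {within [set t | (0 <= t <= T)%E], continuous (X ^~ w)}}.

Definition S2norm p q (X : \bar R -> Omega -> 'M[R]_(p, q)) : \bar R :=
  ((\int[P]_w
      (ereal_sup [set (enorm (X t w))%:E | t in [set t | (0 <= t <= T)%E]]
       ^+ 2)) `^ 2^-1)%E.

Definition H2norm p q (Z : \bar R -> Omega -> 'M[R]_(p, q)) : \bar R :=
  ((\int[P]_w \int[lebesgue_measure]_(s in rtime 0 T)
      ((enorm (Z s%:E w)) ^+ 2)%:E) `^ 2^-1)%E.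

Definition in_S2 p q (X : \bar R -> Omega -> 'M[R]_(p, q)) : Prop :=
  [/\ predictable X, continuous_paths X & (S2norm X < +oo)%E].

Definition in_H2 p q (Z : \bar R -> Omega -> 'M[R]_(p, q)) : Prop :=
  predictable Z /\ (H2norm Z < +oo)%E.

End Processes.

Section BrownianMotion.
Context {R : realType} {disp : measure_display} {Omega : measurableType disp}.
Variable (P : probability Omega R) (T : \bar R).
Variable F : \bar R -> set (set Omega).
Context {d : nat}.
Variable W : R -> Omega -> 'cV[R]_d.

Record brownian_motion : Prop := BrownianMotion {
  bm_measurable : forall t, rtime 0 T t -> random_vector (W t);
  bm_start : {ae P, forall w, W 0 w = 0};
  bm_continuous :
    {ae P, forall w, {within rtime 0 T, continuous (W ^~ w)}};
  bm_independent : forall (s t : R) A B,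
    0 <= s -> s < t -> (t%:E <= T)%E -> F s%:E A -> borel B ->
    (P (A `&` [set w | B (W t w - W s w)%R]) =
     P A * P [set w | B (W t w - W s w)%R])%E;
  (* the law of W_t - W_s is N(0, (t - s) I_d): its values on boxes *)
  bm_gaussian : forall (s t : R) (B : 'I_d -> set R),
    0 <= s -> s < t -> (t%:E <= T)%E -> (forall j, measurable (B j)) ->
    (P [set w | forall j, B j ((W t w - W s w)%R j ord0)] =
     \prod_(j < d) normal_prob 0 (Num.sqrt (t - s)%R) (B j))%E }.

Definition brownian_filtration (t : \bar R) : set (set Omega) :=
  <<s [set N | P.-negligible N] `|`
      [set A | exists s, exists2 B, borel B &
               rtime 0 T s /\ (s%:E <= t)%E /\ A = W s @^-1` B] >>.

Record brownian_basis : Prop := BrownianBasis {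
  bb_complete : measure_is_complete P;
  bb_brownian : brownian_motion;
  bb_generated : forall t, (0 <= t <= T)%E -> F t = brownian_filtration t;
  bb_right_continuous : forall t, (0 <= t < T)%E ->
    F t = \bigcap_(s in [set s | (t < s <= T)%E]) F s;
  bb_final : F T = measurable }.

(* Simple integrands  H = \sum_(i < N) Phi_i 1_(tau_i, tau_(i+1)]. *)
Record simple_integrand (m : nat) := SimpleIntegrand {
  si_size : nat;
  si_time : nat -> R;
  si_coef : nat -> Omega -> 'M[R]_(m, d) }.

Definition simple_integrand_wf m (H : simple_integrand m) : Prop :=
  [/\ 0 <= si_time H 0,
      forall i, (i < si_size H)%N -> si_time H i <= si_time H i.+1,
      ((si_time H (si_size H))%:E <= T)%E,
      forall i, (i < si_size H)%N ->
        measurable_wrt setT (F (si_time H i)%:E) (@borel _) (si_coef H i) &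
      forall i, (i < si_size H)%N ->
        exists C : R, forall w, enorm (si_coef H i w) <= C].

Definition simple_process m (H : simple_integrand m) (t : \bar R) (w : Omega) :
    'M[R]_(m, d) :=
  \sum_(i < si_size H)
    if ((si_time H i)%:E < t <= (si_time H i.+1)%:E)%E then si_coef H i w
    else 0.

(* \int_0^t H_s dW_s = \sum_i Phi_i (W_(tau_(i+1) /\ t) - W_(tau_i /\ t)) *)
Definition simple_ito m (H : simple_integrand m) (t : \bar R) (w : Omega) :
    'cV[R]_m :=
  \sum_(i < si_size H)
    si_coef H i w *m (W (fine (Order.min (si_time H i.+1)%:E t)) w
                      - W (fine (Order.min (si_time H i)%:E t)) w).

(* [I] is a version of the Ito integral \int_a^b Z_s dW_s: an L^2 limit of the
   integrals of simple integrands converging to [Z] in H^2.  By the Ito isometry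
   the limit does not depend, up to P-null sets, on the approximating sequence,
   and every [Z] in H^2 admits one. *)
Definition is_ito_integral m (a b : \bar R)
    (Z : \bar R -> Omega -> 'M[R]_(m, d)) (I : Omega -> 'cV[R]_m) : Prop :=
  random_vector I /\
  exists H : nat -> simple_integrand m,
    [/\ forall k, simple_integrand_wf (H k),
        H2norm P T (fun t w => simple_process (H k) t w - Z t w)
          @[k --> \oo] --> 0%E &
        rvL2norm P (fun w => simple_ito (H k) b w - simple_ito (H k) a w - I w)
          @[k --> \oo] --> 0%E].

End BrownianMotion.

Section DelayBSDE.
Context {R : realType} {disp : measure_display} {Omega : measurableType disp}.
Variable (P : probability Omega R) (T : \bar R).
Variable F : \bar R -> set (set Omega).
Context {d m : nat}.
Variable W : R -> Omega -> 'cV[R]_d.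

(* \int_{-T}^0 h(t + r) X_(t + r) beta(dr) *)
Definition delay_term p q (h : \bar R -> R)
    (X : \bar R -> Omega -> 'M[R]_(p, q))
    (beta : {finite_measure set \bar R -> \bar R})
    (t : \bar R) (w : Omega) : 'M[R]_(p, q) :=
  mxRintegral beta (past T)
    (fun r => zero_ext h (t + r)%E *: zero_ext (X ^~ w) (t + r)%E).

Definition driver_measurable
    (g : Omega -> \bar R -> 'cV[R]_m -> 'M[R]_(m, d) -> 'cV[R]_m) : Prop :=
  measurable_wrt
    ((time_domain T `*` setT) `*` setT)
    (prod_sigma (time_domain T `*` setT)
       (prod_sigma (time_domain T) (predictable_sigma T F)
                   setT (@borel 'cV[R]_m))
       setT (@borel 'M[R]_(m, d)))
    (@borel 'cV[R]_m)
    (fun x => g x.1.1.1 x.1.1.2 x.1.2 x.2).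

Definition driver_lipschitz (K : R)
    (g : Omega -> \bar R -> 'cV[R]_m -> 'M[R]_(m, d) -> 'cV[R]_m) : Prop :=
  {ae (P \x lebesgue_measure)%E, forall x : Omega * R, rtime 0 T x.2 ->
    forall y y' z z',
      enorm (g x.1 x.2%:E y z - g x.1 x.2%:E y' z')
      <= K * (enorm (y - y') + enorm (z - z'))}.

Definition delay_bsde_solution (u v : \bar R -> R)
    (g : Omega -> \bar R -> 'cV[R]_m -> 'M[R]_(m, d) -> 'cV[R]_m)
    (xi : Omega -> 'cV[R]_m)
    (beta1 beta2 : {finite_measure set \bar R -> \bar R})
    (Y : \bar R -> Omega -> 'cV[R]_m)
    (Z : \bar R -> Omega -> 'M[R]_(m, d)) : Prop :=
  [/\ in_S2 P T F Y, in_H2 P T F Z &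
      forall t, (0 <= t <= T)%E ->
        exists2 I, is_ito_integral P T F W t T Z I &
        {ae P, forall w, Y t w =
           xi w
           + mxRintegral lebesgue_measure (rtime t T)
               (fun s => g w s%:E (delay_term u Y beta1 s%:E w)
                                  (delay_term v Z beta2 s%:E w))
           - I w}].

End DelayBSDE.

(* Main.v *)
Require Import Defs.
From HB Require Import structures.
From mathcomp Require Import all_boot all_order all_algebra.
From mathcomp Require Import all_classical all_reals all_analysis.
From mathcomp Require Import measurable_realfun ring lra.

Set Implicit Arguments.
Unset Strict Implicit.
Unset Printing Implicit Defensive.

Import Order.TTheory GRing.Theory Num.Theory.
Import numFieldNormedType.Exports.

Local Open Scope classical_set_scope.
Local Open Scope ring_scope.

(** Stability of the delay equation is a contraction estimate.

    Let (Yn, Zn) and (Y, Z) solve the equations with measures alpha and beta,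
    let dY and dZ be the differences of the solutions, and let dI_t be the
    difference of the stochastic integrals of Zn and Z over [t, T]. Subtracting
    the equations, dY_t + dI_t is the difference of the two integrals of the
    driver over [t, T]. For almost every path it is bounded, for all t at once,
    by the random variable
      B = c1 sup |dY| + e1 sup |Y| + c2 |dZ| + e2 |Z|,
    where |Z| is the L2(dt) norm of a path of Z ([generator_gap]). Here
    c1 = K alpha1([-T, 0]) |u|_1 and c2 = K alpha2([-T, 0]) |v|_2 are at most
    1/5, while e1 and e2 are the same expressions with alpha_i replaced by the
    measure nu_i = |alpha_i - beta_i|. It is monotonicity that makes nu_i the
    plain difference of two measures, of mass |alpha_i - beta_i|([-T, 0]) =
    |alpha_i([-T, 0]) - beta_i([-T, 0])|, which tends to 0. The bound itself
    rests on the Lipschitz property of the driver and on [delay_integral_le]: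
    by Tonelli and translation invariance, a delay multiplies integrals over
    time by at most the mass of the delay measure.

    The stochastic integral dI_t is orthogonal to the square-integrable
    F_t-measurable variables, so dY_t is the projection of a variable of norm
    at most B. Doob's inequality yields E sup |dY|^2 <= 4 E B^2; conditional
    expectations are avoided by testing against the increments of the running
    maximum ([doob_step], [doob_finite]), and the supremum is reached through
    countably many times ([path_sup_bound]). Orthogonality at time 0 and the
    isometry yield E |dZ|^2 <= E B^2. Since c1 and c2 are at most 1/5, the sum
    of the two left sides is at most 4/5 of itself plus 20 (e1^2 E sup |Y|^2 +
    e2^2 E |Z|^2) ([stability_estimate]); the last term tends to 0.

    A stochastic integral is here any L2 limit of integrals of simple
    integrands, so its properties are first proved for these:
    they are sums of increments with coefficients known beforehand, for which
    orthogonality and isometry follow from the independence and the covariances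
    of Brownian increments ([elementary_covariance]). They extend to limits in
    [ito_integral_orthogonal] and [ito_isometry_le]. *)

(** * Image measures and square-integrable functions *)

Section ImageMeasure.
Context d d' (X : measurableType d) (Y : measurableType d') (R : realType).
Variables (mu : {measure set X -> \bar R}) (nu : {measure set Y -> \bar R}).
Variable f : X -> Y.
Hypothesis mf : measurable_fun setT f.
Hypothesis image_f : forall B, measurable B -> mu (f @^-1` B) = nu B.

(** The measure nu is only known to agree with the image of mu on measurable
    sets. Source and target are arbitrary measurable types because Lebesgue
    measure is carried by an alias of the reals with its own sigma-algebra. *)
Lemma ge0_integral_image (D : set Y) (h : Y -> \bar R) : measurable D ->
  measurable_fun D h -> (forall y, D y -> 0 <= h y)%E ->
  (\int[nu]_(y in D) h y = \int[mu]_(x in f @^-1` D) h (f x))%E.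
Proof.
move=> mD mh h0.
transitivity (\int[pushforward mu f]_(y in D) h y)%E.
  by apply: eq_measure_integral => B mB _; exact/esym/image_f.
by rewrite ge0_integral_pushforward// => y /set_mem; exact: h0.
Qed.

Lemma integral_image (h : Y -> \bar R) : measurable_fun setT h ->
  mu.-integrable setT (h \o f) ->
  (\int[nu]_y h y = \int[mu]_x h (f x))%E.
Proof.
move=> mh ih.
transitivity (\int[pushforward mu f]_y h y)%E.
  by apply: eq_measure_integral => B mB _; exact/esym/image_f.
by rewrite integral_pushforward// preimage_setT.
Qed.

End ImageMeasure.

Section SquareIntegrable.
Context d (X : measurableType d) (R : realType).
Variable mu : {measure set X -> \bar R}.
Implicit Types f g : X -> R.

Definition sqint f : Prop :=
  measurable_fun setT f /\ (\int[mu]_x ((f x) ^+ 2)%:E < +oo)%E.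

Lemma measurable_sqr f : measurable_fun setT f ->
  measurable_fun setT (fun x => ((f x) ^+ 2)%:E).
Proof. by move=> mf; apply/measurable_EFinP; exact: measurable_funX. Qed.

Lemma sqint_le f g : measurable_fun setT f -> sqint g ->
  (forall x, `|f x| <= `|g x|) -> sqint f.
Proof.
move=> mf [mg ig] fg; split=> //; apply: le_lt_trans ig.
apply: ge0_le_integral => //.
- by move=> x _; rewrite lee_fin sqr_ge0.
- exact: measurable_sqr.
- exact: measurable_sqr.
- by move=> x _; rewrite lee_fin -(real_normK (num_real (f x)))
    -(real_normK (num_real (g x))) lerXn2r ?nnegrE.
Qed.

Lemma sqintZ (k : R) f : sqint f -> sqint (fun x => k * f x).
Proof.
move=> [mf fi]; split; first exact: measurable_funM.
under eq_integral do rewrite exprMn EFinM.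
rewrite ge0_integralZl_EFin//.
- by rewrite lte_mul_pinfty// ?lee_fin ?sqr_ge0.
- by move=> x _; rewrite lee_fin sqr_ge0.
- exact: measurable_sqr.
- exact: sqr_ge0.
Qed.

Lemma sqintD f g : sqint f -> sqint g -> sqint (fun x => f x + g x).
Proof.
move=> [mf fi] [mg gi]; split; first exact: measurable_funD.
have [m2f m2g] : measurable_fun setT (fun x => (2 * f x ^+ 2)%:E) /\
    measurable_fun setT (fun x => (2 * g x ^+ 2)%:E).
  by split; apply/measurable_EFinP; apply: measurable_funM => //;
    exact: measurable_funX.
apply: (@le_lt_trans _ _ (\int[mu]_x ((2 * f x ^+ 2)%:E + (2 * g x ^+ 2)%:E)))%E.
  apply: ge0_le_integral => //.
  - by move=> x _; rewrite lee_fin sqr_ge0.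
  - by apply: measurable_sqr; exact: measurable_funD.
  - exact: emeasurable_funD.
  - move=> x _; rewrite -EFinD lee_fin.
    by have := sqr_ge0 (f x - g x); nra.
rewrite ge0_integralD//; last 2 first.
  by move=> x _; rewrite lee_fin mulr_ge0 ?sqr_ge0.
  by move=> x _; rewrite lee_fin mulr_ge0 ?sqr_ge0.
rewrite lte_add_pinfty//.
- under eq_integral do rewrite EFinM.
  rewrite ge0_integralZl_EFin//; first by rewrite lte_mul_pinfty.
  + by move=> x _; rewrite lee_fin sqr_ge0.
  + exact: measurable_sqr.
- under eq_integral do rewrite EFinM.
  rewrite ge0_integralZl_EFin//; first by rewrite lte_mul_pinfty.
  + by move=> x _; rewrite lee_fin sqr_ge0.
  + exact: measurable_sqr.
Qed.

Lemma sqintN f : sqint f -> sqint (fun x => - f x).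
Proof.
by move=> [mf fi]; split; [exact: measurable_funN|under eq_integral do rewrite sqrrN].
Qed.

Lemma sqintB f g : sqint f -> sqint g -> sqint (fun x => f x - g x).
Proof. by move=> fi gi; apply: sqintD => //; exact: sqintN. Qed.

Lemma sqint0 : sqint (fun=> 0).
Proof. by split=> //; under eq_integral do rewrite expr0n/=; rewrite integral0. Qed.

Lemma sqint_sum (I : Type) (r : seq I) (h : I -> X -> R) :
  (forall i, sqint (h i)) -> sqint (fun x => \sum_(i <- r) h i x).
Proof.
move=> hi; elim: r => [|i r IH].
  by under eq_fun do rewrite big_nil; exact: sqint0.
by under eq_fun do rewrite big_cons; exact: sqintD.
Qed.

Lemma sqint_mul f g : sqint f -> sqint g ->
  mu.-integrable setT (EFin \o (fun x => f x * g x)).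
Proof.
move=> [mf fi] [mg gi]; apply/integrableP; split.
  by apply/measurable_EFinP; exact: measurable_funM.
apply: (@le_lt_trans _ _ (\int[mu]_x ((f x ^+ 2)%:E + (g x ^+ 2)%:E)))%E.
  apply: ge0_le_integral => //.
  - apply: measurableT_comp => //; apply/measurable_EFinP.
    exact: measurable_funM.
  - by apply: emeasurable_funD; exact: measurable_sqr.
  - move=> x _; rewrite -EFinD abse_EFin lee_fin normrM.
    rewrite -[X in _ <= X + _](real_normK (num_real _)).
    rewrite -[X in _ <= _ + X](real_normK (num_real _)).
    by have := sqr_ge0 (`|f x| - `|g x|);
      have := mulr_ge0 (normr_ge0 (f x)) (normr_ge0 (g x)); nra.
rewrite ge0_integralD//; last 4 first.
- by move=> x _; rewrite lee_fin sqr_ge0.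
- exact: measurable_sqr.
- by move=> x _; rewrite lee_fin sqr_ge0.
- exact: measurable_sqr.
by rewrite lte_add_pinfty.
Qed.

Lemma sqint_sqr f : sqint f -> mu.-integrable setT (EFin \o (fun x => f x ^+ 2)).
Proof. by move=> fi; apply: sqint_mul. Qed.

Lemma integral_EFin_Rintegral (D : set X) f : measurable D ->
  mu.-integrable D (EFin \o f) ->
  (\int[mu]_(x in D) (f x)%:E = (\int[mu]_(x in D) f x)%:E)%E.
Proof. by move=> mD fi; rewrite /Rintegral fineK//; exact: integrable_fin_num. Qed.

Lemma integrable_sumR (D : set X) (I : Type) (r : seq I) (h : I -> X -> R) :
  measurable D -> (forall i, mu.-integrable D (EFin \o h i)) ->
  mu.-integrable D (EFin \o (fun x => \sum_(i <- r) h i x)).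
Proof.
move=> mD hi.
rewrite (_ : _ \o _ = (fun x => \sum_(i <- r) (EFin \o h i) x)%E); last first.
  by apply/funext => x /=; rewrite sumEFin.
exact: integrable_sum.
Qed.

Lemma Rintegral_sum (D : set X) (I : Type) (r : seq I) (h : I -> X -> R) :
  measurable D -> (forall i, mu.-integrable D (EFin \o h i)) ->
  \int[mu]_(x in D) (\sum_(i <- r) h i x) =
  \sum_(i <- r) \int[mu]_(x in D) h i x.
Proof.
move=> mD hi; elim: r => [|i r IH].
  under eq_Rintegral do rewrite big_nil.
  by rewrite big_nil /Rintegral integral0.
under eq_Rintegral do rewrite big_cons.
by rewrite RintegralD// ?big_cons ?IH//; exact: integrable_sumR.
Qed.

End SquareIntegrable.

Section BoundedSqint.
Context d (X : measurableType d) (R : realType) (P : probability X R).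

Lemma sqint_bounded (f : X -> R) (C : R) : measurable_fun setT f ->
  (forall x, `|f x| <= C) -> sqint P f.
Proof.
move=> mf fC; split=> //.
apply: (@le_lt_trans _ _ (\int[P]_x (C ^+ 2)%:E))%E.
  apply: ge0_le_integral => //.
  - by move=> x _; rewrite lee_fin sqr_ge0.
  - exact: measurable_sqr.
  - move=> x _; rewrite lee_fin -(real_normK (num_real (f x))).
    by rewrite lerXn2r ?nnegrE// (le_trans _ (fC x)).
by rewrite integral_cst//= probability_setT mule1 ltry.
Qed.

Lemma sqint1 : sqint P (fun=> 1).
Proof. by apply: (@sqint_bounded _ 1) => // x; rewrite normr1. Qed.

Lemma sqint_integrable (f : X -> R) : sqint P f -> P.-integrable setT (EFin \o f).
Proof.
move=> fi; have := sqint_mul fi sqint1.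
by rewrite (_ : (fun x => _) = f)//; apply/funext => x; rewrite mulr1.
Qed.

Lemma sqintM_bounded (f g : X -> R) (C : R) : measurable_fun setT f ->
  (forall x, `|f x| <= C) -> sqint P g -> sqint P (fun x => f x * g x).
Proof.
move=> mf fC gi; apply: (@sqint_le _ _ _ _ _ (fun x => C * g x)).
- by apply: measurable_funM => //; case: gi.
- exact: sqintZ.
- by move=> x; rewrite !normrM ler_wpM2r// (le_trans (fC x))// ler_norm.
Qed.

End BoundedSqint.

(** * Independent random variables *)

Section Independence.
Context d (X : measurableType d) (R : realType) (P : probability X R).
Local Open Scope ereal_scope.

(** The law of (f, g) is the product of the two laws, since they agree on
    rectangles; Fubini then factors the mean of the product. *)
Lemma independent_expectation (f g : X -> R) :
  measurable_fun setT f -> measurable_fun setT g ->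
  (forall A B, measurable A -> measurable B ->
     P (f @^-1` A `&` g @^-1` B) = P (f @^-1` A) * P (g @^-1` B)) ->
  P.-integrable setT (EFin \o f) -> P.-integrable setT (EFin \o g) ->
  P.-integrable setT (EFin \o (f \* g)%R) ->
  (\int[P]_x (f x * g x) = \int[P]_x f x * \int[P]_x g x)%R.
Proof.
move=> mf mg ind fi gi fgi.
pose fg (x : X) := (f x, g x).
have mfg : measurable_fun setT fg by exact: measurable_fun_pair.
pose rf : {RV P >-> R} := mfun_Sub (mem_set mf).
pose rg : {RV P >-> R} := mfun_Sub (mem_set mg).
pose rfg : {RV P >-> (R * R)%type} := mfun_Sub (mem_set mfg).
pose m1 := distribution P rf; pose m2 := distribution P rg.
have mul_meas : measurable_fun setT (fun z : R * R => (z.1 * z.2)%:E).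
  by apply/measurable_EFinP; apply: measurable_funM.
have eqm : forall A, measurable A -> (m1 \x m2) A = distribution P rfg A.
  by apply: product_measure_unique => A B mA mB; exact: ind.
have E1 : \int[P]_x (f x * g x)%:E = \int[m1 \x m2]_z (z.1 * z.2)%:E.
  rewrite (eq_measure_integral (distribution P rfg))//; last first.
    by move=> A mA _; exact: eqm.
  by rewrite integral_distribution.
have zi : (m1 \x m2).-integrable setT (fun z : R * R => (z.1 * z.2)%:E).
  apply/integrableP; split => //.
  rewrite (eq_measure_integral (distribution P rfg))//; last first.
    by move=> A mA _; exact: eqm.
  rewrite ge0_integral_distribution//; last exact: measurableT_comp.
  by case/integrableP : fgi.
have E2 : \int[m1 \x m2]_z (z.1 * z.2)%:E =
    (\int[P]_x f x * \int[P]_x g x)%:E.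
  rewrite -integral12_prod_meas1//=.
  rewrite /fubini_F/=.
  have inner (x : R) : \int[m2]_y (x * y)%:E = (x * \int[P]_x g x)%:E.
    rewrite integral_distribution//=; last 2 first.
      by apply/measurable_EFinP; exact: measurable_funM.
      rewrite (_ : _ \o _ = (fun z => x%:E * (EFin \o g) z))//.
      exact: integrableZl.
    under eq_integral do rewrite /= EFinM.
    by rewrite integralZl// integral_EFin_Rintegral.
  under eq_integral do rewrite inner.
  rewrite integral_distribution//=; last 2 first.
    by apply/measurable_EFinP; exact: measurable_funM.
    rewrite (_ : _ \o _ = (fun z => (EFin \o f) z * (\int[P]_x g x)%:E))//.
    exact: integrableZr.
  under eq_integral do rewrite /= EFinM.
  by rewrite integralZr// integral_EFin_Rintegral.
by apply: EFin_inj; rewrite -E2 -E1 integral_EFin_Rintegral.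
Qed.

End Independence.

(** * Translation invariance of Lebesgue measure *)

Section LebesgueShift.
Context {R : realType}.
Local Open Scope ereal_scope.
Local Notation mu := lebesgue_measure.

(** Lebesgue measure is determined by its values on half-open intervals. *)
Lemma lebesgue_measure_shift (c : R) (A : set R) : measurable A ->
  pushforward mu ((fun x => x + c)%R : _ -> measurableTypeR R) A = mu A.
Proof.
have mc : measurable_fun setT ((fun x => x + c)%R : R -> measurableTypeR R).
  exact: measurable_funD.
move=> mA; apply/esym/lebesgue_measure_unique => //= _ [[a b]] _ <-.
rewrite /pushforward (_ : _ @^-1` _ = `](a - c)%R, (b - c)%R]%classic); last first.
  by apply/seteqP; split => x /=; rewrite !in_itv/= ltrBlDr lerBrDr.
rewrite !lebesgue_measure_itv/= !lte_fin ltrD2r.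
by case: ifPn => // _; rewrite -!EFinD; congr EFin; ring.
Qed.

Lemma ge0_integral_shift (c : R) (f : R -> \bar R) :
  measurable_fun [set: R] f -> (forall r, 0 <= f r) ->
  \int[mu]_r f (r + c)%R = \int[mu]_r f r.
Proof.
move=> mf f0.
have mc : @measurable_fun _ _ (measurableTypeR R) (measurableTypeR R) setT
  (fun x => (x + c)%R) by exact: measurable_funD.
rewrite [RHS](@ge0_integral_image _ _ (measurableTypeR R) (measurableTypeR R) R
  mu mu _ mc (lebesgue_measure_shift c) setT)//.
Qed.

End LebesgueShift.

(** * Mean and variance of the centred normal law *)

Section NormalMoments.
Context {R : realType}.
Local Open Scope ereal_scope.
Local Notation mu := (@lebesgue_measure R).

Lemma ge0_integral_normal (s : R) (f : R -> \bar R) :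
  measurable_fun setT f -> (forall x, 0 <= f x) ->
  \int[normal_prob 0 s]_x f x = \int[mu]_x (f x * (normal_pdf 0 s x)%:E).
Proof.
move=> mf f0.
have dom : normal_prob 0 s `<< mu := normal_prob_dominates 0 s.
rewrite -(Radon_Nikodym_SigmaFinite.change_of_variables dom)//.
have mRN : measurable_fun setT (Radon_Nikodym_SigmaFinite.f (normal_prob 0 s) mu).
  by case/integrableP : (Radon_Nikodym_SigmaFinite.f_integrable dom).
have mpdf : measurable_fun setT (fun x => (normal_pdf 0 s x)%:E).
  by apply/measurable_EFinP; exact: measurable_normal_pdf.
apply: ae_eq_integral => //; [exact: emeasurable_funM|exact: emeasurable_funM|].
apply: ae_eqe_mul2l; apply: integral_ae_eq => //.
  exact: Radon_Nikodym_SigmaFinite.f_integrable.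
by move=> E _ mE; rewrite -Radon_Nikodym_SigmaFinite.f_integral.
Qed.

(** The density is even and Lebesgue measure is invariant under reflection. *)
Lemma normal_prob_sym (s : R) (A : set R) : s != 0%R -> measurable A ->
  normal_prob 0 s (-%R @^-1` A) = normal_prob 0 s A.
Proof.
move=> s0 mA; rewrite /normal_prob.
rewrite (@ge0_integral_image _ _ (measurableTypeR R) (measurableTypeR R) R
  mu mu (-%R) (@oppr_measurable _ _) (@lebesgue_measureN R) A)//.
- apply: eq_integral => x _; congr EFin.
  by rewrite !normal_pdfE// /normal_fun !subr0 sqrrN.
- by apply/measurable_funTS/measurable_EFinP; exact: measurable_normal_pdf.
- by move=> x _; rewrite lee_fin normal_pdf_ge0.
Qed.

Let q (s x : R) : R := normal_pdf 0 s x.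

Let scaled_pdf (s x : R) : (0 < s)%R ->
  (s * q s x = (Num.sqrt (pi *+ 2))^-1 * expR (- x ^+ 2 / (s ^+ 2 *+ 2)))%R.
Proof.
move=> s0; rewrite /q normal_pdfE ?gt_eqF// /normal_peak /normal_fun subr0 mulrA.
congr (_ * _)%R.
by rewrite -mulrnAr sqrtrM ?sqr_ge0// sqrtr_sqr gtr0_norm// invfM mulrA divff
  ?gt_eqF// mul1r.
Qed.

(** h s t = (s^-2 - t^-2) / 2, so that t q_t(x) = s q_s(x) exp(h x^2). *)
Let h (s t : R) := ((t - s) * (t + s) / (2 * s ^+ 2 * t ^+ 2))%R.

Let exponent (s t x : R) : (0 < s)%R -> (0 < t)%R ->
  (- x ^+ 2 / (t ^+ 2 *+ 2) = - x ^+ 2 / (s ^+ 2 *+ 2) + h s t * x ^+ 2)%R.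
Proof. by move=> s0 t0; rewrite /h; field; rewrite !gt_eqF. Qed.

(** This is exp z >= 1 + z at z = h x^2. Integrated over the line, it compares
    the second moment with the total masses of the two densities, which are
    known: the variance comes out without integrating by parts. *)
Lemma pdf_lower (s t x : R) : (0 < s)%R -> (0 < t)%R ->
  ((1 + h s t * x ^+ 2) * (s * q s x) <= t * q t x)%R.
Proof.
move=> s0 t0; rewrite !scaled_pdf// (exponent x s0 t0) expRD.
have := expR_ge1Dx (h s t * x ^+ 2).
have := expR_ge0 (- x ^+ 2 / (s ^+ 2 *+ 2)).
have : (0 <= (Num.sqrt (pi *+ 2))^-1 :> R)%R by rewrite invr_ge0.
set a := (_^-1)%R; set e := expR _; set e' := expR _ => a0 e0 e1.
by rewrite mulrCA mulrA -mulrA ler_wpM2l// mulrC ler_wpM2l.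
Qed.

Let mM s : measurable_fun setT (fun x : R => (x ^+ 2 * q s x)%R).
Proof.
apply: measurable_funM; first exact: measurable_funX.
exact: measurable_normal_pdf.
Qed.

Let q0 s x : (0 <= q s x)%R. Proof. exact: normal_pdf_ge0. Qed.

Let iqZ (k s : R) : mu.-integrable setT (EFin \o (fun x => k * q s x)%R).
Proof. exact: (integrableZl measurableT k (integrable_normal_pdf 0 s)). Qed.

Let IqZ (k s : R) : (\int[mu]_x (k * q s x) = k)%R.
Proof.
rewrite RintegralZl//; last exact: integrable_normal_pdf.
by rewrite /Rintegral integral_normal_pdf mulr1.
Qed.

(** For t = 2 s the number h is positive, and the comparison bounds x^2 q_s(x) by
    a multiple of the density q_t. *)
Lemma moment_integrable (s : R) : (0 < s)%R ->
  mu.-integrable setT (EFin \o (fun x => x ^+ 2 * q s x)%R).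
Proof.
move=> s0; have t0 : (0 < 2 * s)%R by lra.
have h0 : (0 < h s (2 * s))%R.
  by rewrite divr_gt0 ?mulr_gt0 ?exprn_gt0//; lra.
apply: (@le_integrable _ (measurableTypeR R) R mu _ measurableT _
  (EFin \o (fun x => (2 * s) / (h s (2 * s) * s) * q (2 * s) x)%R)) => //.
  by apply/measurable_EFinP; exact: mM.
have c0 : (0 <= 2 * s / (h s (2 * s) * s))%R by rewrite ltW// divr_gt0// mulr_gt0.
move=> x _ /=; rewrite lee_fin (ger0_norm (mulr_ge0 (sqr_ge0 x) (q0 _ _))).
rewrite (ger0_norm (mulr_ge0 c0 (q0 _ _))).
have E : (h s (2 * s) * s * (x ^+ 2 * q s x) <= 2 * s * q (2 * s) x)%R.
  by have := pdf_lower x s0 t0; have := mulr_ge0 (ltW s0) (q0 s x); lra.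
have hs : (0 < h s (2 * s) * s)%R by exact: mulr_gt0.
rewrite -(ler_pM2l hs); apply: (le_trans E); rewrite le_eqVlt; apply/orP; left; apply/eqP.
by field; rewrite !gt_eqF.
Qed.

Local Notation M s := (\int[mu]_x (x ^+ 2 * q s x))%R.

Lemma moment_comparison (s t : R) : (0 < s)%R -> (0 < t)%R ->
  (s + h s t * s * M s <= t)%R.
Proof.
move=> s0 t0; have iM := moment_integrable s0.
have iMZ := integrableZl measurableT (h s t * s)%R iM.
rewrite -[X in (X + _)%R](IqZ s s) -[leRHS](IqZ t t) -RintegralZl// -RintegralD//.
apply: le_Rintegral => //; first exact: (integrableD measurableT (iqZ s s) iMZ).
move=> x _; apply: le_trans (pdf_lower x s0 t0).
by rewrite le_eqVlt; apply/orP; left; apply/eqP; ring.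
Qed.

(** Let t tend to s in [moment_comparison], from above for an upper bound and
    from below, where h is negative, for a lower bound. *)
Lemma normal_second_moment (s : R) : (0 < s)%R ->
  \int[normal_prob 0 s]_x ((x ^+ 2)%:E) = (s ^+ 2)%:E.
Proof.
move=> s0; rewrite ge0_integral_normal//; last 2 first.
  by apply/measurable_EFinP; exact: measurable_funX.
  by move=> x; rewrite lee_fin sqr_ge0.
under eq_integral do rewrite -EFinM.
rewrite integral_EFin_Rintegral//; last exact: moment_integrable.
congr EFin.
have H t : (0 < t)%R -> ((t - s) * ((t + s) * M s) <= (t - s) * (2 * s * t ^+ 2))%R.
  move=> t0; have := moment_comparison s0 t0.
  have -> : (h s t * s * M s = (t - s) * ((t + s) * M s) / (2 * s * t ^+ 2))%R.
    by rewrite /h; field; rewrite !gt_eqF.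
  by rewrite -lerBrDl ler_pdivrMr// !mulr_gt0// exprn_gt0.
apply/eqP; rewrite eq_le; apply/andP; split; apply/ler_addgt0Pr => e e0.
- pose dl := Num.min 1%R (e / (2 * s + 1))%R.
  have d0 : (0 < dl)%R by rewrite lt_min ltr01 divr_gt0//; lra.
  have d1 : (dl <= 1)%R by rewrite ge_min lexx.
  have de : (dl * (2 * s + 1) <= e)%R.
    by rewrite -ler_pdivlMr ?ge_min ?lexx ?orbT//; lra.
  have := H (s + dl)%R (addr_gt0 s0 d0); rewrite addrAC subrr add0r ler_pM2l// => H1.
  have : ((s + dl + s) * M s <= (s + dl + s) * (s + dl) ^+ 2)%R.
    by apply: le_trans H1 _; rewrite ler_wpM2r ?sqr_ge0//; lra.
  by rewrite ler_pM2l; [move=> /le_trans; apply; nra|lra].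
- pose dl := Num.min (s / 2)%R (e / (2 * s))%R.
  have d0 : (0 < dl)%R by rewrite lt_min !divr_gt0//; lra.
  have d1 : (dl <= s / 2)%R by rewrite ge_min lexx.
  have de : (dl * (2 * s) <= e)%R.
    by rewrite -ler_pdivlMr ?ge_min ?lexx ?orbT//; lra.
  have t0 : (0 < s - dl)%R by lra.
  have := H (s - dl)%R t0; rewrite addrAC subrr add0r !mulNr lerN2 ler_pM2l// => H1.
  have : ((s - dl + s) * (s - dl) ^+ 2 <= (s - dl + s) * M s)%R.
    by apply: le_trans H1; rewrite ler_wpM2r ?sqr_ge0//; lra.
  by rewrite ler_pM2l; [nra|lra].
Qed.

End NormalMoments.

Section NormalVariable.
Context d (X : measurableType d) (R : realType) (P : probability X R).
Variables (f : X -> R) (s : R).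
Hypothesis s0 : 0 < s.
Hypothesis mf : measurable_fun setT f.
Hypothesis lawf : forall B, measurable B -> P (f @^-1` B) = normal_prob 0 s B.

Let lawi (h : R -> \bar R) : measurable_fun setT h -> (forall y, 0 <= h y)%E ->
  (\int[normal_prob 0 s]_y h y = \int[P]_x h (f x))%E.
Proof.
move=> mh h0.
by rewrite (@ge0_integral_image _ _ X (measurableTypeR R) R P (normal_prob 0 s)
  f mf lawf setT)// preimage_setT.
Qed.

Lemma normal_variable_sqr : (\int[P]_x ((f x) ^+ 2)%:E = (s ^+ 2)%:E)%E.
Proof.
rewrite -normal_second_moment// lawi//.
- by apply/measurable_EFinP; exact: measurable_funX.
- by move=> y; rewrite lee_fin sqr_ge0.
Qed.

Lemma normal_variable_sqint : sqint P f.
Proof. by split => //; rewrite normal_variable_sqr ltry. Qed.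

(** The variables f and - f have the same law. *)
Lemma normal_variable_mean : \int[P]_x f x = 0.
Proof.
have fi := sqint_integrable normal_variable_sqint.
have mN : @measurable_fun _ _ X (measurableTypeR R) setT (fun x => - f x).
  exact: measurable_funN.
have fNi : P.-integrable setT (EFin \o (fun x => - f x)).
  by rewrite (_ : _ \o _ = (\- (EFin \o f))%E)//; exact: integrableN.
have E1 : (\int[P]_x (f x)%:E = \int[P]_x (- f x)%:E)%E.
  rewrite -(@integral_image _ _ X (measurableTypeR R) R P (normal_prob 0 s)
    f mf lawf (fun y => y%:E))//; last exact: EFin_measurable.
  rewrite -(@integral_image _ _ X (measurableTypeR R) R P (normal_prob 0 s)
    (fun x => - f x) mN _ (fun y => y%:E))//; last exact: EFin_measurable.
  move=> A mA; transitivity (normal_prob 0 s (-%R @^-1` A)); last first.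
    by apply: normal_prob_sym => //; rewrite gt_eqF.
  rewrite -lawf//.
  by rewrite -[X in measurable X]setTI; exact: oppr_measurable.
have : \int[P]_x f x = \int[P]_x (- f x) by rewrite /Rintegral E1.
have -> : \int[P]_x (- f x) = - \int[P]_x f x.
  rewrite (_ : (fun x => _) = (fun x => -1 * f x)); last first.
    by apply/funext => x; rewrite mulN1r.
  by rewrite RintegralZl// mulN1r.
lra.
Qed.

End NormalVariable.

(** * The Euclidean norm of matrices *)

Section EuclideanNorm.
Context {R : realType} {p q : nat}.
Implicit Types A B : 'M[R]_(p, q).

(** The Frobenius inner product, whose norm is [enorm]. *)
Definition mxdot A B : R := \sum_i \sum_j A i j * B i j.

Lemma mxdot_ge0 A : 0 <= mxdot A A.
Proof. by apply: sumr_ge0 => i _; apply: sumr_ge0 => j _; rewrite -expr2 sqr_ge0. Qed.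

Lemma enorm_ge0 A : 0 <= enorm A. Proof. exact: sqrtr_ge0. Qed.

Lemma sqr_enormE A : enorm A ^+ 2 = \sum_i \sum_j A i j ^+ 2.
Proof.
rewrite sqr_sqrtr//; apply: sumr_ge0 => i _; apply: sumr_ge0 => j _.
exact: sqr_ge0.
Qed.

Lemma sqr_enorm A : enorm A ^+ 2 = mxdot A A.
Proof. by rewrite sqr_enormE. Qed.

Lemma mxdotC A B : mxdot A B = mxdot B A.
Proof. by apply: eq_bigr => i _; apply: eq_bigr => j _; rewrite mulrC. Qed.

Lemma mxdotDl A A' B : mxdot (A + A') B = mxdot A B + mxdot A' B.
Proof.
rewrite /mxdot -big_split/=; apply: eq_bigr => i _.
by rewrite -big_split/=; apply: eq_bigr => j _; rewrite mxE mulrDl.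
Qed.

Lemma mxdotZl a A B : mxdot (a *: A) B = a * mxdot A B.
Proof.
rewrite /mxdot mulr_sumr; apply: eq_bigr => i _.
by rewrite mulr_sumr; apply: eq_bigr => j _; rewrite mxE mulrA.
Qed.

Lemma mxdotDr A B B' : mxdot A (B + B') = mxdot A B + mxdot A B'.
Proof. by rewrite mxdotC mxdotDl !(mxdotC A). Qed.

Lemma mxdotZr a A B : mxdot A (a *: B) = a * mxdot A B.
Proof. by rewrite mxdotC mxdotZl mxdotC. Qed.

Lemma enorm_eq0 A : enorm A = 0 -> A = 0.
Proof.
move=> A0; have : \sum_i \sum_j A i j ^+ 2 = 0 by rewrite -sqr_enormE A0 expr0n.
move/eqP; rewrite psumr_eq0 => [/allP H|i _]; last first.
  by apply: sumr_ge0 => j _; rewrite sqr_ge0.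
apply/matrixP => i j; rewrite mxE.
have := H i (mem_index_enum _); rewrite psumr_eq0 => [/allP H'|k _]; last first.
  by rewrite sqr_ge0.
by have := H' j (mem_index_enum _); rewrite sqrf_eq0 => /eqP.
Qed.

(** Cauchy-Schwarz, by expanding the square of |B| A - |A| B. *)
Lemma mxdot_le A B : mxdot A B <= enorm A * enorm B.
Proof.
have [A0|A0] := eqVneq (enorm A) 0.
  by rewrite A0 mul0r (enorm_eq0 A0) -(scale0r B) mxdotZl mul0r.
have [B0|B0] := eqVneq (enorm B) 0.
  by rewrite B0 mulr0 (enorm_eq0 B0) -(scale0r A) mxdotZr mul0r.
have ab : 0 < enorm A * enorm B.
  by rewrite mulr_gt0// lt_def ?A0 ?B0 enorm_ge0.
rewrite -(ler_pM2l ab).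
have := mxdot_ge0 (enorm B *: A + (- enorm A) *: B).
rewrite !(mxdotDl, mxdotDr, mxdotZl, mxdotZr) (mxdotC B A) -!sqr_enorm.
by set a := enorm A; set b := enorm B; set c := mxdot A B; nra.
Qed.

Lemma enormZ a A : enorm (a *: A) = `|a| * enorm A.
Proof.
apply/eqP; rewrite -(@eqrXn2 _ 2)// ?mulr_ge0 ?enorm_ge0//.
by rewrite sqr_enorm mxdotZl mxdotZr mulrA -expr2 exprMn real_normK ?num_real// sqr_enorm.
Qed.

Lemma enormN A : enorm (- A) = enorm A.
Proof. by rewrite -scaleN1r enormZ normrN1 mul1r. Qed.

Lemma ler_enormD A B : enorm (A + B) <= enorm A + enorm B.
Proof.
rewrite -ler_sqr ?nnegrE// ?addr_ge0 ?enorm_ge0//.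
rewrite sqr_enorm !(mxdotDl, mxdotDr) (mxdotC B A) -!sqr_enorm sqrrD.
by have := mxdot_le A B; rewrite mulr2n; lra.
Qed.

Lemma ler_enormB A B : enorm (A - B) <= enorm A + enorm B.
Proof. by rewrite -(enormN B) ler_enormD. Qed.

Lemma ler_coord_enorm A i j : `|A i j| <= enorm A.
Proof.
rewrite -ler_sqr ?nnegrE// ?enorm_ge0// real_normK ?num_real//.
rewrite sqr_enormE (bigD1 i)//= (bigD1 j)//= -addrA lerDl addr_ge0//.
  by apply: sumr_ge0 => k _; exact: sqr_ge0.
by apply: sumr_ge0 => k _; apply: sumr_ge0 => l _; exact: sqr_ge0.
Qed.

End EuclideanNorm.

(** * Measurability of matrix-valued maps *)

Section BorelMatrices.
Context {R : realType} {p q : nat}.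

Let opens := [set O : set 'M[R]_(p, q) | open O].

Lemma measurable_coord i j :
  @measurable_fun _ _ (g_sigma_algebraType opens) R setT
    (fun A : 'M[R]_(p, q) => A i j).
Proof.
apply: (measurability (@RGenOInfty.G R)); first exact: RGenOInfty.measurableE.
move=> _ [_ [x ->] <-]; rewrite setTI; apply: sub_sigma_algebra.
rewrite /opens/=; apply: open_comp; last exact: interval_open.
by move=> A _; exact: coord_continuous.
Qed.

Lemma measurable_wrt_coord (U : Type) (D : set U) (G : set (set U))
  (f : U -> 'M[R]_(p, q)) i j (B : set R) :
  measurable_wrt D G (@borel _) f -> measurable B ->
  G (D `&` (fun x => f x i j) @^-1` B).
Proof.
move=> mf mB; have := @measurable_coord i j measurableT B mB; rewrite setTI.
exact: mf.
Qed.

(** An open set of matrices is a countable union of boxes with rational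
    centres, and the preimage of a box is cut out by finitely many conditions
    on the entries. *)
Lemma measurable_of_coord d (X : measurableType d) (D : set X)
    (f : X -> 'M[R]_(p, q)) : measurable D ->
  (forall i j, measurable_fun D (fun x => f x i j)) ->
  measurable_wrt D measurable (@borel _) f.
Proof.
move=> mD mf.
suff H : @measurable_fun _ _ X (g_sigma_algebraType opens) D f.
  by move=> B mB; exact: H.
apply: (@measurability _ _ X (g_sigma_algebraType opens) D f opens) => // _ [U oU <-].
pose S := [set c : 'M[rat]_(p, q) * nat |
  [set A : 'M[R]_(p, q) | forall i j, `|ratr (c.1 i j) - A i j| < c.2.+1%:R^-1]
    `<=` U].
have -> : D `&` f @^-1` U = \bigcup_(c in S)
    (D `&` [set x | forall i j, `|ratr (c.1 i j) - f x i j| < c.2.+1%:R^-1]).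
  apply/seteqP; split => [x [Dx Ufx]|x [c Sc [Dx /=]]]; last first.
    by move=> H; split => //; exact: Sc.
  have /nbhs_ballP[e /= e0 eU] : nbhs (f x) U by exact: open_nbhs_nbhs.
  have [k [r [rE ke k0]]] : exists k r, [/\ r = k.+1%:R^-1, r < e / 2 & 0 < r :> R].
    have e20 : 0 < e / 2 by rewrite divr_gt0.
    have [k _ H] := near_infty_natSinv_lt (PosNum e20).
    by exists k, k.+1%:R^-1; split => //; exact: (H k (leqnn k)).
  have /choice[c Hc] : forall ij : 'I_p * 'I_q, exists a : rat,
      `|ratr a - f x ij.1 ij.2| < r.
    move=> [i j] /=.
    have : f x i j - r < f x i j + r by lra.
    move=> /rat_in_itvoo[a]; rewrite in_itv/= => /andP[r1 r2].
    by exists a; rewrite ltr_norml; apply/andP; split; lra.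
  exists ((\matrix_(i, j) c (i, j)), k); last first.
    by split => // i j /=; rewrite mxE -rE; exact: (Hc (i, j)).
  move=> A /= HA; apply: eU; split => // i j.
  rewrite -ball_normE/= -[f x i j](subrK (ratr (c (i, j)))) -addrA.
  rewrite (le_lt_trans (ler_normD _ _))//.
  have := HA i j; have := Hc (i, j); rewrite mxE/= -rE distrC; lra.
rewrite bigcup_mkcond; apply: countable_bigcupT_measurable => [|c].
  exact: countableP.
case: ifPn => // _.
rewrite (_ : _ `&` _ = D `&` \bigcap_(ij in [set: 'I_p * 'I_q])
   (D `&` [set x | `|ratr (c.1 ij.1 ij.2) - f x ij.1 ij.2| < c.2.+1%:R^-1])).
  apply: measurableI => //; apply: fin_bigcap_measurable => [|[i j] _].
    exact: finite_finset.
  rewrite /=.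
  have mg : measurable_fun D (fun x => `|ratr (c.1 i j) - f x i j|).
    by apply: measurableT_comp => //; apply: measurable_funB.
  have := mg mD _ (@measurable_itv R `]-oo, c.2.+1%:R^-1[).
  by congr (measurable _); apply/seteqP; split=> x /=; rewrite in_itv/=.
apply/seteqP; split => [x [Dx H]|x [Dx H]]; split => //.
  by move=> [i j] _; split => //; exact: H.
by move=> i j; have [] := H (i, j) I.
Qed.

Lemma measurable_sum_sqr d (X : measurableType d) (D : set X)
    (f : X -> 'M[R]_(p, q)) :
  (forall i j, measurable_fun D (fun x => f x i j)) ->
  measurable_fun D (fun x => enorm (f x) ^+ 2).
Proof.
move=> mf; under eq_fun do rewrite sqr_enormE.
apply: measurable_sum => i; apply: measurable_sum => j.
exact: measurable_funX.
Qed.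

Lemma measurable_enorm d (X : measurableType d) (D : set X)
    (f : X -> 'M[R]_(p, q)) :
  (forall i j, measurable_fun D (fun x => f x i j)) ->
  measurable_fun D (fun x => enorm (f x)).
Proof.
move=> mf; rewrite (_ : (fun x => _) =
  Num.sqrt \o (fun x => \sum_i \sum_j f x i j ^+ 2))//.
apply: measurableT_comp.
  by apply: continuous_measurable_fun; exact: sqrt_continuous.
apply: measurable_sum => i; apply: measurable_sum => j.
exact: measurable_funX.
Qed.

End BorelMatrices.

Section SubSigma.
Context d (X : measurableType d) (R : realType).

Definition submeasurable (H : set (set X)) (f : X -> R) : Prop :=
  forall B, measurable B -> H (f @^-1` B).

Lemma submeasurableP (G : set (set X)) (f : X -> R) :
  submeasurable <<s G>> f <->
  @measurable_fun _ _ (g_sigma_algebraType G) R setT f.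
Proof.
split=> [mf _ B mB|mf B mB]; first by rewrite setTI; exact: mf.
by have := mf measurableT B mB; rewrite setTI.
Qed.

Lemma submeasurable_le (H H' : set (set X)) f : H `<=` H' ->
  submeasurable H f -> submeasurable H' f.
Proof. by move=> HH mf B mB; apply: HH; exact: mf. Qed.

Lemma submeasurable_measurable (H : set (set X)) f :
  H `<=` measurable -> submeasurable H f -> measurable_fun setT f.
Proof. by move=> HH mf _ B mB; rewrite setTI; apply: HH; exact: mf. Qed.

Lemma submeasurable_coord (H : set (set X)) p q (f : X -> 'M[R]_(p, q)) i j :
  measurable_wrt setT H (@borel _) f -> submeasurable H (fun x => f x i j).
Proof.
by move=> mf B mB; have := measurable_wrt_coord i j mf mB; rewrite setTI.
Qed.

End SubSigma.

(** * Covariances of Brownian increments *)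

Section BrownianIncrements.
Context {R : realType} {disp : measure_display} {Omega : measurableType disp}.
Variables (P : probability Omega R) (T : \bar R).
Variable F : \bar R -> set (set Omega).
Context {d : nat}.
Variable W : R -> Omega -> 'cV[R]_d.
Hypothesis hW : brownian_basis P T F W.

Let gens (t : \bar R) : set (set Omega) :=
  [set N | P.-negligible N] `|`
  [set A | exists s, exists2 B, borel B &
     rtime 0 T s /\ (s%:E <= t)%E /\ A = W s @^-1` B].

Lemma filtrationE t : (0 <= t <= T)%E -> F t = <<s gens t>>.
Proof. exact: (bb_generated hW). Qed.

Lemma filtration_le s t : (0 <= s)%E -> (s <= t)%E -> (t <= T)%E ->
  F s `<=` F t.
Proof.
move=> s0 st tT; rewrite !filtrationE ?s0 ?(le_trans s0 st) ?(le_trans st tT)//.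
apply: sub_sigma_algebra2 => A [NA|[r [B bB [rT [rs ->]]]]]; first by left.
by right; exists r, B => //; split => //; split => //; exact: le_trans st.
Qed.

Lemma filtration_measurable t : (0 <= t <= T)%E -> F t `<=` measurable.
Proof. by move=> /andP[t0 tT]; rewrite -(bb_final hW); exact: filtration_le. Qed.

Definition adapted t (f : Omega -> R) := submeasurable (F t) f.

Lemma adaptedP t f : (0 <= t <= T)%E ->
  adapted t f <-> @measurable_fun _ _ (g_sigma_algebraType (gens t)) R setT f.
Proof. by move=> tT; rewrite /adapted filtrationE//; exact: submeasurableP. Qed.

Lemma adapted_le s t f : (0 <= s)%E -> (s <= t)%E -> (t <= T)%E ->
  adapted s f -> adapted t f.
Proof. by move=> s0 st tT; apply: submeasurable_le; exact: filtration_le. Qed.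

Lemma adapted_measurable t f : (0 <= t <= T)%E -> adapted t f ->
  measurable_fun setT f.
Proof.
by move=> tT; apply: submeasurable_measurable; exact: filtration_measurable.
Qed.

Lemma adaptedM t f g : (0 <= t <= T)%E -> adapted t f -> adapted t g ->
  adapted t (fun w => f w * g w).
Proof.
move=> tT /adaptedP-/(_ tT) mf /adaptedP-/(_ tT) mg; apply/adaptedP => //.
exact: measurable_funM.
Qed.

Lemma adaptedB t f g : (0 <= t <= T)%E -> adapted t f -> adapted t g ->
  adapted t (fun w => f w - g w).
Proof.
move=> tT /adaptedP-/(_ tT) mf /adaptedP-/(_ tT) mg; apply/adaptedP => //.
exact: measurable_funB.
Qed.

Definition incr (a b : R) (k : 'I_d) (w : Omega) : R :=
  W b w k ord0 - W a w k ord0.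

Lemma adapted_brownian s t k : 0 <= s -> (s%:E <= t)%E -> (t <= T)%E ->
  adapted t (fun w => W s w k ord0).
Proof.
move=> s0 st tT; have t0 : (0 <= t)%E by rewrite (le_trans _ st)// lee_fin.
rewrite /adapted filtrationE ?t0// => B mB; apply: sub_sigma_algebra; right.
exists s, [set x : 'cV[R]_d | B (x k ord0)].
  by have := @measurable_coord R d 1 k ord0 measurableT B mB; rewrite setTI.
by split; [rewrite /rtime/= lee_fin s0 (le_trans st tT)|split].
Qed.

Lemma adapted_incr a b t k : 0 <= a -> 0 <= b -> (a%:E <= t)%E -> (b%:E <= t)%E ->
  (t <= T)%E -> adapted t (incr a b k).
Proof.
move=> a0 b0 at_ bt tT; apply: adaptedB; try exact: adapted_brownian.
by rewrite (le_trans _ at_)// lee_fin.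
Qed.

Lemma measurable_incr a b k : 0 <= a -> a <= b -> (b%:E <= T)%E ->
  measurable_fun setT (incr a b k).
Proof.
move=> a0 ab bT; apply: (@adapted_measurable b%:E).
  by rewrite lee_fin (le_trans a0 ab).
by apply: adapted_incr; rewrite ?lee_fin// (le_trans a0 ab).
Qed.

Lemma incr_law a b k B : 0 <= a -> a < b -> (b%:E <= T)%E -> measurable B ->
  P (incr a b k @^-1` B) = normal_prob 0 (Num.sqrt (b - a)) B.
Proof.
move=> a0 ab bT mB.
have := @bm_gaussian _ _ _ _ _ _ _ _ (bb_brownian hW) a b
  (fun j => if j == k then B else setT) a0 ab bT.
rewrite (bigD1 k)//= eqxx big1 ?mule1 => [<-|j /negbTE ->]; last 2 first.
- by move=> j; case: ifP.
- exact: (integral_normal_pdf 0 _).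
congr (P _); apply/seteqP; split => w /=; rewrite /incr.
- by move=> Bw j; case: eqP => // ->; rewrite !mxE.
- by move=> /(_ k); rewrite eqxx !mxE.
Qed.

Lemma incr_law2 a b k l A B : k != l -> 0 <= a -> a < b -> (b%:E <= T)%E ->
  measurable A -> measurable B ->
  (P (incr a b k @^-1` A `&` incr a b l @^-1` B) =
  P (incr a b k @^-1` A) * P (incr a b l @^-1` B))%E.
Proof.
move=> kl a0 ab bT mA mB; rewrite !incr_law//.
have := @bm_gaussian _ _ _ _ _ _ _ _ (bb_brownian hW) a b
  (fun j => if j == k then A else if j == l then B else setT) a0 ab bT.
rewrite (bigD1 k)//= eqxx (bigD1 l)//= 1?eq_sym//= (negbTE kl) eqxx.
rewrite big1 ?mule1 => [<-|j /andP[/negbTE -> /negbTE ->]]; last 2 first.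
- by move=> j; case: ifP => // _; case: ifP.
- exact: (integral_normal_pdf 0 _).
congr (P _); apply/seteqP; split => w /=; rewrite /incr.
- move=> [Aw Bw] j; case: eqP => [->|_]; first by rewrite !mxE.
  by case: eqP => // ->; rewrite !mxE.
- move=> H; split; first by have := H k; rewrite eqxx !mxE.
  by have := H l; rewrite (eq_sym l) (negbTE kl) eqxx !mxE.
Qed.

Lemma incrxx a k w : incr a a k w = 0. Proof. by rewrite /incr subrr. Qed.

Lemma incr_split a b c k w : incr a c k w = incr a b k w + incr b c k w.
Proof. by rewrite /incr; ring. Qed.

Lemma incr_sqint a b k : 0 <= a -> a <= b -> (b%:E <= T)%E ->
  sqint P (incr a b k).
Proof.
move=> a0; rewrite le_eqVlt => /orP[/eqP <- _|ab bT].
  by rewrite (_ : incr a a k = fun=> 0)//; [exact: sqint0|apply/funext => w; exact: incrxx].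
apply: (@normal_variable_sqint _ _ _ _ _ (Num.sqrt (b - a))).
- by rewrite sqrtr_gt0 subr_gt0.
- by apply: measurable_incr => //; exact: ltW.
- by move=> B mB; exact: incr_law.
Qed.

Lemma incr_mean a b k : 0 <= a -> a <= b -> (b%:E <= T)%E ->
  \int[P]_w incr a b k w = 0.
Proof.
move=> a0; rewrite le_eqVlt => /orP[/eqP <- _|ab bT].
  by under eq_Rintegral do rewrite incrxx; rewrite Rintegral_cst//= mul0r.
apply: (@normal_variable_mean _ _ _ _ _ (Num.sqrt (b - a))).
- by rewrite sqrtr_gt0 subr_gt0.
- by apply: measurable_incr => //; exact: ltW.
- by move=> B mB; exact: incr_law.
Qed.

Lemma incr_covariance a b k l : 0 <= a -> a <= b -> (b%:E <= T)%E ->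
  \int[P]_w (incr a b k w * incr a b l w) = (k == l)%:R * (b - a).
Proof.
move=> a0; rewrite le_eqVlt => /orP[/eqP <- _|ab bT].
  under eq_Rintegral do rewrite incrxx mul0r.
  by rewrite Rintegral_cst//= mul0r subrr mulr0.
have [<-|kl] := eqVneq k l.
  rewrite mul1r /Rintegral; under eq_integral do rewrite -expr2.
  rewrite (@normal_variable_sqr _ _ _ _ _ (Num.sqrt (b - a)))//=.
  - by rewrite sqr_sqrtr// subr_ge0 ltW.
  - by rewrite sqrtr_gt0 subr_gt0.
  - by apply: measurable_incr => //; exact: ltW.
  - by move=> B mB; exact: incr_law.
have ilt := ltW ab.
rewrite mul0r independent_expectation//.
- by rewrite incr_mean// mul0r.
- exact: measurable_incr.
- exact: measurable_incr.
- by move=> A B mA mB; exact: incr_law2.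
- exact/sqint_integrable/incr_sqint.
- exact/sqint_integrable/incr_sqint.
- by apply: sqint_mul; exact: incr_sqint.
Qed.

(** The increment over ]a, b] is independent of F_a; it is constant if a = b, a
    case on which the axioms of Brownian motion are silent. *)
Lemma past_increment_expectation a b (psi g : Omega -> R) (h : 'cV[R]_d -> R) :
  0 <= a -> a <= b -> (b%:E <= T)%E ->
  adapted a%:E psi -> P.-integrable setT (EFin \o psi) ->
  (forall B, measurable B -> borel (h @^-1` B)) ->
  (forall w, g w = h (W b w - W a w)) ->
  measurable_fun setT g -> P.-integrable setT (EFin \o g) ->
  P.-integrable setT (EFin \o (fun w => psi w * g w)) ->
  \int[P]_w (psi w * g w) = \int[P]_w psi w * \int[P]_w g w.
Proof.
move=> a0 + bT apsi ipsi mh gE mg ig ipg.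
have aT : (0 <= a%:E)%E by rewrite lee_fin.
rewrite le_eqVlt => /orP[/eqP ab|ab].
  have g0 w : g w = h 0 by rewrite gE -ab subrr.
  under eq_Rintegral do rewrite g0.
  rewrite RintegralZr//; congr (_ * _).
  under eq_Rintegral do rewrite g0.
  by rewrite Rintegral_cst//= probability_setT/= mulr1.
have abT : (a%:E <= T)%E by rewrite (le_trans _ bT)// lee_fin ltW.
apply: independent_expectation => //.
  by apply: adapted_measurable apsi; rewrite aT.
move=> A B mA mB.
have -> : g @^-1` B = [set w | (h @^-1` B) (W b w - W a w)].
  by apply/seteqP; split => w /=; rewrite gE.
apply: (bm_independent (bb_brownian hW)) => //.
- exact: apsi.
- exact: mh.
Qed.

Let incrE a b k w : incr a b k w = (W b w - W a w) k ord0.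
Proof. by rewrite !mxE. Qed.

Lemma increment_centered a b k (psi : Omega -> R) :
  0 <= a -> a <= b -> (b%:E <= T)%E -> adapted a%:E psi -> sqint P psi ->
  \int[P]_w (psi w * incr a b k w) = 0.
Proof.
move=> a0 ab bT apsi psi2.
rewrite (@past_increment_expectation a b psi _ (fun x => x k ord0))//.
- by rewrite incr_mean// mulr0.
- exact: sqint_integrable.
- move=> B mB.
  by have := @measurable_coord R d 1 k ord0 measurableT B mB; rewrite setTI.
- exact: measurable_incr.
- exact/sqint_integrable/incr_sqint.
- by apply: sqint_mul => //; exact: incr_sqint.
Qed.

Lemma increment_square a b k l (psi : Omega -> R) (C : R) :
  0 <= a -> a <= b -> (b%:E <= T)%E -> adapted a%:E psi ->
  (forall w, `|psi w| <= C) ->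
  \int[P]_w (psi w * (incr a b k w * incr a b l w)) =
  (k == l)%:R * (b - a) * \int[P]_w psi w.
Proof.
move=> a0 ab bT apsi psiC.
have aT : (0 <= a%:E <= T)%E by rewrite lee_fin a0 (le_trans _ bT)// lee_fin.
have mpsi := adapted_measurable aT apsi.
rewrite (@past_increment_expectation a b psi _ (fun x => x k ord0 * x l ord0))//.
- by rewrite mulrC incr_covariance.
- exact/sqint_integrable/(sqint_bounded P mpsi psiC).
- move=> B mB.
  have mm : @measurable_fun _ _ (g_sigma_algebraType [set U : set 'cV[R]_d | open U])
      R setT (fun x : 'cV[R]_d => x k ord0 * x l ord0).
    by apply: measurable_funM; exact: measurable_coord.
  by have := mm measurableT B mB; rewrite setTI.
- by move=> w; rewrite !incrE.
- by apply: measurable_funM; exact: measurable_incr.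
- by apply: sqint_mul; exact: incr_sqint.
- rewrite (_ : _ \o _ = EFin \o (fun w => (psi w * incr a b k w) * incr a b l w)).
    apply: sqint_mul; last exact: incr_sqint.
    by apply: (@sqintM_bounded _ _ _ _ _ _ C) => //; exact: incr_sqint.
  by apply/funext => w /=; rewrite mulrA.
Qed.

(** The length of the intersection of ]a, b] and ]a', b']. *)
Definition overlap (a b a' b' : R) : R :=
  Num.max 0 (Num.min b b' - Num.max a a').

Lemma overlapC a b a' b' : overlap a b a' b' = overlap a' b' a b.
Proof. by rewrite /overlap minC (maxC a). Qed.

(** Cut both increments at a' and at c = min b b'. Only the product of the two
    increments over ]a', c] contributes: in each other term, the increment that
    comes last is independent of the remaining factors and has mean 0. *)
Lemma elementary_covariance_le (a b a' b' : R) (k l : 'I_d) (f g : Omega -> R) (C D : R) :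
  0 <= a -> a <= b -> (b%:E <= T)%E -> a' <= b' -> (b'%:E <= T)%E -> a <= a' ->
  adapted a%:E f -> adapted a'%:E g ->
  (forall w, `|f w| <= C) -> (forall w, `|g w| <= D) ->
  \int[P]_w ((f w * incr a b k w) * (g w * incr a' b' l w)) =
  (k == l)%:R * overlap a b a' b' * \int[P]_w (f w * g w).
Proof.
move=> a0 ab bT a'b' b'T aa' af ag fC gD.
have a'0 : 0 <= a' by lra.
have a'T : (0 <= a'%:E <= T)%E by rewrite lee_fin a'0 (le_trans _ b'T)// lee_fin.
have /andP[_ a'T1] := a'T.
have af' : adapted a'%:E f by apply: adapted_le af => //; rewrite lee_fin.
have afg : adapted a'%:E (fun w => f w * g w) by exact: adaptedM.
have mfg := adapted_measurable a'T afg.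
have fgCD w : `|f w * g w| <= C * D.
  by rewrite normrM ler_pM.
have [ba'|a'b] := leP b a'.
  have -> : overlap a b a' b' = 0.
    rewrite /overlap max_l// subr_le0 (le_trans _ (_ : a' <= _))//.
      by rewrite ge_min ba'.
    by rewrite le_max lexx orbT.
  rewrite mulr0 mul0r.
  rewrite (_ : (fun w => _) = fun w => (f w * g w * incr a b k w) * incr a' b' l w); last first.
    by apply/funext => w; ring.
  apply: increment_centered => //.
  - by apply: adaptedM => //; apply: adapted_incr; rewrite ?lee_fin//; lra.
  - by apply: (@sqintM_bounded _ _ _ _ _ _ (C * D)) => //; exact: incr_sqint.
have -> : overlap a b a' b' = Num.min b b' - a'.
  by rewrite /overlap (max_r aa') max_r// subr_ge0 le_min (ltW a'b).
pose c := Num.min b b'.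
have ca' : a' <= c by rewrite le_min (ltW a'b).
have cb : c <= b by rewrite ge_min lexx.
have cb' : c <= b' by rewrite ge_min lexx orbT.
have cT : (c%:E <= T)%E by rewrite (le_trans _ bT)// lee_fin.
have c0 : 0 <= c by lra.
(* one of the two increments beyond c is empty, so their product vanishes *)
have cc : c = b \/ c = b' by rewrite /c /Num.min; case: ifP; [left|right].
pose psi w := f w * g w.
have s1 k' : sqint P (fun w => psi w * incr a' c k' w).
  by apply: (@sqintM_bounded _ _ _ _ _ _ (C * D)) => //; exact: incr_sqint.
have s2 k' b1 : c <= b1 -> (b1%:E <= T)%E -> sqint P (fun w => incr c b1 k' w).
  by move=> ? ?; exact: incr_sqint.
have e1 : (fun w => (f w * incr a b k w) * (g w * incr a' b' l w)) =
  (fun w => ((psi w * incr a a' k w) * incr a' b' l w +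
      psi w * (incr a' c k w * incr a' c l w)) +
     ((psi w * incr a' c k w) * incr c b' l w +
      (psi w * incr a' c l w) * incr c b k w)).
  apply/funext => w; rewrite (incr_split a a' b) (incr_split a' c b) (incr_split a' c b').
  have Z : incr c b k w * incr c b' l w = 0.
    by case: cc => <-; rewrite incrxx ?mul0r ?mulr0.
  apply/eqP; rewrite -subr_eq0; apply/eqP.
  transitivity (psi w * (incr c b k w * incr c b' l w)); first by rewrite /psi; ring.
  by rewrite Z mulr0.
have i1 : P.-integrable setT (EFin \o (fun w => (psi w * incr a a' k w) * incr a' b' l w)).
  apply: sqint_mul; last exact: incr_sqint.
  by apply: (@sqintM_bounded _ _ _ _ _ _ (C * D)) => //; exact: incr_sqint.
have i2 : P.-integrable setT (EFin \o (fun w => psi w * (incr a' c k w * incr a' c l w))).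
  rewrite (_ : _ \o _ = EFin \o (fun w => (psi w * incr a' c k w) * incr a' c l w)).
    by apply: sqint_mul => //; exact: incr_sqint.
  by apply/funext => w /=; rewrite mulrA.
have i3 : P.-integrable setT (EFin \o (fun w => (psi w * incr a' c k w) * incr c b' l w)).
  by apply: sqint_mul => //; exact: s2.
have i4 : P.-integrable setT (EFin \o (fun w => (psi w * incr a' c l w) * incr c b k w)).
  by apply: sqint_mul => //; exact: s2.
have ac k' : adapted c%:E (fun w => psi w * incr a' c k' w).
  apply: adaptedM; first by rewrite lee_fin c0.
    by apply: adapted_le afg => //; rewrite lee_fin.
  by apply: adapted_incr; rewrite ?lee_fin.
rewrite e1 RintegralD//; last 2 first.
- rewrite (_ : _ \o _ = (fun w => ((psi w * incr a a' k w) * incr a' b' l w)%:E +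
   (psi w * (incr a' c k w * incr a' c l w))%:E)%E)//; exact: integrableD.
- rewrite (_ : _ \o _ = (fun w => ((psi w * incr a' c k w) * incr c b' l w)%:E +
   ((psi w * incr a' c l w) * incr c b k w)%:E)%E)//; exact: integrableD.
rewrite !RintegralD// (increment_square _ _ a'0 ca' cT afg fgCD).
rewrite (increment_centered k c0 cb bT (ac l) (s1 l)).
rewrite (increment_centered l c0 cb' b'T (ac k) (s1 k)) !addr0.
rewrite increment_centered ?add0r//.
- apply: adaptedM => //; apply: adapted_incr; rewrite ?lee_fin//.
- by apply: (@sqintM_bounded _ _ _ _ _ _ (C * D)) => //; exact: incr_sqint.
Qed.

Lemma elementary_covariance (a b a' b' : R) (k l : 'I_d) (f g : Omega -> R) (C D : R) :
  0 <= a -> a <= b -> (b%:E <= T)%E -> 0 <= a' -> a' <= b' -> (b'%:E <= T)%E ->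
  adapted a%:E f -> adapted a'%:E g ->
  (forall w, `|f w| <= C) -> (forall w, `|g w| <= D) ->
  \int[P]_w ((f w * incr a b k w) * (g w * incr a' b' l w)) =
  (k == l)%:R * overlap a b a' b' * \int[P]_w (f w * g w).
Proof.
move=> a0 ab bT a'0 a'b' b'T af ag fC gD.
have [aa'|/ltW a'a] := leP a a'; first exact: (elementary_covariance_le _ _ _ _ _ _ _ _ _ _ fC gD).
under eq_Rintegral do rewrite mulrC.
rewrite (elementary_covariance_le _ _ _ _ _ _ _ _ _ _ gD fC)// overlapC eq_sym.
by under eq_Rintegral do rewrite mulrC.
Qed.

End BrownianIncrements.

Section RealTime.
Context {R : realType}.

Lemma measurable_rtime (a b : \bar R) :
  @measurable _ (measurableTypeR R) (rtime a b).
Proof.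
have := @EFin_measurable R setT measurableT _ (emeasurable_itv `[a, b]).
by rewrite setTI; congr measurable; apply/seteqP; split => x /=; rewrite in_itv.
Qed.

(** The deterministic counterpart of [elementary_covariance]. *)
Lemma integral_indicator_overlap (T : \bar R) (a b a' b' c : R) :
  0 <= a -> a <= b -> (b%:E <= T)%E -> 0 <= a' -> a' <= b' -> (b'%:E <= T)%E ->
  let f := fun s : measurableTypeR R => (a < s <= b)%R%:R * (a' < s <= b')%R%:R * c in
  lebesgue_measure.-integrable (rtime 0 T) (EFin \o f) /\
  \int[lebesgue_measure]_(s in rtime 0 T) f s = overlap a b a' b' * c.
Proof.
move=> a0 ab bT a'0 a'b' b'T f.
pose A := Num.max a a'; pose B := Num.min b b'.
pose J : set (measurableTypeR R) := `]A, B]%classic.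
have mJ : measurable J by exact: measurable_itv.
have fE s : f s = c * \1_J s.
  rewrite /f mulrC; congr (_ * _); rewrite indicE -natrM mulnb; congr ((nat_of_bool _)%:R).
  apply/idP/idP; rewrite inE /J /= in_itv/= /A /B gt_max le_min.
    by move=> /andP[/andP[-> ->] /andP[-> ->]].
  by move=> /andP[/andP[-> ->] /andP[-> ->]].
have mD := measurable_rtime 0%E T.
have JD : rtime 0 T `&` J = J.
  apply/setIidPr => s; rewrite /J/= in_itv/= /A /B gt_max le_min.
  move=> /andP[/andP[as_ _] /andP[sb _]]; rewrite /rtime/= !lee_fin.
  rewrite (le_trans a0 (ltW as_))/=.
  by rewrite (le_trans _ bT)// lee_fin.
have lJ : lebesgue_measure J = (overlap a b a' b')%:E.
  rewrite lebesgue_measure_itv/= lte_fin /overlap -/A -/B.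
  case: ifPn => [AB|]; first by rewrite max_r// subr_ge0 ltW.
  by rewrite -leNgt => BA; rewrite max_l// subr_le0.
have I1 : (\int[lebesgue_measure]_(s in rtime 0 T) (\1_J s)%:E =
    (overlap a b a' b')%:E)%E.
  by rewrite integral_indic// setIC JD; exact: lJ.
have i1 : lebesgue_measure.-integrable (rtime 0 T) (EFin \o (\1_J : _ -> R)).
  apply/integrableP; split; first exact/measurable_EFinP/measurable_indic.
  under eq_integral do rewrite /= ger0_norm//.
  by rewrite I1 ltry.
split.
  rewrite (_ : _ \o _ = (fun s => c%:E * (EFin \o (\1_J : _ -> R)) s)%E).
    exact: integrableZl.
  by apply/funext => s /=; rewrite fE.
under eq_Rintegral do rewrite fE.
by rewrite RintegralZl// mulrC /Rintegral I1.
Qed.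

End RealTime.

(** * Elementary stochastic integrals *)

Section ElementaryIto.
Context {R : realType} {disp : measure_display} {Omega : measurableType disp}.
Variables (P : probability Omega R) (T : \bar R).
Variable F : \bar R -> set (set Omega).
Context {d m : nat}.
Variable W : R -> Omega -> 'cV[R]_d.
Hypothesis hW : brownian_basis P T F W.

Section Family.
Variables (J : finType) (a b : J -> R) (Phi : J -> Omega -> 'M[R]_(m, d)).

(** The intervals are indexed by an arbitrary finite type instead of running
    along one time grid: in this form the difference of two simple integrands
    is again an elementary family, indexed by a disjoint union. *)
Definition family_ito (w : Omega) : 'cV[R]_m :=
  \sum_j Phi j w *m (W (b j) w - W (a j) w).

Definition family_process (t : \bar R) (w : Omega) : 'M[R]_(m, d) :=
  \sum_j if ((a j)%:E < t <= (b j)%:E)%E then Phi j w else 0.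

Lemma family_itoE w i :
  family_ito w i ord0 =
  \sum_j \sum_k Phi j w i k * incr W (a j) (b j) k w.
Proof.
rewrite /family_ito summxE; apply: eq_bigr => j _; rewrite mxE.
by apply: eq_bigr => k _; rewrite /incr !mxE.
Qed.

Lemma family_processE (s : R) w i k :
  family_process s%:E w i k = \sum_j (a j < s <= b j)%R%:R * Phi j w i k.
Proof.
rewrite /family_process summxE; apply: eq_bigr => j _.
rewrite lte_fin lee_fin.
by case: ifP => _; rewrite ?mul1r ?mul0r// mxE.
Qed.

Definition elementary_family : Prop :=
  [/\ forall j, 0 <= a j, forall j, a j <= b j, forall j, ((b j)%:E <= T)%E,
      forall j i k, adapted F (a j)%:E (fun w => Phi j w i k) &
      forall j, exists C, forall w, enorm (Phi j w) <= C].

Hypothesis hJ : elementary_family.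

Let a0 j : 0 <= a j. Proof. by case: hJ. Qed.
Let ab j : a j <= b j. Proof. by case: hJ. Qed.
Let bT j : ((b j)%:E <= T)%E. Proof. by case: hJ. Qed.
Let aPhi j i k : adapted F (a j)%:E (fun w => Phi j w i k).
Proof. by case: hJ. Qed.
Let bPhi j : exists C, forall w i k, `|Phi j w i k| <= C.
Proof.
case: hJ => _ _ _ _ /(_ j)[C HC]; exists C => w i k.
exact: le_trans (ler_coord_enorm _ _ _) (HC w).
Qed.
Let mPhi j i k : measurable_fun setT (fun w => Phi j w i k).
Proof.
apply: (adapted_measurable hW) (aPhi j i k).
by rewrite lee_fin a0 (le_trans _ (bT j))// lee_fin.
Qed.

Lemma family_term_sqint j i k :
  sqint P (fun w => Phi j w i k * incr W (a j) (b j) k w).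
Proof.
have [C HC] := bPhi j.
apply: (@sqintM_bounded _ _ _ _ _ _ C) => //.
exact: (incr_sqint hW).
Qed.

Lemma family_ito_sqint i : sqint P (fun w => family_ito w i ord0).
Proof.
under eq_fun do rewrite family_itoE.
by apply: sqint_sum => j; apply: sqint_sum => k; exact: family_term_sqint.
Qed.

(** Each increment is zero or starts after t, and psi Phi_j is known when it
    starts. *)
Lemma family_ito_orthogonal t psi i : (0 <= t <= T)%E ->
  (forall j, (t <= (a j)%:E)%E \/ a j = b j) ->
  adapted F t psi -> sqint P psi ->
  \int[P]_w (psi w * family_ito w i ord0) = 0.
Proof.
move=> /andP[t0 tT] ta apsi psi2.
have -> : (fun w => psi w * family_ito w i ord0) =
  (fun w => \sum_j \sum_k (psi w * Phi j w i k) * incr W (a j) (b j) k w).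
  apply/funext => w; rewrite family_itoE mulr_sumr; apply: eq_bigr => j _.
  by rewrite mulr_sumr; apply: eq_bigr => k _; rewrite mulrA.
have psiPhi j k : sqint P (fun w => psi w * Phi j w i k).
  have [C HC] := bPhi j; under eq_fun do rewrite mulrC.
  by apply: (@sqintM_bounded _ _ _ _ _ _ C).
have ii j k : P.-integrable setT
    (EFin \o (fun w => (psi w * Phi j w i k) * incr W (a j) (b j) k w)).
  by apply: sqint_mul => //; exact: (incr_sqint hW).
rewrite Rintegral_sum// => [|j]; last exact: integrable_sumR.
rewrite big1// => j _; rewrite Rintegral_sum// big1// => k _.
have [taj|abj] := ta j; last first.
  rewrite abj (_ : (fun w => _) = fun=> 0); last first.
    by apply/funext => w; rewrite incrxx mulr0.
  by rewrite Rintegral_cst//= mul0r.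
apply: (increment_centered hW) => //.
have ajT : (0 <= (a j)%:E <= T)%E.
  by rewrite lee_fin a0 (le_trans _ (bT j))// lee_fin.
have /andP[_ ajT'] := ajT.
apply: (adaptedM hW) => //.
exact: (adapted_le hW) apsi.
Qed.

Let c i j k j' k' := \int[P]_w (Phi j w i k * Phi j' w i k').

Let iPhi i j k j' k' :
  P.-integrable setT (EFin \o (fun w => Phi j w i k * Phi j' w i k')).
Proof.
have [C HC] := bPhi j; have [C' HC'] := bPhi j'.
by apply: sqint_mul; [apply: (@sqint_bounded _ _ _ _ _ C)|
  apply: (@sqint_bounded _ _ _ _ _ C')].
Qed.

Let left_side : (\int[P]_w (enorm (family_ito w) ^+ 2)%:E =
  (\sum_i \sum_j \sum_k \sum_j' overlap (a j) (b j) (a j') (b j') *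
     c i j k j' k)%:E)%E.
Proof.
pose e i j k w := Phi j w i k * incr W (a j) (b j) k w.
have eE w : enorm (family_ito w) ^+ 2 =
    \sum_i \sum_j \sum_k \sum_j' \sum_k' e i j k w * e i j' k' w.
  rewrite sqr_enormE; apply: eq_bigr => i _; rewrite big_ord1 family_itoE.
  rewrite expr2 mulr_suml; apply: eq_bigr => j _.
  rewrite mulr_suml; apply: eq_bigr => k _.
  rewrite mulr_sumr; apply: eq_bigr => j' _.
  by rewrite mulr_sumr.
have ie i j k j' k' : P.-integrable setT (EFin \o (fun w => e i j k w * e i j' k' w)).
  by apply: sqint_mul; exact: family_term_sqint.
have i4 i j k j' := integrable_sumR (index_enum 'I_d) measurableT (ie i j k j').
have i3 i j k := integrable_sumR (index_enum J) measurableT (i4 i j k).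
have i2 i j := integrable_sumR (index_enum 'I_d) measurableT (i3 i j).
have i1 i := integrable_sumR (index_enum J) measurableT (i2 i).
have i0 := integrable_sumR (index_enum 'I_m) measurableT i1.
under eq_integral do rewrite eE.
rewrite integral_EFin_Rintegral//; congr EFin.
rewrite Rintegral_sum//; apply: eq_bigr => i _.
rewrite Rintegral_sum//; apply: eq_bigr => j _.
rewrite Rintegral_sum//; apply: eq_bigr => k _.
rewrite Rintegral_sum//; apply: eq_bigr => j' _.
rewrite Rintegral_sum//.
have [C HC] := bPhi j; have [C' HC'] := bPhi j'.
rewrite (bigD1 k)//= big1 ?addr0 => [|k' kk'].
- by rewrite (elementary_covariance hW _ _ _ _ _ _ _ _ _ _
    (fun w => HC w i k) (fun w => HC' w i k))// eqxx mul1r.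
- by rewrite (elementary_covariance hW _ _ _ _ _ _ _ _ _ _
    (fun w => HC w i k) (fun w => HC' w i k'))// eq_sym (negbTE kk') !mul0r.
Qed.

Let inner w :
  (\int[lebesgue_measure]_(s in rtime 0 T) (enorm (family_process s%:E w) ^+ 2)%:E =
  (\sum_i \sum_k \sum_j \sum_j' overlap (a j) (b j) (a j') (b j') *
     (Phi j w i k * Phi j' w i k))%:E)%E.
Proof.
pose e i k j j' (s : measurableTypeR R) :=
  (a j < s <= b j)%R%:R * (a j' < s <= b j')%R%:R * (Phi j w i k * Phi j' w i k).
have eE (s : measurableTypeR R) : enorm (family_process s%:E w) ^+ 2 =
    \sum_i \sum_k \sum_j \sum_j' e i k j j' s.
  rewrite sqr_enormE; apply: eq_bigr => i _; apply: eq_bigr => k _.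
  rewrite family_processE expr2 mulr_suml; apply: eq_bigr => j _.
  by rewrite mulr_sumr; apply: eq_bigr => j' _; rewrite /e mulrACA.
have mD := @measurable_rtime R 0%E T.
have H i k j j' := integral_indicator_overlap (Phi j w i k * Phi j' w i k)
  (a0 j) (ab j) (bT j) (a0 j') (ab j') (bT j').
have ie i k j j' : lebesgue_measure.-integrable (rtime 0 T) (EFin \o e i k j j').
  exact: (H i k j j').1.
have i4 i k j := integrable_sumR (index_enum J) mD (ie i k j).
have i3 i k := integrable_sumR (index_enum J) mD (i4 i k).
have i2 i := integrable_sumR (index_enum 'I_d) mD (i3 i).
have i1 := integrable_sumR (index_enum 'I_m) mD i2.
under eq_integral do rewrite eE.
rewrite integral_EFin_Rintegral//; congr EFin.
rewrite Rintegral_sum//; apply: eq_bigr => i _.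
rewrite Rintegral_sum//; apply: eq_bigr => k _.
rewrite Rintegral_sum//; apply: eq_bigr => j _.
rewrite Rintegral_sum//; apply: eq_bigr => j' _.
exact: (H i k j j').2.
Qed.

(** Both sides expand into the same sum of overlaps times E[Phi_j Phi_j'], by
    [elementary_covariance] on the left and [integral_indicator_overlap] on the
    right. *)
Lemma family_ito_isometry :
  (\int[P]_w (enorm (family_ito w) ^+ 2)%:E =
   \int[P]_w \int[lebesgue_measure]_(s in rtime 0 T)
     (enorm (family_process s%:E w) ^+ 2)%:E)%E.
Proof.
rewrite left_side; under eq_integral do rewrite inner.
pose e i k j j' w :=
  overlap (a j) (b j) (a j') (b j') * (Phi j w i k * Phi j' w i k).
have ie i k j j' : P.-integrable setT (EFin \o e i k j j').
  rewrite (_ : _ \o _ = (fun w => (overlap (a j) (b j) (a j') (b j'))%:E *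
    (Phi j w i k * Phi j' w i k)%R%:E)%E)//.
  exact: (integrableZl measurableT _ (iPhi i j k j' k)).
have i4 i k j := integrable_sumR (index_enum J) measurableT (ie i k j).
have i3 i k := integrable_sumR (index_enum J) measurableT (i4 i k).
have i2 i := integrable_sumR (index_enum 'I_d) measurableT (i3 i).
have i1 := integrable_sumR (index_enum 'I_m) measurableT i2.
rewrite integral_EFin_Rintegral//; congr EFin.
rewrite [RHS](Rintegral_sum _ measurableT i2); apply: eq_bigr => i _.
rewrite exchange_big/=.
rewrite [RHS](Rintegral_sum _ measurableT (i3 i)); apply: eq_bigr => k _.
rewrite [RHS](Rintegral_sum _ measurableT (i4 i k)); apply: eq_bigr => j _.
rewrite [RHS](Rintegral_sum _ measurableT (ie i k j)); apply: eq_bigr => j' _.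
by rewrite [RHS]RintegralZl.
Qed.

End Family.

End ElementaryIto.

(** * Norms defined by a square root *)

Section SquareRootNorm.
Context {R : realType}.
Local Open Scope ereal_scope.

Lemma poweR_half_lt (x : \bar R) (e : R) : 0 <= x -> (0 < e)%R ->
  x `^ 2^-1 < e%:E -> x < (e ^+ 2)%:E.
Proof.
case: x => [r| |]// r0 e0; last by rewrite poweRyr.
rewrite poweR_EFin powR12_sqrt// !lte_fin => H.
rewrite -(sqr_sqrtr r0) ltr_sqr// nnegrE ?sqrtr_ge0//; exact: ltW.
Qed.

Lemma poweR_half_lty (x : \bar R) : 0 <= x -> x `^ 2^-1 < +oo -> x < +oo.
Proof. by move=> _; apply: lty_poweRy. Qed.

Lemma cvg_poweR_half (x : (\bar R)^nat) : (forall n, 0 <= x n) ->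
  x n `^ 2^-1 @[n --> \oo] --> 0 ->
  forall e : R, (0 < e)%R -> \forall n \near \oo, x n <= e%:E.
Proof.
move=> x0 cx e e0.
have se0 : (0 < Num.sqrt e)%R by rewrite sqrtr_gt0.
have /fine_cvgP[fx cfx] := cx.
have lt_e : \forall n \near \oo, (fine (x n `^ 2^-1) < Num.sqrt e)%R.
  exact: (cvgr_lt _ cfx _ se0).
apply: filterS2 fx lt_e => n fxn /= xn.
have := @poweR_half_lt (x n) (Num.sqrt e) (x0 n) se0.
by rewrite sqr_sqrtr ?(ltW e0)// -(fineK fxn) lte_fin => /(_ xn) /ltW.
Qed.

Lemma poweR_half_cvg (x : (\bar R)^nat) : (forall n, 0 <= x n) ->
  (forall e : R, (0 < e)%R -> \forall n \near \oo, x n <= e%:E) ->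
  x n `^ 2^-1 @[n --> \oo] --> 0.
Proof.
move=> x0 H; apply/fine_cvgP; split.
  apply: filterS (H 1%R ltr01) => n xn.
  by rewrite fin_num_poweR// ge0_fin_numE// (le_lt_trans xn)// ltry.
apply/cvgrPdist_le => e e0.
apply: filterS (H (e ^+ 2)%R (exprn_gt0 2 e0)) => n /=.
move: (x0 n); case: (x n) => [r| |]// r0.
rewrite lee_fin => re.
rewrite sub0r normrN poweR_EFin/= powR12_sqrt// ger0_norm ?sqrtr_ge0//.
by rewrite -(ger0_norm (ltW e0)) -sqrtr_sqr ler_sqrt// exprn_ge0// ltW.
Qed.

End SquareRootNorm.

Section CauchySchwarz.
Context d (X : measurableType d) (R : realType) (mu : {measure set X -> \bar R}).

(** The polynomial t^2 A + 2 t B + C is the integral of (t f + g)^2, hence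
    nonnegative at every t. *)
Lemma sqint_cauchy_schwarz (f g : X -> R) : sqint mu f -> sqint mu g ->
  (\int[mu]_x (f x * g x)) ^+ 2 <=
  (\int[mu]_x (f x ^+ 2)) * (\int[mu]_x (g x ^+ 2)).
Proof.
move=> fi gi.
set B := Rintegral _ _ _; set A := (X in _ <= X * _); set C := (X in _ <= _ * X).
have quad (t : R) : 0 <= t ^+ 2 * A + 2 * t * B + C.
  have -> : t ^+ 2 * A + 2 * t * B + C = \int[mu]_x ((t * f x + g x) ^+ 2).
    rewrite (_ : (fun x => (t * f x + g x) ^+ 2) =
      (fun x => t ^+ 2 * f x ^+ 2 + (2 * t) * (f x * g x) + g x ^+ 2)); last first.
      by apply/funext => x; ring.
    have i1 := sqint_sqr fi; have i2 := sqint_mul fi gi; have i3 := sqint_sqr gi.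
    have i1' : mu.-integrable setT (EFin \o (fun x => t ^+ 2 * f x ^+ 2)).
      exact: (integrableZl measurableT (t ^+ 2) i1).
    have i2' : mu.-integrable setT (EFin \o (fun x => 2 * t * (f x * g x))).
      exact: (integrableZl measurableT (2 * t) i2).
    rewrite RintegralD//; last exact: (integrableD measurableT i1' i2').
    by rewrite RintegralD// !RintegralZl.
  by apply: Rintegral_ge0 => x _; exact: sqr_ge0.
have A0 : 0 <= A by apply: Rintegral_ge0 => x _; exact: sqr_ge0.
have [Az|Az] := eqVneq A 0.
  rewrite Az mul0r.
  have [->|B0] := eqVneq B 0; first by rewrite expr0n.
  (* a nonzero slope would make the polynomial equal to -1 at this point *)
  have := quad (- (C + 1) / (2 * B)).
  rewrite Az mulr0 add0r (_ : 2 * _ * B = - (C + 1)); first by lra.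
  by field.
have Apos : 0 < A by rewrite lt_def Az.
(* the minimum of the polynomial *)
have := quad (- B / A).
rewrite (_ : _ + _ = (A * C - B ^+ 2) / A); last by field.
by rewrite pmulr_lge0 ?invr_gt0// subr_ge0.
Qed.

End CauchySchwarz.

Section EuclideanIneq.
Context {R : realType}.

(** Expand the square of eta A - B. As eta tends to 0, a perturbation B that
    is much smaller costs a factor close to 1. *)
Lemma sqr_enormD_weighted p q (A B : 'M[R]_(p, q)) (eta : R) : 0 < eta ->
  enorm (A + B) ^+ 2 <= (1 + eta) * enorm A ^+ 2 + (1 + eta^-1) * enorm B ^+ 2.
Proof.
move=> e0; rewrite sqr_enorm !(mxdotDl, mxdotDr) (mxdotC B A) -!sqr_enorm.
have H := mxdot_ge0 (eta *: A - B).
have : 0 <= eta^-1 * mxdot (eta *: A - B) (eta *: A - B).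
  by rewrite mulr_ge0// invr_ge0 ltW.
rewrite -scaleN1r !(mxdotDl, mxdotDr, mxdotZl, mxdotZr) (mxdotC B A) -!sqr_enorm.
set a := enorm A ^+ 2; set c := enorm B ^+ 2; set x := mxdot A B.
rewrite (_ : eta^-1 * _ = eta * a - 2 * x + eta^-1 * c); last by field; rewrite gt_eqF.
by rewrite !mulrDl !mul1r; lra.
Qed.

Lemma sqr_enormD p q (A B : 'M[R]_(p, q)) :
  enorm (A + B) ^+ 2 <= 2 * enorm A ^+ 2 + 2 * enorm B ^+ 2.
Proof. by have := sqr_enormD_weighted A B ltr01; rewrite invr1. Qed.

End EuclideanIneq.

(** * Predictable processes *)

Section Predictability.
Context {R : realType} {disp : measure_display} {Omega : measurableType disp}.
Variables (P : probability Omega R) (T : \bar R).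
Variable F : \bar R -> set (set Omega).
Context {d : nat}.
Variable W : R -> Omega -> 'cV[R]_d.
Hypothesis hT : (0 < T)%E.
Hypothesis hW : brownian_basis P T F W.

Lemma measurable_time : measurable [set t : \bar R | (0 <= t <= T)%E].
Proof.
rewrite (_ : [set t | _] = `[0%E, T]%classic); first exact: emeasurable_itv.
by apply/seteqP; split => x /=; rewrite in_itv.
Qed.

Lemma measurable_time_domain : measurable (@time_domain R disp Omega T).
Proof. by apply: measurableX => //; exact: measurable_time. Qed.

Lemma predictable_sigma_measurable : predictable_sigma T F `<=` measurable.
Proof.
apply: smallest_sub.
  split; first exact: measurable0.
    by move=> A mA; apply: measurableD => //; exact: measurable_time_domain.
  by move=> A mA; exact: bigcup_measurable.
have sT s : (0 <= s <= T)%E -> F s `<=` measurable by exact: (filtration_measurable hW).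
move=> C [[A FA ->]|[A [s [t [s0 st tT FA ->]]]]].
  apply: measurableX; last exact: emeasurable_set1.
  by apply: sT FA; rewrite lexx ltW.
apply: measurableX.
  by apply: sT FA; rewrite s0 (le_trans (ltW st)).
rewrite (_ : [set r | _] = `]s, t]%classic); first exact: emeasurable_itv.
by apply/seteqP; split => x /=; rewrite in_itv.
Qed.

(** The sets whose section at t is in F_t form a sigma-algebra, which contains
    the generating rectangles. *)
Lemma predictable_section t : (0 <= t <= T)%E ->
  predictable_sigma T F `<=` [set C | F t [set w | C (w, t)]].
Proof.
move=> tT; have Ft := filtrationE hW tT.
apply: smallest_sub.
  split.
  - by rewrite /= Ft; exact: sigma_algebra0.
  - move=> A; rewrite /= Ft => FA.
    rewrite (_ : [set w | _] = ~` [set w | A (w, t)]); first exact: sigma_algebraC.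
    by apply/seteqP; split => [w [_]//|w nA]; split.
  - move=> A; rewrite /= Ft => FA.
    rewrite (_ : [set w | _] = \bigcup_i [set w | A i (w, t)]).
      exact: sigma_algebra_bigcup.
    by apply/seteqP; split => w [i _ Ai]; exists i.
have F0 : F t set0 by rewrite Ft; exact: sigma_algebra0.
move=> C [[A FA ->]|[A [s [r [s0 sr rT FA ->]]]]] /=.
  have [t0|t0] := eqVneq t 0%E.
    by rewrite t0 (_ : [set w | _] = A)//; apply/seteqP; split => [w []//|w Aw]; split.
  rewrite (_ : [set w | _] = set0)//; apply/seteqP; split => // w [/= _] /eqP.
  by rewrite (negbTE t0).
have [str|str] := boolP (s < t <= r)%E; last first.
  by rewrite (_ : [set w | _] = set0)//; apply/seteqP; split => // w [/= _]; apply/negP.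
rewrite (_ : [set w | _] = A); last first.
  by apply/seteqP; split => [w []//|w Aw]; split.
have /andP[/ltW st _] := str; have /andP[_ tT'] := tT.
exact: (filtration_le hW) FA.
Qed.

Lemma predictable_adapted p q (X : \bar R -> Omega -> 'M[R]_(p, q)) t i j :
  (0 <= t <= T)%E -> predictable T F X -> adapted F t (fun w => X t w i j).
Proof.
move=> tT pX B mB.
have := predictable_section tT (measurable_wrt_coord i j pX mB).
congr (F t _); apply/seteqP; split => [w [_]//|w Bw].
by split.
Qed.

Lemma predictable_measurable p q (X : \bar R -> Omega -> 'M[R]_(p, q)) i j :
  predictable T F X ->
  measurable_fun (@time_domain R disp Omega T) (fun x => X x.2 x.1 i j).
Proof.
move=> pX _ B mB; apply: predictable_sigma_measurable.
exact: (measurable_wrt_coord i j pX mB).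
Qed.

Lemma predictable_path p q (X : \bar R -> Omega -> 'M[R]_(p, q)) w i j :
  predictable T F X ->
  measurable_fun [set t | (0 <= t <= T)%E] (fun t => X t w i j).
Proof.
move=> pX; have mX := predictable_measurable i j pX.
apply: (@measurable_comp _ _ _ _ _ _ (@time_domain R disp Omega T)
  (fun x => X x.2 x.1 i j) _ (fun t => (w, t))) => //.
- exact: measurable_time_domain.
- by move=> _ [t tT <-]; split.
- by apply: measurable_funTS; exact: pair1_measurable.
Qed.

Definition realtime_domain : set (Omega * measurableTypeR R) := setT `*` rtime 0 T.

Lemma measurable_realtime_domain : measurable realtime_domain.
Proof. by apply: measurableX => //; exact: measurable_rtime. Qed.

Lemma predictable_joint p q (X : \bar R -> Omega -> 'M[R]_(p, q)) i j :
  predictable T F X ->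
  measurable_fun realtime_domain (fun x => X x.2%:E x.1 i j).
Proof.
move=> pX; have mX := predictable_measurable i j pX.
apply: (@measurable_comp _ _ _ _ _ _ (@time_domain R disp Omega T)
  (fun x => X x.2 x.1 i j) _
  (fun x : Omega * measurableTypeR R => (x.1, x.2%:E))) => //.
- exact: measurable_time_domain.
- by move=> _ [[w s] [_ sT] <-]; split.
- apply: measurable_funTS; apply: measurable_fun_pair => //=.
  by apply: (measurableT_comp (@EFin_measurable R setT)); exact: measurable_snd.
Qed.

Local Open Scope ereal_scope.

Lemma iterated_integralE (f : Omega * measurableTypeR R -> \bar R) :
  measurable_fun realtime_domain f -> (forall x, 0 <= f x) ->
  \int[P]_w \int[lebesgue_measure]_(s in rtime 0 T) f (w, s) =
  \int[P \x lebesgue_measure]_(x in realtime_domain) f x.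
Proof.
move=> mf f0; rewrite [RHS]integral_mkcond.
rewrite fubini_tonelli1//; last 2 first.
- exact/(measurable_restrictT _ measurable_realtime_domain).
- by move=> x; rewrite patchE; case: ifP.
apply: eq_integral => w _; rewrite /fubini_F [LHS]integral_mkcond.
apply: eq_integral => s _; rewrite !patchE.
congr (if _ then _ else _); apply/idP/idP; rewrite !inE => H; first by split.
by case: H.
Qed.

Lemma iterated_integral_measurable (f : Omega * measurableTypeR R -> \bar R) :
  measurable_fun realtime_domain f -> (forall x, 0 <= f x) ->
  measurable_fun setT (fun w => \int[lebesgue_measure]_(s in rtime 0 T) f (w, s)).
Proof.
move=> mf f0.
rewrite (_ : (fun w => _) = fubini_F lebesgue_measure (f \_ realtime_domain)).
  apply: measurable_fun_fubini_tonelli_F.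
    exact/(measurable_restrictT _ measurable_realtime_domain).
  by move=> x; rewrite patchE; case: ifP.
apply/funext => w; rewrite /fubini_F [LHS]integral_mkcond.
apply: eq_integral => s _; rewrite !patchE.
congr (if _ then _ else _); apply/idP/idP; rewrite !inE => H; first by split.
by case: H.
Qed.

End Predictability.

(** * The stochastic integral as a limit *)

Section LinearBound.
Context d (X : measurableType d) (R : realType) (mu : {measure set X -> \bar R}).

Lemma le_integral_lin2 (D : set X) (f g h : X -> R) (k l : R) :
  measurable D -> 0 <= k -> 0 <= l ->
  measurable_fun D f -> measurable_fun D g -> measurable_fun D h ->
  (forall x, 0 <= f x) -> (forall x, 0 <= g x) -> (forall x, 0 <= h x) ->
  (forall x, f x <= k * g x + l * h x) ->
  (\int[mu]_(x in D) (f x)%:E <=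
   k%:E * \int[mu]_(x in D) (g x)%:E + l%:E * \int[mu]_(x in D) (h x)%:E)%E.
Proof.
move=> mD k0 l0 mf mg mh f0 g0 h0 fgh.
rewrite -!ge0_integralZl_EFin//; last 4 first.
- by move=> x _; rewrite lee_fin.
- exact/measurable_EFinP.
- by move=> x _; rewrite lee_fin.
- exact/measurable_EFinP.
rewrite -ge0_integralD//; last 4 first.
- by move=> x _; rewrite mule_ge0 ?lee_fin.
- by apply: measurable_funeM; exact/measurable_EFinP.
- by move=> x _; rewrite mule_ge0 ?lee_fin.
- by apply: measurable_funeM; exact/measurable_EFinP.
apply: ge0_le_integral => //.
- by move=> x _; rewrite lee_fin.
- exact/measurable_EFinP.
- by apply: emeasurable_funD; apply: measurable_funeM; exact/measurable_EFinP.
- by move=> x _; rewrite -!EFinM -EFinD lee_fin.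
Qed.

End LinearBound.

Lemma lee_double_sum (R : realType) (x y : \bar R) (e : R) :
  (x <= e%:E -> y <= e%:E -> 2%:E * x + 2%:E * y <= (4 * e)%:E)%E.
Proof.
move=> xe ye.
have -> : ((4 * e)%:E = 2%:E * e%:E + 2%:E * e%:E)%E.
  by rewrite -!EFinM -EFinD; congr EFin; ring.
by apply: leeD; apply: lee_wpmul2l.
Qed.

Section ItoIntegral.
Context {R : realType} {disp : measure_display} {Omega : measurableType disp}.
Variables (P : probability Omega R) (T : \bar R).
Variable F : \bar R -> set (set Omega).
Context {d m : nat}.
Variable W : R -> Omega -> 'cV[R]_d.
Hypothesis hT : (0 < T)%E.
Hypothesis hW : brownian_basis P T F W.

Definition sqL2 p q (X : Omega -> 'M[R]_(p, q)) : \bar R :=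
  (\int[P]_w ((enorm (X w)) ^+ 2)%:E)%E.

Definition sqH2 p q (Z : \bar R -> Omega -> 'M[R]_(p, q)) : \bar R :=
  (\int[P]_w \int[lebesgue_measure]_(s in rtime 0 T)
      ((enorm (Z s%:E w)) ^+ 2)%:E)%E.

Definition jointly_measurable p q (Z : \bar R -> Omega -> 'M[R]_(p, q)) :=
  forall i j, measurable_fun (realtime_domain T)
    (fun x : Omega * measurableTypeR R => Z x.2%:E x.1 i j).

Definition coord_measurable p q (X : Omega -> 'M[R]_(p, q)) :=
  forall i j, measurable_fun setT (fun w => X w i j).

Lemma sqL2_ge0 p q (X : Omega -> 'M[R]_(p, q)) : (0 <= sqL2 X)%E.
Proof. by apply: integral_ge0 => w _; rewrite lee_fin sqr_ge0. Qed.

Lemma sqH2_ge0 p q (Z : \bar R -> Omega -> 'M[R]_(p, q)) : (0 <= sqH2 Z)%E.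
Proof.
by apply: integral_ge0 => w _; apply: integral_ge0 => s _; rewrite lee_fin sqr_ge0.
Qed.

Lemma coord_measurableB p q (X Y : Omega -> 'M[R]_(p, q)) :
  coord_measurable X -> coord_measurable Y ->
  coord_measurable (fun w => X w - Y w).
Proof.
move=> mX mY i j; under eq_fun do rewrite !mxE.
exact: measurable_funB.
Qed.

Lemma jointly_measurableB p q (X Y : \bar R -> Omega -> 'M[R]_(p, q)) :
  jointly_measurable X -> jointly_measurable Y ->
  jointly_measurable (fun t w => X t w - Y t w).
Proof.
move=> mX mY i j; under eq_fun do rewrite !mxE.
exact: measurable_funB.
Qed.

Lemma sqL2_lin2 p q (X A B : Omega -> 'M[R]_(p, q)) (k l : R) :
  coord_measurable X -> coord_measurable A -> coord_measurable B ->
  0 <= k -> 0 <= l ->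
  (forall w, enorm (X w) ^+ 2 <= k * enorm (A w) ^+ 2 + l * enorm (B w) ^+ 2) ->
  (sqL2 X <= k%:E * sqL2 A + l%:E * sqL2 B)%E.
Proof.
move=> mX mA mB k0 l0 H; apply: le_integral_lin2 => //;
  try exact: measurable_sum_sqr; by move=> w; exact: sqr_ge0.
Qed.

Lemma sqH2_prod p q (X : \bar R -> Omega -> 'M[R]_(p, q)) : jointly_measurable X ->
  (sqH2 X = \int[P \x lebesgue_measure]_(x in realtime_domain T)
      (enorm (X x.2%:E x.1) ^+ 2)%:E)%E.
Proof.
move=> mX; rewrite -iterated_integralE//.
- by apply/measurable_EFinP; exact: measurable_sum_sqr.
- by move=> x; rewrite lee_fin sqr_ge0.
Qed.

Lemma sqH2_lin2 p q (X A B : \bar R -> Omega -> 'M[R]_(p, q)) (k l : R) :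
  jointly_measurable X -> jointly_measurable A -> jointly_measurable B ->
  0 <= k -> 0 <= l ->
  (forall t w, enorm (X t w) ^+ 2 <=
     k * enorm (A t w) ^+ 2 + l * enorm (B t w) ^+ 2) ->
  (sqH2 X <= k%:E * sqH2 A + l%:E * sqH2 B)%E.
Proof.
move=> mX mA mB k0 l0 H; rewrite !sqH2_prod//.
apply: le_integral_lin2 => //; try exact: measurable_sum_sqr;
  by [exact: measurable_realtime_domain|move=> x; exact: sqr_ge0].
Qed.

Lemma predictable_jointly p q (X : \bar R -> Omega -> 'M[R]_(p, q)) :
  predictable T F X -> jointly_measurable X.
Proof. by move=> pX i j; exact: (predictable_joint hT hW). Qed.

Section Tail.
Variable H : @simple_integrand R _ Omega d m.
Hypothesis wH : simple_integrand_wf T F H.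

Let tau := si_time H.
Let n := si_size H.

Lemma si_time_le i j : (i <= j)%N -> (j <= n)%N -> tau i <= tau j.
Proof.
case: wH => _ + _ _ _ => step; elim: j => [|j IH]; first by rewrite leqn0 => /eqP ->.
rewrite leq_eqVlt => /orP[/eqP -> //|ij] jn.
by apply: le_trans (step j jn); apply: IH => //; exact: ltnW.
Qed.

Lemma si_time_ge0 i : (i <= n)%N -> 0 <= tau i.
Proof. by move=> ?; case: wH => t0 *; apply: le_trans t0 _; exact: si_time_le. Qed.

Lemma si_time_leT i : (i <= n)%N -> ((tau i)%:E <= T)%E.
Proof.
move=> ?; case: wH => _ _ tT _ _; apply: le_trans tT.
by rewrite lee_fin; exact: si_time_le.
Qed.

(** The start of the i-th interval of the grid after truncation to [t, T]. If
    the interval ends before t this is its end point, and nothing remains. *)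
Definition tail_start (t : \bar R) (i : 'I_n) : R :=
  Num.max (tau i) (fine (Order.min (tau i.+1)%:E t)).

Definition tail_end (i : 'I_n) : R := tau i.+1.

Lemma tail_startP t i : (0 <= t)%E ->
  [\/ (tail_start t i = tau i /\ (t <= (tau i)%:E)%E),
      (tail_start t i)%:E = t /\ ((tau i)%:E <= t <= (tau i.+1)%:E)%E |
      tail_start t i = tau i.+1 /\ ((tau i.+1)%:E <= t)%E].
Proof.
move=> t0; rewrite /tail_start.
have ii : tau i <= tau i.+1 by apply: si_time_le.
case: t t0 => [r| |]// r0; last first.
  constructor 3; rewrite leey; split => //.
  by rewrite min_l ?leey//= max_r.
rewrite -EFin_min/= !lee_fin.
have [r1|r1] := leP r (tau i).
  constructor 1; split => //; rewrite max_l// ge_min r1 orbT//.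
have [r2|r2] := leP r (tau i.+1).
  by constructor 2; rewrite (ltW r1) max_r// ltW.
by constructor 3; rewrite max_r//; split => //; exact: ltW.
Qed.

Lemma tail_family t : (0 <= t <= T)%E ->
  elementary_family T F (tail_start t) tail_end (fun i : 'I_n => si_coef H i).
Proof.
move=> /andP[t0 tT].
have lb (i : 'I_n) : tau i <= tail_start t i by rewrite le_max lexx.
have ub (i : 'I_n) : tail_start t i <= tail_end i.
  have ii : tau i <= tau i.+1 by apply: si_time_le.
  have [[-> _]|[H1 /andP[_ H2]]|[-> _]] := tail_startP i t0 => //.
  by rewrite -lee_fin H1.
have ge0 (i : 'I_n) : 0 <= tail_start t i.
  by apply: le_trans (lb i); apply: si_time_ge0; exact: ltnW.
have leT (i : 'I_n) : ((tail_end i)%:E <= T)%E by apply: si_time_leT.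
split => //.
- move=> i k l; case: wH => _ _ _ /(_ i (ltn_ord i)) mi _.
  apply: (adapted_le hW) (submeasurable_coord k l mi).
  + by rewrite lee_fin; apply: si_time_ge0; exact: ltnW.
  + by rewrite lee_fin.
  + by apply: le_trans (leT i); rewrite lee_fin.
- by move=> i; case: wH => _ _ _ _ /(_ i (ltn_ord i)).
Qed.

Lemma tail_start_ge t (i : 'I_n) : (0 <= t)%E ->
  (t <= (tail_start t i)%:E)%E \/ tail_start t i = tail_end i.
Proof.
move=> t0; have [[-> H1]|[-> _]|[-> _]] := tail_startP i t0.
- by left.
- by left.
- by right.
Qed.

Lemma simple_ito_tail t w : (0 <= t <= T)%E ->
  simple_ito W H T w - simple_ito W H t w =
  family_ito W (tail_start t) tail_end (fun i : 'I_n => si_coef H i) w.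
Proof.
move=> /andP[t0 tT]; rewrite /simple_ito -sumrB; apply: eq_bigr => i _.
rewrite -mulmxBr; congr (_ *m _).
have ii : tau i <= tau i.+1 by apply: si_time_le.
have leT : ((si_time H i.+1)%:E <= T)%E by exact: si_time_leT.
have leT' : ((si_time H i)%:E <= T)%E by apply: si_time_leT; exact: ltnW.
rewrite (min_l leT) (min_l leT').
rewrite /= -/tau /tail_end.
have [[-> H1]|[H1 /andP[H2 H3]]|[-> H1]] := tail_startP i t0.
- rewrite !min_r//; last by rewrite (le_trans H1)// lee_fin.
  by rewrite subrr subr0.
- move: H1; set a := tail_start t i => H1.
  by rewrite min_r// min_l//= -H1/= opprB addrA subrK.
- by rewrite !min_l//=; [rewrite !subrr|rewrite (le_trans _ H1)// lee_fin].
Qed.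

Lemma tail_process s w :
  family_process (tail_start 0%E) tail_end (fun i : 'I_n => si_coef H i) s w =
  simple_process H s w.
Proof.
apply: eq_bigr => i _; rewrite (_ : tail_start 0%E i = tau i)//.
have t0 : 0 <= tau i by apply: si_time_ge0; exact: ltnW.
have t1 : 0 <= tau i.+1 by exact: si_time_ge0.
by rewrite /tail_start min_r ?lee_fin// max_l.
Qed.

End Tail.

Section DifferenceFamily.
Variables (J1 J2 : finType) (a1 b1 : J1 -> R) (a2 b2 : J2 -> R).
Variables (Phi1 : J1 -> Omega -> 'M[R]_(m, d)) (Phi2 : J2 -> Omega -> 'M[R]_(m, d)).

Definition join_fun (x : J1 -> R) (y : J2 -> R) (j : J1 + J2) : R :=
  match j with inl i => x i | inr i => y i end.

Definition join_coef (j : J1 + J2) (w : Omega) : 'M[R]_(m, d) :=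
  match j with inl i => Phi1 i w | inr i => - Phi2 i w end.

Lemma join_family : elementary_family T F a1 b1 Phi1 ->
  elementary_family T F a2 b2 Phi2 ->
  elementary_family T F (join_fun a1 a2) (join_fun b1 b2) join_coef.
Proof.
move=> [p1 p2 p3 p4 p5] [q1 q2 q3 q4 q5]; split.
- by case.
- by case.
- by case.
- case=> j i k //=.
  have jT : (0 <= (a2 j)%:E <= T)%E.
    by rewrite lee_fin q1 (le_trans _ (q3 j))// lee_fin.
  rewrite (_ : (fun w => _) = (fun w => 0 - Phi2 j w i k)); last first.
    by apply/funext => w; rewrite mxE sub0r.
  apply: (adaptedB hW) => //.
  by apply/(adaptedP hW) => //; exact: measurable_cst.
- case=> j /=; first exact: p5.
  by have [C HC] := q5 j; exists C => w; rewrite enormN.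
Qed.

Lemma join_ito w : family_ito W (join_fun a1 a2) (join_fun b1 b2) join_coef w =
  family_ito W a1 b1 Phi1 w - family_ito W a2 b2 Phi2 w.
Proof.
rewrite /family_ito big_sumType/= -sumrN; congr (_ + _).
by apply: eq_bigr => j _; rewrite mulNmx.
Qed.

Lemma join_process s w :
  family_process (join_fun a1 a2) (join_fun b1 b2) join_coef s w =
  family_process a1 b1 Phi1 s w - family_process a2 b2 Phi2 s w.
Proof.
rewrite /family_process big_sumType/= -sumrN; congr (_ + _).
by apply: eq_bigr => j _; case: ifP => //; rewrite oppr0.
Qed.

End DifferenceFamily.

Lemma family_process_jointly (J : finType) (a b : J -> R)
    (Phi : J -> Omega -> 'M[R]_(m, d)) : elementary_family T F a b Phi ->
  jointly_measurable (family_process a b Phi).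
Proof.
move=> [a0 ab bT aPhi bPhi] i k.
under eq_fun do rewrite family_processE.
apply: measurable_sum => j; apply: measurable_funM.
  rewrite (_ : (fun x => _) = (\1_(`]a j, b j]%classic : set (measurableTypeR R))) \o snd).
    apply: measurable_funTS; apply: measurableT_comp; last exact: measurable_snd.
    by apply: measurable_indic; exact: measurable_itv.
  apply/funext => x /=; rewrite indicE; congr ((nat_of_bool _)%:R).
  by apply/idP/idP; rewrite inE/= in_itv.
apply: measurable_funTS; apply: (measurableT_comp (f := fun w => Phi j w i k)).
  apply: (adapted_measurable hW) (aPhi j i k).
  by rewrite lee_fin a0 (le_trans _ (bT j))// lee_fin.
exact: measurable_fst.
Qed.

Lemma random_vector_coord p q (X : Omega -> 'M[R]_(p, q)) :
  random_vector X -> coord_measurable X.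
Proof.
move=> mX i j _ B mB; rewrite setTI.
by have := measurable_wrt_coord i j mX mB; rewrite setTI.
Qed.

Lemma sqL2_sqint p q (X : Omega -> 'M[R]_(p, q)) : coord_measurable X ->
  (sqL2 X < +oo)%E -> forall i j, sqint P (fun w => X w i j).
Proof.
move=> mX fX i j; apply: (@sqint_le _ _ _ _ _ (fun w => enorm (X w))) => //.
  by split => //; exact: measurable_enorm.
by move=> w; rewrite (ger0_norm (enorm_ge0 _)) ler_coord_enorm.
Qed.

Lemma family_ito_coord (J : finType) (a b : J -> R)
    (Phi : J -> Omega -> 'M[R]_(m, d)) : elementary_family T F a b Phi ->
  coord_measurable (family_ito W a b Phi).
Proof.
by move=> eF i j; rewrite ord1; case: (family_ito_sqint hW eF i).
Qed.

(** The definition of the stochastic integral over [t, T] at a given precision,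
    with the integral of the simple integrand seen as an elementary family. *)
Lemma ito_approximation t (Z : \bar R -> Omega -> 'M[R]_(m, d)) I :
  (0 <= t <= T)%E -> is_ito_integral P T F W t T Z I ->
  coord_measurable I /\
  forall e : R, 0 < e -> exists H : @simple_integrand R _ Omega d m,
    [/\ simple_integrand_wf T F H,
      (sqH2 (fun t w => simple_process H t w - Z t w)%R <= e%:E)%E &
      (sqL2 (fun w => family_ito W (@tail_start H t) (@tail_end H)
               (fun i : 'I_(si_size H) => si_coef H i) w - I w)%R <= e%:E)%E].
Proof.
move=> tT [rI [H [wH cH cI]]]; split; first exact: random_vector_coord.
move=> e e0.
have n1 := cvg_poweR_half (fun k => sqH2_ge0 _) cH e0.
have n2 := cvg_poweR_half (fun k => sqL2_ge0 _) cI e0.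
have [k [h1 h2]] : exists k, (sqH2 (fun t w => simple_process (H k) t w - Z t w)%R <= e%:E)%E
   /\ (sqL2 (fun w => simple_ito W (H k) T w - simple_ito W (H k) t w - I w)%R <= e%:E)%E.
  have : \forall k \near \oo,
     (sqH2 (fun t w => simple_process (H k) t w - Z t w)%R <= e%:E)%E
   /\ (sqL2 (fun w => simple_ito W (H k) T w - simple_ito W (H k) t w - I w)%R <= e%:E)%E.
    by apply: filterS2 n1 n2.
  by move=> /filter_ex.
exists (H k); split => //.
apply: le_trans h2; rewrite le_eqVlt; apply/orP; left; apply/eqP.
by apply: eq_integral => w _; rewrite simple_ito_tail.
Qed.

Lemma ito_integral_sqint t (Z : \bar R -> Omega -> 'M[R]_(m, d)) I : (0 <= t <= T)%E ->
  is_ito_integral P T F W t T Z I -> forall i, sqint P (fun w => I w i ord0).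
Proof.
move=> tT hI i; have [mI /(_ 1 ltr01) [H [wH _ hL]]] := ito_approximation tT hI.
have eF := tail_family wH tT.
have mX := family_ito_coord eF.
have s1 := family_ito_sqint hW eF i.
have s2 := sqL2_sqint (coord_measurableB mX mI) (le_lt_trans hL (ltry 1)) i ord0.
have := sqintB s1 s2.
by rewrite (_ : (fun w => _) = (fun w => I w i ord0))//; apply/funext => w;
  rewrite !mxE; ring.
Qed.

(** Orthogonality to the past passes to the limit: by Cauchy-Schwarz, the
    defect is at most the norm of psi times the approximation error. *)
Lemma ito_integral_orthogonal t (Z : \bar R -> Omega -> 'M[R]_(m, d)) I : (0 <= t <= T)%E ->
  is_ito_integral P T F W t T Z I ->
  forall i psi, adapted F t psi -> sqint P psi ->
  \int[P]_w (psi w * I w i ord0) = 0.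
Proof.
move=> tT hI i psi apsi psi2.
have sI := ito_integral_sqint tT hI i.
have [mI approx] := ito_approximation tT hI.
set x := Rintegral _ _ _.
pose A := \int[P]_w (psi w ^+ 2).
have A0 : 0 <= A by apply: Rintegral_ge0 => w _; exact: sqr_ge0.
have small (e : R) : 0 < e -> x ^+ 2 <= A * e.
  move=> e0; have [H [wH _ hL]] := approx e e0.
  have eF := tail_family wH tT.
  have mX := family_ito_coord eF.
  have s1 := family_ito_sqint hW eF i.
  have mD := coord_measurableB mX mI.
  have s2 := sqL2_sqint mD (le_lt_trans hL (ltry e)) i ord0.
  have /andP[t0 _] := tT.
  have o1 := family_ito_orthogonal hW eF i tT (fun j => tail_start_ge wH j t0) apsi psi2.
  set X := family_ito _ _ _ _ in mX s1 mD s2 o1 hL.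
  have -> : x = - \int[P]_w (psi w * (X w - I w) i ord0).
    have -> : (fun w => psi w * (X w - I w) i ord0) =
      (fun w => psi w * X w i ord0 - psi w * I w i ord0).
      by apply/funext => w; rewrite !mxE mulrBr.
    rewrite RintegralB//; [|exact: sqint_mul|exact: sqint_mul].
    by rewrite o1 sub0r opprK.
  rewrite sqrrN; apply: le_trans (sqint_cauchy_schwarz psi2 s2) _.
  rewrite ler_wpM2l// -lee_fin -integral_EFin_Rintegral//; last exact: sqint_sqr.
  apply: le_trans hL; apply: ge0_le_integral => //.
  - by move=> w _; rewrite lee_fin sqr_ge0.
  - by apply: measurable_sqr; case: s2.
  - by apply/measurable_EFinP; exact: measurable_sum_sqr.
  - move=> w _; rewrite lee_fin -(real_normK (num_real _)).
    by rewrite ler_sqr ?nnegrE ?enorm_ge0// ler_coord_enorm.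
apply/eqP; rewrite -sqrf_eq0 eq_le sqr_ge0 andbT.
apply/ler_addgt0Pl => e e0; rewrite addr0.
have A1 : 0 < A + 1 by lra.
have := small (e / (A + 1)) (divr_gt0 e0 A1) => /le_trans; apply.
by rewrite mulrA ler_pdivrMr//; nra.
Qed.

(** The difference of the two approximating integrands is an elementary family
    and satisfies the isometry. The weighted inequality [sqr_enormD_weighted]
    transfers it to the limits with a factor (1 + eta)^2 and an error as small
    as desired; then eta tends to 0. *)
Lemma ito_isometry_le (Z Z' : \bar R -> Omega -> 'M[R]_(m, d)) I I' :
  jointly_measurable Z -> jointly_measurable Z' ->
  is_ito_integral P T F W 0 T Z I -> is_ito_integral P T F W 0 T Z' I' ->
  (sqH2 (fun t w => Z t w - Z' t w)%R <= sqL2 (fun w => I w - I' w)%R)%E.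
Proof.
move=> mZ mZ' hI hI'.
have tT : (0 <= (0 : \bar R) <= T)%E by apply/andP; split => //; exact: ltW.
have [mI approx] := ito_approximation tT hI.
have [mI' approx'] := ito_approximation tT hI'.
have mdI := coord_measurableB mI mI'.
have mdZ := jointly_measurableB mZ mZ'.
set N := sqH2 _; set E := sqL2 _.
have key (eta e : R) : 0 < eta -> 0 < e ->
  (N <= ((1 + eta) ^+ 2)%:E * E + ((2 + eta) * (1 + eta^-1) * (4 * e))%:E)%E.
  move=> eta0 e0.
  have [H [wH hH hL]] := approx e e0; have [H' [wH' hH' hL']] := approx' e e0.
  have eF := join_family (tail_family wH tT) (tail_family wH' tT).
  have iso := family_ito_isometry hW eF.
  have mX := family_ito_coord (tail_family wH tT).
  have mX' := family_ito_coord (tail_family wH' tT).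
  have mp := family_process_jointly (tail_family wH tT).
  have mp' := family_process_jointly (tail_family wH' tT).
  set X := family_ito W (@tail_start H 0%E) _ _ in hL mX.
  set X' := family_ito W (@tail_start H' 0%E) _ _ in hL' mX'.
  set p := family_process (@tail_start H 0%E) _ _ in mp.
  set p' := family_process (@tail_start H' 0%E) _ _ in mp'.
  have iso' : sqL2 (fun w => X w - X' w)%R = sqH2 (fun t w => p t w - p' t w)%R.
    transitivity (\int[P]_w (enorm (family_ito W (join_fun (@tail_start H 0%E)
      (@tail_start H' 0%E)) (join_fun (@tail_end H) (@tail_end H'))
      (join_coef (fun i : 'I_(si_size H) => si_coef H i)
        (fun i : 'I_(si_size H') => si_coef H' i)) w) ^+ 2)%:E)%E.
      by apply: eq_integral => w _; rewrite join_ito.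
    rewrite iso; apply: eq_integral => w _; apply: eq_integral => s _.
    by rewrite join_process.
  have pE s w : p s w = simple_process H s w by exact: tail_process.
  have pE' s w : p' s w = simple_process H' s w by exact: tail_process.
  have hp : (sqH2 (fun t w => p t w - Z t w)%R <= e%:E)%E.
    by apply: le_trans hH; rewrite le_eqVlt; apply/orP; left; apply/eqP;
      apply: eq_integral => w _; apply: eq_integral => s _; rewrite pE.
  have hp' : (sqH2 (fun t w => p' t w - Z' t w)%R <= e%:E)%E.
    by apply: le_trans hH'; rewrite le_eqVlt; apply/orP; left; apply/eqP;
      apply: eq_integral => w _; apply: eq_integral => s _; rewrite pE'.
  have eta1 : 0 <= 1 + eta by lra.
  have eta2 : 0 <= 1 + eta^-1 by rewrite addr_ge0// invr_ge0 ltW.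
  have b1 : (sqH2 (fun t w => (Z t w - p t w) - (Z' t w - p' t w))%R <= (4 * e)%:E)%E.
    have := @sqH2_lin2 _ _ (fun t w => (Z t w - p t w) - (Z' t w - p' t w))%R
      (fun t w => p t w - Z t w)%R (fun t w => p' t w - Z' t w)%R 2 2.
    move=> /(_ (jointly_measurableB (jointly_measurableB mZ mp)
        (jointly_measurableB mZ' mp')) (jointly_measurableB mp mZ)
        (jointly_measurableB mp' mZ') _ _ _) -/(_ _ _ _)/le_trans; apply => //.
      move=> t w; rewrite (_ : _ - _ = - (p t w - Z t w) + (p' t w - Z' t w)); last first.
        by rewrite !opprB.
      by rewrite -(enormN (p t w - Z t w)); exact: sqr_enormD.
    exact: lee_double_sum.
  have b2 : (sqL2 (fun w => (X w - I w) - (X' w - I' w))%R <= (4 * e)%:E)%E.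
    have := @sqL2_lin2 _ _ (fun w => (X w - I w) - (X' w - I' w))%R
      (fun w => X w - I w)%R (fun w => X' w - I' w)%R 2 2.
    move=> /(_ (coord_measurableB (coord_measurableB mX mI)
        (coord_measurableB mX' mI')) (coord_measurableB mX mI)
        (coord_measurableB mX' mI') _ _ _) -/(_ _ _ _)/le_trans; apply => //.
      by move=> w; rewrite -(enormN (X' w - I' w)); exact: sqr_enormD.
    exact: lee_double_sum.
  have c1 : (N <= (1 + eta)%:E * sqH2 (fun t w => p t w - p' t w)%R +
     (1 + eta^-1)%:E * sqH2 (fun t w => (Z t w - p t w) - (Z' t w - p' t w))%R)%E.
    apply: sqH2_lin2 => //; try by do ?[exact: jointly_measurableB|
      apply: jointly_measurableB].
    move=> t w; have := sqr_enormD_weighted (p t w - p' t w)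
      ((Z t w - p t w) - (Z' t w - p' t w)) eta0.
    rewrite (_ : p t w - p' t w + _ = Z t w - Z' t w)//.
    by apply/matrixP => i j; rewrite !mxE; ring.
  have c2 : (sqL2 (fun w => X w - X' w)%R <= (1 + eta)%:E * E +
     (1 + eta^-1)%:E * sqL2 (fun w => (X w - I w) - (X' w - I' w))%R)%E.
    apply: sqL2_lin2 => //; try by do ?[exact: coord_measurableB|
      apply: coord_measurableB].
    move=> w; have := sqr_enormD_weighted (I w - I' w)
      ((X w - I w) - (X' w - I' w)) eta0.
    rewrite (_ : I w - I' w + _ = X w - X' w)//.
    by apply/matrixP => i j; rewrite !mxE; ring.
  apply: (le_trans c1); rewrite -iso'.
  apply: (@le_trans _ _ ((1 + eta)%:E * ((1 + eta)%:E * E + (1 + eta^-1)%:E * (4 * e)%:E)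
     + (1 + eta^-1)%:E * (4 * e)%:E))%E.
    apply: leeD; last by rewrite lee_wpmul2l// lee_fin.
    rewrite lee_wpmul2l ?lee_fin//; apply: (le_trans c2); rewrite leeD2l//.
    by rewrite lee_wpmul2l// lee_fin.
  rewrite ge0_muleDr; last 2 first.
  - by rewrite mule_ge0 ?lee_fin ?sqL2_ge0.
  - by rewrite mule_ge0 ?lee_fin// mulr_ge0// ltW.
  rewrite muleA -EFinM -!EFinM -addeA -EFinD le_eqVlt; apply/orP; left; apply/eqP.
  by congr (_%:E * _ + _%:E)%E; ring.
have [EI|] := ltP E +oo%E; last by rewrite leye_eq => /eqP ->; rewrite leey.
have Efin : E \is a fin_num by rewrite ge0_fin_numE ?sqL2_ge0.
rewrite -(fineK Efin) in key *; set x := fine E in key *.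
have x0 : 0 <= x by rewrite fine_ge0// sqL2_ge0.
apply/lee_addgt0Pr => dl dl0.
(* for eta at most 1, (1 + eta)^2 x exceeds x by at most 3 eta x, which is below dl / 2 *)
pose eta := Num.min 1 (dl / (2 * (3 * x + 1))).
have x1 : 0 < 2 * (3 * x + 1) by lra.
have eta0 : 0 < eta by rewrite lt_min ltr01 divr_gt0.
have eta1 : eta <= 1 by rewrite ge_min lexx.
have etax : eta * (2 * (3 * x + 1)) <= dl.
  by rewrite -ler_pdivlMr ?ge_min ?lexx ?orbT//.
pose c := (2 + eta) * (1 + eta^-1) * 4.
have c0 : 0 < c.
  by rewrite !mulr_gt0// addr_gt0// invr_gt0.
have e0 : 0 < dl / (2 * c) by rewrite divr_gt0// mulr_gt0.
apply: (le_trans (key eta (dl / (2 * c)) eta0 e0)).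
rewrite -EFinM -!EFinD lee_fin.
rewrite (_ : (2 + eta) * _ * _ = dl / 2); last first.
  by rewrite mulrA -/c; field; rewrite gt_eqF.
by nra.
Qed.

End ItoIntegral.

(** * Doob's inequality for finitely many times *)

Section AlmostEverywhere.
Context d (X : measurableType d) (R : realType) (mu : {measure set X -> \bar R}).

(** The minimum of f and g is below g everywhere and equals f almost
    everywhere. *)
Lemma le_Rintegral_ae (f g : X -> R) :
  mu.-integrable setT (EFin \o f) -> mu.-integrable setT (EFin \o g) ->
  {ae mu, forall x, f x <= g x} ->
  \int[mu]_x f x <= \int[mu]_x g x.
Proof.
move=> fi gi fg.
have mf : measurable_fun setT f by apply/measurable_EFinP; case/integrableP : fi.
have mg : measurable_fun setT g by apply/measurable_EFinP; case/integrableP : gi.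
pose h x := Num.min (f x) (g x).
have mh : measurable_fun setT h by exact: measurable_minr.
have fh : (\int[mu]_x (f x)%:E = \int[mu]_x (h x)%:E)%E.
  apply: ae_eq_integral => //; [exact/measurable_EFinP|exact/measurable_EFinP|].
  by apply: filterS fg => x fgx _; rewrite /h min_l.
have hi : mu.-integrable setT (EFin \o h).
  apply: (@le_integrable _ _ _ mu _ measurableT _
      (fun x => (abse \o (EFin \o f)) x + (abse \o (EFin \o g)) x)%E) => //.
  - exact/measurable_EFinP.
  - move=> x _; rewrite /h /= lee_fin /Num.min.
    rewrite (@ger0_norm _ (`|f x| + `|g x|)) ?addr_ge0//.
    by case: ifP => _; rewrite ?lerDl ?lerDr.
  - by apply: integrableD => //; exact: integrable_abse.
rewrite {1}/Rintegral fh -/(Rintegral mu setT h).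
by apply: le_Rintegral => // x _; rewrite /h ge_min lexx orbT.
Qed.

Lemma ae_sqint_le (f g : X -> R) : measurable_fun setT f -> sqint mu g ->
  {ae mu, forall x, `|f x| <= `|g x|} -> sqint mu f.
Proof.
move=> mf [mg ig] fg; split => //; apply: le_lt_trans ig.
apply: ae_ge0_le_integral => //.
- by move=> x _; rewrite lee_fin sqr_ge0.
- exact: measurable_sqr.
- by move=> x _; rewrite lee_fin sqr_ge0.
- exact: measurable_sqr.
- apply: filterS fg => x fgx _; rewrite lee_fin.
  by rewrite -(real_normK (num_real (f x))) -(real_normK (num_real (g x))) ler_sqr ?nnegrE.
Qed.

End AlmostEverywhere.

Section RunningMaximum.
Context {R : realType} {U : Type} {m : nat}.
Variable y : \bar R -> U -> 'cV[R]_m.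

(** Norms are nonnegative, so starting the maximum from 0 does not alter it on
    a nonempty list. *)
Definition runmax (s : seq (\bar R)) (w : U) : R :=
  foldl (fun a t => Num.max a (enorm (y t w))) 0 s.

Lemma runmax_rcons s t w :
  runmax (rcons s t) w = Num.max (runmax s w) (enorm (y t w)).
Proof. by rewrite /runmax foldl_rcons. Qed.

Lemma runmax_rconsE s t :
  runmax (rcons s t) = (fun w => Num.max (runmax s w) (enorm (y t w))).
Proof. by apply/funext => w; exact: runmax_rcons. Qed.

Lemma runmax_ge0 s w : 0 <= runmax s w.
Proof.
elim/last_ind: s => [|s t IH]; first by [].
by rewrite runmax_rcons le_max IH.
Qed.

Lemma runmax_le s w c :
  (runmax s w <= c) = (0 <= c) && all (fun t => enorm (y t w) <= c) s.
Proof.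
elim/last_ind: s => [|s t IH]; first by rewrite andbT.
by rewrite runmax_rcons ge_max IH all_rcons andbCA andbC.
Qed.

Lemma runmax_ge s w t : t \in s -> enorm (y t w) <= runmax s w.
Proof.
move=> ts; have := lexx (runmax s w); rewrite runmax_le => /andP[_ /allP].
exact.
Qed.

Lemma runmax_sub s s' w : {subset s <= s'} -> runmax s w <= runmax s' w.
Proof.
move=> ss'; rewrite runmax_le runmax_ge0/=; apply/allP => t /ss'.
exact: runmax_ge.
Qed.

End RunningMaximum.

Section Doob.
Context {R : realType} {disp : measure_display} {Omega : measurableType disp}.
Variables (P : probability Omega R) (T : \bar R).
Variable F : \bar R -> set (set Omega).
Context {d m : nat}.
Variable W : R -> Omega -> 'cV[R]_d.
Hypothesis hT : (0 < T)%E.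
Hypothesis hW : brownian_basis P T F W.

Variables (y I : \bar R -> Omega -> 'cV[R]_m) (B : Omega -> R).
Hypothesis ay : forall t, (0 <= t <= T)%E ->
  forall i, adapted F t (fun w => y t w i ord0).
Hypothesis y2 : forall t, (0 <= t <= T)%E -> forall i, sqint P (fun w => y t w i ord0).
Hypothesis I2 : forall t, (0 <= t <= T)%E -> forall i, sqint P (fun w => I t w i ord0).
Hypothesis Iorth : forall t, (0 <= t <= T)%E -> forall i psi,
  adapted F t psi -> sqint P psi -> \int[P]_w (psi w * I t w i ord0) = 0.
Hypothesis B2 : sqint P B.
Hypothesis yIB : forall t, (0 <= t <= T)%E ->
  {ae P, forall w, enorm (y t w + I t w) <= B w}.

Let coord_enorm_sqint (Y : Omega -> 'cV[R]_m) : (forall i, sqint P (fun w => Y w i ord0)) ->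
  sqint P (fun w => enorm (Y w)).
Proof.
move=> hY; have mY : measurable_fun setT (fun w => enorm (Y w)).
  by apply: measurable_enorm => i j; rewrite ord1; case: (hY i).
split => //.
have ii : P.-integrable setT (EFin \o (fun w => \sum_i (Y w i ord0) ^+ 2)).
  by apply: integrable_sumR => // i; exact: sqint_sqr.
case/integrableP : ii => _; apply: le_lt_trans.
rewrite le_eqVlt; apply/orP; left; apply/eqP; apply: eq_integral => w _ /=.
rewrite sqr_enormE ger0_norm ?sumr_ge0// => [|i _]; last exact: sqr_ge0.
by congr EFin; apply: eq_bigr => i _; rewrite big_ord1.
Qed.

Lemma adapted_enorm t : (0 <= t <= T)%E -> adapted F t (fun w => enorm (y t w)).
Proof.
move=> tT; apply/(adaptedP hW _ tT); apply: measurable_enorm => i j; rewrite ord1.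
exact/(adaptedP hW _ tT)/ay.
Qed.

Lemma adapted_runmax s t : (t <= T)%E -> all (fun r => 0 <= r <= t)%E s ->
  (0 <= t)%E -> adapted F t (runmax y s).
Proof.
move=> tT + t0; have tT' : (0 <= t <= T)%E by rewrite t0.
elim/last_ind: s => [_|s r IH].
  by apply/(adaptedP hW _ tT'); exact: measurable_cst.
rewrite all_rcons => /andP[/andP[r0 rt] /IH aM].
apply/(adaptedP hW _ tT').
rewrite runmax_rconsE.
apply: measurable_maxr; first exact/(adaptedP hW _ tT').
apply/(adaptedP hW _ tT'); apply: (adapted_le hW r0 rt tT).
by apply: adapted_enorm; rewrite r0 (le_trans rt).
Qed.

Lemma runmax_sqint s : all (fun r => 0 <= r <= T)%E s -> sqint P (runmax y s).
Proof.
elim/last_ind: s => [_|s t IH]; first by rewrite /runmax/=; exact: sqint0.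
rewrite all_rcons => /andP[tT sT].
have x2 : sqint P (fun w => enorm (y t w)) by apply: coord_enorm_sqint; exact: y2.
have m2 := IH sT.
apply: (sqint_le _ (sqintD m2 x2)) => [|w].
  rewrite runmax_rconsE.
  by apply: measurable_maxr; [case: m2|case: x2].
rewrite runmax_rcons !ger0_norm ?addr_ge0 ?runmax_ge0 ?enorm_ge0//.
  by rewrite ge_max lerDl lerDr runmax_ge0 enorm_ge0.
by rewrite le_max runmax_ge0.
Qed.

(** The increment of the running maximum at time t, multiplied by the unit
    vector y_t / |y_t|, is F_t-measurable and hence orthogonal to I_t. In the
    left side, y_t may therefore be replaced by y_t + I_t, of norm at most B.
    This replaces the conditional expectation in Doob's argument. *)
Lemma doob_step s t : (0 <= t <= T)%E -> all (fun r => 0 <= r <= t)%E s ->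
  \int[P]_w ((runmax y (rcons s t) w - runmax y s w) * enorm (y t w)) <=
  \int[P]_w ((runmax y (rcons s t) w - runmax y s w) * B w).
Proof.
move=> tT st; have /andP[t0 tT1] := tT.
pose dl w := runmax y (rcons s t) w - runmax y s w.
have dl0 w : 0 <= dl w by rewrite subr_ge0 runmax_rcons le_max lexx.
have sT : all (fun r => 0 <= r <= T)%E s.
  by apply: sub_all st => r /andP[-> rt]; rewrite (le_trans rt).
have s'T : all (fun r => 0 <= r <= T)%E (rcons s t) by rewrite all_rcons tT.
have adl : adapted F t dl.
  apply: (adaptedB hW) => //; apply: adapted_runmax => //.
  by rewrite all_rcons t0 lexx.
have sdl : sqint P dl by apply: sqintB; exact: runmax_sqint.
(* the quotient is 0 where y_t vanishes, since the inverse of 0 is 0 *)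
pose psi i w := dl w * (y t w i ord0 / enorm (y t w)).
have apsi i : adapted F t (psi i).
  apply: (adaptedM hW) => //; apply: (adaptedM hW) => //; first exact: ay.
  apply/(adaptedP hW _ tT).
  rewrite (_ : (fun w => _) = (@powR R ^~ (-1)) \o (fun w => enorm (y t w))).
    apply: measurableT_comp; first exact: measurable_powR.
    exact/(adaptedP hW _ tT)/adapted_enorm.
  by apply/funext => w /=; rewrite powR_inv1 ?enorm_ge0.
have psi_dl i w : `|psi i w| <= `|dl w|.
  rewrite normrM ler_piMr// normrM normfV (ger0_norm (enorm_ge0 _)).
  have [->|e0] := eqVneq (enorm (y t w)) 0; first by rewrite invr0 mulr0.
  by rewrite ler_pdivrMr ?mul1r ?ler_coord_enorm// lt_def e0 enorm_ge0.
have mpsi i : measurable_fun setT (psi i) by exact: (adapted_measurable hW tT).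
have psi2 i : sqint P (psi i) := sqint_le (mpsi i) sdl (psi_dl i).
have yI2 i : sqint P (fun w => (y t w + I t w) i ord0).
  by under eq_fun do rewrite mxE; apply: sqintD; [exact: y2|exact: I2].
have iy i : P.-integrable setT (EFin \o (fun w => psi i w * y t w i ord0)).
  by apply: sqint_mul => //; exact: y2.
have iyI i : P.-integrable setT (EFin \o (fun w => psi i w * (y t w + I t w) i ord0)).
  exact: sqint_mul.
have E1 : \int[P]_w (dl w * enorm (y t w)) = \sum_i \int[P]_w (psi i w * y t w i ord0).
  rewrite -Rintegral_sum//; apply: eq_Rintegral => w _.
  have -> : \sum_i (psi i w * y t w i ord0) =
     dl w * (enorm (y t w) ^+ 2 / enorm (y t w)).
    rewrite sqr_enormE mulr_suml mulr_sumr; apply: eq_bigr => i _.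
    by rewrite big_ord1 /psi; ring.
  have [->|e0] := eqVneq (enorm (y t w)) 0; first by rewrite invr0 !mulr0.
  by rewrite expr2 mulfK.
rewrite E1.
have -> : \sum_i \int[P]_w (psi i w * y t w i ord0) =
    \sum_i \int[P]_w (psi i w * (y t w + I t w) i ord0).
  apply: eq_bigr => i _.
  have -> : (fun w => psi i w * (y t w + I t w) i ord0) =
     (fun w => psi i w * y t w i ord0 + psi i w * I t w i ord0).
    by apply/funext => w; rewrite mxE mulrDr.
  rewrite RintegralD//; first by rewrite (Iorth tT) ?addr0.
  by apply: sqint_mul => //; exact: I2.
rewrite -Rintegral_sum//; apply: le_Rintegral_ae.
- exact: integrable_sumR.
- exact: sqint_mul.
apply: filterS (yIB tT) => w Bw.
have -> : \sum_i (psi i w * (y t w + I t w) i ord0) =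
   dl w * (mxdot (y t w) (y t w + I t w) / enorm (y t w)).
  rewrite /mxdot mulr_suml mulr_sumr; apply: eq_bigr => i _.
  by rewrite big_ord1 /psi; ring.
rewrite ler_wpM2l// (le_trans _ Bw)//.
have [->|e0] := eqVneq (enorm (y t w)) 0; first by rewrite invr0 mulr0 enorm_ge0.
rewrite ler_pdivrMr; last by rewrite lt_def e0 enorm_ge0.
by rewrite mulrC; exact: mxdot_le.
Qed.

(** Let M and M' be the maximum before and after time t. If M' > M then
    M' = |y_t|, so that M'^2 <= M^2 + 2 (M' - M) |y_t|. Sum over the times and
    apply [doob_step]. *)
Lemma doob_cross s : sorted <=%O s -> all (fun r => 0 <= r <= T)%E s ->
  \int[P]_w (runmax y s w ^+ 2) <= 2 * \int[P]_w (runmax y s w * B w).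
Proof.
elim/last_ind: s => [_ _|s t IH].
  rewrite (_ : (fun w => runmax y [::] w ^+ 2) = fun=> 0); last first.
    by apply/funext => w; rewrite /runmax/= expr0n.
  rewrite (_ : (fun w => runmax y [::] w * B w) = fun=> 0); last first.
    by apply/funext => w; rewrite /runmax/= mul0r.
  by rewrite Rintegral_cst//= !mul0r mulr0.
move=> srt; rewrite all_rcons => /andP[tT sT].
have {}IH := IH (subseq_sorted le_trans (subseq_rcons s t) srt) sT.
have st : all (fun r => 0 <= r <= t)%E s.
  apply/allP => r rs; have /allP/(_ _ rs)/andP[-> _] /= := sT.
  move: srt; rewrite (sorted_pairwise le_trans) pairwise_rcons => /andP[/allP + _].
  exact.
have s'T : all (fun r => 0 <= r <= T)%E (rcons s t) by rewrite all_rcons tT.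
have step := doob_step tT st.
have m2 := runmax_sqint sT; have m'2 := runmax_sqint s'T.
have x2 : sqint P (fun w => enorm (y t w)) by apply: coord_enorm_sqint; exact: y2.
pose mm := runmax y s; pose mm' := runmax y (rcons s t).
have d2 : sqint P (fun w => mm' w - mm w) by exact: sqintB.
have i1 := sqint_sqr m2; have i2 := sqint_mul d2 x2.
have i3 := sqint_mul m2 B2; have i4 := sqint_mul d2 B2.
have i2' : P.-integrable setT (EFin \o (fun w => 2 * ((mm' w - mm w) * enorm (y t w)))).
  exact: (integrableZl measurableT 2 i2).
apply: (@le_trans _ _ (\int[P]_w (mm w ^+ 2 + 2 * ((mm' w - mm w) * enorm (y t w))))).
  apply: le_Rintegral => //; first exact: sqint_sqr.
    exact: (integrableD measurableT i1 i2').
  move=> w _; rewrite /mm /mm' runmax_rcons /Num.max.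
  by case: ifPn => [ab|]; [nra|rewrite subrr mul0r mulr0 addr0].
rewrite RintegralD// RintegralZl//.
have -> : \int[P]_w (runmax y (rcons s t) w * B w) =
    \int[P]_w (mm w * B w) + \int[P]_w ((mm' w - mm w) * B w).
  rewrite -RintegralD//; apply: eq_Rintegral => w _.
  by rewrite -mulrDl addrC subrK.
by rewrite mulrDr lerD// ler_wpM2l.
Qed.

(** Absorb the cross term of [doob_cross] by 2 M B <= M^2 / 2 + 2 B^2. *)
Lemma doob_finite s : all (fun r => 0 <= r <= T)%E s ->
  \int[P]_w (runmax y s w ^+ 2) <= 4 * \int[P]_w (B w ^+ 2).
Proof.
move=> sT.
have sortE : runmax y (sort <=%O s) = runmax y s.
  by apply/funext => w; apply/eqP; rewrite eq_le !runmax_sub// => t; rewrite mem_sort.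
have := @doob_cross (sort <=%O s).
rewrite sortE => /(_ (sort_sorted le_total s)).
rewrite all_sort => /(_ sT) H.
have m2 := runmax_sqint sT.
have iM := sqint_sqr m2; have iB := sqint_sqr B2; have iMB := sqint_mul m2 B2.
have : 2 * \int[P]_w (runmax y s w * B w) <=
    2^-1 * \int[P]_w (runmax y s w ^+ 2) + 2 * \int[P]_w (B w ^+ 2).
  rewrite -!RintegralZl// -RintegralD//.
  - apply: le_Rintegral => //.
    + exact: (integrableZl measurableT 2 iMB).
    + apply: (integrableD measurableT (integrableZl measurableT 2^-1 iM)
        (integrableZl measurableT 2 iB)).
    + by move=> w _; have := sqr_ge0 (runmax y s w / 2 - B w); nra.
  - exact: (integrableZl measurableT 2^-1 iM).
  - exact: (integrableZl measurableT 2 iB).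
lra.
Qed.

(** At time 0 the vectors y and I are orthogonal in mean, so the second moment
    of I is at most that of y + I. *)
Lemma initial_orthogonality :
  (sqL2 P (I 0%E) <= (\int[P]_w (B w ^+ 2))%:E)%E.
Proof.
have tT : (0 <= (0 : \bar R) <= T)%E by apply/andP; split => //; exact: ltW.
have iI i := sqint_sqr (I2 tT i).
have iy i := sqint_sqr (y2 tT i).
have iyI i := sqint_mul (y2 tT i) (I2 tT i).
have s2 i : sqint P (fun w => (y 0%E w + I 0%E w) i ord0).
  by under eq_fun do rewrite mxE; apply: sqintD; [exact: y2|exact: I2].
have e2 : sqint P (fun w => enorm (y 0%E w + I 0%E w)) by exact: coord_enorm_sqint.
have -> : sqL2 P (I 0%E) = (\sum_i \int[P]_w (I 0%E w i ord0 ^+ 2))%:E.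
  rewrite -Rintegral_sum// -integral_EFin_Rintegral//; last exact: integrable_sumR.
  apply: eq_integral => w _; congr EFin; rewrite sqr_enormE.
  by apply: eq_bigr => i _; rewrite big_ord1.
rewrite lee_fin; apply: (@le_trans _ _ (\int[P]_w (enorm (y 0%E w + I 0%E w) ^+ 2))).
  have -> : \int[P]_w (enorm (y 0%E w + I 0%E w) ^+ 2) =
     \sum_i \int[P]_w ((y 0%E w + I 0%E w) i ord0 ^+ 2).
    rewrite -Rintegral_sum//; last by move=> i; exact: sqint_sqr.
    apply: eq_Rintegral => w _; rewrite sqr_enormE.
    by apply: eq_bigr => i _; rewrite big_ord1.
  apply: ler_sum => i _.
  have -> : (fun w => (y 0%E w + I 0%E w) i ord0 ^+ 2) =
     (fun w => (y 0%E w i ord0 ^+ 2 + 2 * (y 0%E w i ord0 * I 0%E w i ord0)) +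
        I 0%E w i ord0 ^+ 2).
    by apply/funext => w; rewrite mxE; ring.
  have i2 := integrableZl measurableT 2 (iyI i).
  rewrite RintegralD//; last exact: (integrableD measurableT (iy i) i2).
  rewrite RintegralD// RintegralZl// (Iorth tT) ?mulr0 ?addr0.
  - by rewrite lerDr; apply: Rintegral_ge0 => w _; exact: sqr_ge0.
  - exact: ay.
  - exact: y2.
apply: le_Rintegral_ae; [exact: sqint_sqr|exact: sqint_sqr|].
apply: filterS (yIB tT) => w Bw.
by rewrite ler_sqr ?nnegrE ?enorm_ge0// (le_trans (enorm_ge0 _) Bw).
Qed.

End Doob.

(** * Suprema of continuous paths *)

Section DenseTimes.
Context {R : realType}.
Variable T : \bar R.
Hypothesis hT : (0 < T)%E.

(** The rational times of [0, T] and T itself, which may be irrational or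
    infinite; every index that encodes no time of [0, T] is sent to T. *)
Definition dense_time (n : nat) : \bar R :=
  if (unpickle n : option rat) is Some q then
    if (0 <= (ratr q : R)%:E <= T)%E then (ratr q : R)%:E else T
  else T.

Lemma dense_time_in n : (0 <= dense_time n <= T)%E.
Proof.
have TT : (0 <= T <= T)%E by rewrite lexx ltW.
by rewrite /dense_time; case: unpickle => // q; case: ifP.
Qed.

Lemma dense_time_top : exists n, dense_time n = T.
Proof.
exists (pickle (-1 : rat)); rewrite /dense_time pickleK.
by rewrite rmorphN rmorph1 lee_fin lerNr oppr0 leNgt ltr01.
Qed.

Lemma dense_time_right (r : R) (U : set (\bar R)) : 0 <= r -> (r%:E < T)%E ->
  nbhs r%:E U -> exists n, U (dense_time n).
Proof.
move=> r0 rT /nbhs_EFin /nbhs_ballP[e /= e0 eU].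
have [b [rb bT be]] : exists b : R, [/\ r < b, (b%:E <= T)%E & b <= r + e].
  case: T rT => [b| |]//.
    rewrite lte_fin => rb; exists (Num.min b (r + e)); split.
    - by rewrite lt_min rb ltrDl.
    - by rewrite lee_fin ge_min lexx.
    - by rewrite ge_min lexx orbT.
  by exists (r + e); split; rewrite ?leey// ltrDl.
have /rat_in_itvoo[q] := rb; rewrite in_itv/= => /andP[rq qb].
exists (pickle q); rewrite /dense_time pickleK.
rewrite lee_fin (le_trans r0 (ltW rq))/= (le_trans _ bT) ?lee_fin ?(ltW qb)//.
apply: eU; rewrite /ball/= ltr_distlC; apply/andP; split; lra.
Qed.

Lemma enorm_cvg {U : Type} (G : set_system U) {FG : Filter G} p q
    (f : U -> 'M[R]_(p, q)) (A : 'M[R]_(p, q)) :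
  f x @[x --> G] --> A -> enorm (f x) @[x --> G] --> enorm A.
Proof.
move=> fA.
apply: (@cvg_comp _ _ _ (fun x => \sum_i \sum_j f x i j ^+ 2) (@Num.sqrt R) _
   (nbhs (\sum_i \sum_j A i j ^+ 2))); last exact: sqrt_continuous.
have cadd : continuous (fun x : R * R => x.1 + x.2) by exact: add_continuous.
apply: (cvg_big cadd) => i _; apply: (cvg_big cadd) => j _.
have fij : f x i j @[x --> G] --> A i j.
  exact: (cvg_comp _ _ fA (@coord_continuous R p q i j A)).
by rewrite !expr2; under eq_fun do rewrite expr2; exact: cvgM.
Qed.

Lemma continuous_sup_dense p q (X : \bar R -> 'M[R]_(p, q)) (c : R) :
  {within [set t : \bar R | (0 <= t <= T)%E], continuous X} ->
  (forall n, enorm (X (dense_time n)) <= c) ->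
  forall t, (0 <= t <= T)%E -> enorm (X t) <= c.
Proof.
move=> /subspace_continuousP cX Xc t tT; rewrite leNgt; apply/negP => cXt.
have near_t := cvgr_gt _ (enorm_cvg (cX t tT)) _ cXt.
have {}near_t : nbhs t (fun s => (0 <= s <= T)%E -> c < enorm (X s)) by exact: near_t.
suff [n Hn] : exists n, (0 <= dense_time n <= T)%E -> c < enorm (X (dense_time n)).
  by have := Hn (dense_time_in n); rewrite ltNge Xc.
have /andP[t0] := tT; rewrite le_eqVlt => /orP[/eqP tE|].
  by have [n nT] := dense_time_top; exists n => _; rewrite nT -tE.
case: t t0 tT cXt near_t => [r| |]// r0 _ _ near_t rT; last first.
  by rewrite ltNge leey in rT.
exact: dense_time_right near_t.
Qed.

End DenseTimes.

Section Supremum.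
Context {R : realType} {disp : measure_display} {Omega : measurableType disp}.
Variables (P : probability Omega R) (T : \bar R).
Hypothesis hT : (0 < T)%E.
Hypothesis cP : measure_is_complete P.
Context {p q : nat}.

(** The supremum whose second moment is the square of [S2norm]. *)
Definition path_sup (X : \bar R -> Omega -> 'M[R]_(p, q)) (w : Omega) : \bar R :=
  ereal_sup [set (enorm (X t w))%:E | t in [set t | (0 <= t <= T)%E]].

Lemma path_sup_ge X w t : (0 <= t <= T)%E -> ((enorm (X t w))%:E <= path_sup X w)%E.
Proof. by move=> tT; apply: ereal_sup_ubound; exists t. Qed.

Lemma path_sup_ge0 X w : (0 <= path_sup X w)%E.
Proof.
apply: le_trans (path_sup_ge X w (_ : (0 <= T <= T)%E)); last by rewrite lexx ltW.
by rewrite lee_fin enorm_ge0.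
Qed.

Definition dense_sup (X : \bar R -> Omega -> 'M[R]_(p, q)) (w : Omega) : \bar R :=
  ereal_sup (range (fun n => (enorm (X (dense_time T n) w))%:E)).

Lemma path_supE X w :
  {within [set t : \bar R | (0 <= t <= T)%E], continuous (X ^~ w)} ->
  path_sup X w = dense_sup X w.
Proof.
move=> cX; apply/eqP; rewrite eq_le; apply/andP; split; last first.
  apply: ge_ereal_sup => _ [n _ <-]; apply: path_sup_ge; exact: dense_time_in.
have ge n : ((enorm (X (dense_time T n) w))%:E <= dense_sup X w)%E.
  by apply: ereal_sup_ubound; exists n.
apply: ge_ereal_sup => _ [t tT <-].
case: (dense_sup X w) ge => [c| |] ge; [|by rewrite leey|by have := ge 0%N].
by rewrite lee_fin; apply: (continuous_sup_dense hT cX) tT => n; rewrite -lee_fin.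
Qed.

Lemma dense_sup_measurable (X : \bar R -> Omega -> 'M[R]_(p, q)) :
  (forall t i j, (0 <= t <= T)%E -> measurable_fun setT (fun w => X t w i j)) ->
  measurable_fun setT (dense_sup X).
Proof.
move=> mX.
have mn n : measurable_fun setT (fun w => (enorm (X (dense_time T n) w))%:E).
  apply/measurable_EFinP; apply: measurable_enorm => i j.
  by apply: mX; exact: dense_time_in.
have := measurable_fun_esups mn 0.
congr measurable_fun; apply/funext => w; rewrite /esups /dense_sup; congr ereal_sup.
by apply/seteqP; split => [_ [n _ <-]|_ [n _ <-]]; exists n.
Qed.

(** Along continuous paths the supremum may be taken over countably many times;
    as P is complete, the exceptional paths do not affect measurability. *)
Lemma path_sup_measurable (X : \bar R -> Omega -> 'M[R]_(p, q)) :
  (forall t i j, (0 <= t <= T)%E -> measurable_fun setT (fun w => X t w i j)) ->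
  continuous_paths P T X -> measurable_fun setT (path_sup X).
Proof.
move=> mX cX; apply: (ae_measurable_fun cP _ (dense_sup_measurable mX)).
by apply: filterS cX => w cw _; rewrite path_supE.
Qed.

End Supremum.

Section DoobSup.
Context {R : realType} {disp : measure_display} {Omega : measurableType disp}.
Variables (P : probability Omega R) (T : \bar R).
Hypothesis hT : (0 < T)%E.
Hypothesis cP : measure_is_complete P.
Context {m : nat}.
Variable y : \bar R -> Omega -> 'cV[R]_m.
Hypothesis my : forall t i, (0 <= t <= T)%E -> measurable_fun setT (fun w => y t w i ord0).
Hypothesis cy : continuous_paths P T y.

(** The running maxima over the first n dense times increase to the supremum. *)
Lemma path_sup_bound (C : R) :
  (forall s, all (fun r => 0 <= r <= T)%E s -> sqint P (runmax y s)) ->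
  (forall s, all (fun r => 0 <= r <= T)%E s ->
     \int[P]_w (runmax y s w ^+ 2) <= C) ->
  (\int[P]_w (path_sup T y w ^+ 2) <= C%:E)%E.
Proof.
move=> hs hC.
pose s n := mkseq (dense_time T) n.
have sT n : all (fun r => 0 <= r <= T)%E (s n).
  by apply/allP => _ /mapP[k _ ->]; exact: dense_time_in.
pose g n w := ((runmax y (s n) w) ^+ 2)%:E.
have mg n : measurable_fun setT (g n) by apply: measurable_sqr; case: (hs _ (sT n)).
have g0 n w : (0 <= g n w)%E by rewrite lee_fin sqr_ge0.
have ndM w : {homo (fun n => runmax y (s n) w) : n k / (n <= k)%N >-> n <= k}.
  move=> n k nk; apply: runmax_sub => _ /mapP[i + ->]; rewrite mem_iota/= add0n => ik.
  by apply: map_f; rewrite mem_iota/= add0n (leq_trans ik).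
have ndg w : {homo (fun n => g n w) : n k / (n <= k)%N >-> (n <= k)%E}.
  by move=> n k nk; rewrite lee_fin ler_sqr ?nnegrE ?runmax_ge0//; exact: ndM.
have mS : measurable_fun setT (fun w => path_sup T y w ^+ 2)%E.
  have mp : measurable_fun setT (path_sup T y).
    by apply: (path_sup_measurable hT cP) => // t i j tT; rewrite ord1; exact: my.
  by under eq_fun do rewrite expe2; exact: emeasurable_funM.
have mg' : measurable_fun setT (fun w => ereal_sup (range (g ^~ w))).
  have := measurable_fun_esups mg 0.
  congr measurable_fun; apply/funext => w; rewrite /esups; congr ereal_sup.
  by apply/seteqP; split => [_ [n _ <-]|_ [n _ <-]]; exists n.
apply: (@le_trans _ _ (\int[P]_w ereal_sup (range (g ^~ w)))%E).
  apply: ae_ge0_le_integral => //.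
  - by move=> w _; rewrite expe_ge0 ?path_sup_ge0.
  - by move=> w _; apply: le_trans (g0 0%N w) (ereal_sup_ubound _); exists 0%N.
  apply: filterS cy => w cw _.
  have gle n : (g n w <= ereal_sup (range (g ^~ w)))%E.
    by apply: ereal_sup_ubound; exists n.
  case: (ereal_sup _) gle => [c| |] gle; [|by rewrite leey|by have := gle 0%N].
  have c0 : 0 <= c by rewrite -lee_fin (le_trans (g0 0%N w)).
  have : (path_sup T y w <= (Num.sqrt c)%:E)%E.
    apply: ge_ereal_sup => _ [t tT <-]; rewrite lee_fin.
    apply: (continuous_sup_dense hT cw) tT => n.
    rewrite -ler_sqr ?nnegrE ?enorm_ge0 ?sqrtr_ge0// [leRHS]sqr_sqrtr//.
    have := gle n.+1; rewrite lee_fin; apply: le_trans.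
    rewrite ler_sqr ?nnegrE ?enorm_ge0 ?runmax_ge0//; apply: runmax_ge.
    by apply: map_f; rewrite mem_iota/= add0n ltnSn.
  move: (path_sup_ge0 hT y w); case: (path_sup T y w) => [r| |]// r0.
  rewrite lee_fin => rc; rewrite -EFin_expe lee_fin -(sqr_sqrtr c0).
  by rewrite ler_sqr ?nnegrE ?sqrtr_ge0.
have supE w : (ereal_sup (range (g ^~ w)) = limn (g ^~ w))%E.
  by apply/esym/cvg_lim => //; exact: ereal_nondecreasing_cvgn.
under eq_integral do rewrite supE.
rewrite monotone_convergence//.
apply: lime_le.
  apply: ereal_nondecreasing_is_cvgn => n k nk.
  by apply: ge0_le_integral => // w _; exact: ndg.
apply: nearW => n.
rewrite integral_EFin_Rintegral//; last exact/sqint_sqr/hs.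
by rewrite lee_fin hC.
Qed.

End DoobSup.

(** * Differences of finite measures *)

Section FiniteMeasureDifference.
Context d (X : measurableType d) (R : realType).

(** A measure has to be nonnegative on every set, measurable or not; the
    absolute value ensures this and changes nothing on measurable sets. *)
Lemma finite_measure_difference (alpha beta : {finite_measure set X -> \bar R}) :
  (forall A, measurable A -> alpha A <= beta A)%E ->
  exists nu : {finite_measure set X -> \bar R},
    forall A, measurable A -> (beta A = alpha A + nu A)%E.
Proof.
move=> ab.
have fa A : measurable A -> alpha A \is a fin_num by exact: fin_num_measure.
have fb A : measurable A -> beta A \is a fin_num by exact: fin_num_measure.
pose f (A : set X) : \bar R := `|fine (beta A) - fine (alpha A)|%:E.
have fE A : measurable A -> f A = (fine (beta A) - fine (alpha A))%:E.
  move=> mA; rewrite /f ger0_norm// subr_ge0 fine_le//; last exact: ab.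
  - exact: fa.
  - exact: fb.
have f0 : f set0 = 0%E by rewrite fE// !measure0 subrr.
have fge A : (0 <= f A)%E by rewrite lee_fin.
have fsa : semi_sigma_additive f.
  move=> B mB tB mUB; rewrite fE//.
  have cv (mu : {finite_measure set X -> \bar R}) :
      (\sum_(0 <= i < n) fine (mu (B i)))%R @[n --> \oo] --> fine (mu (\bigcup_n B n)).
    have := @measure_semi_sigma_additive _ _ _ mu B mB tB mUB.
    rewrite -[X in _ --> X](@fineK _ (mu (\bigcup_n B n))); last exact: fin_num_measure.
    move=> /fine_cvg; rewrite (_ : fine \o _ = (fun n => \sum_(0 <= i < n) fine (mu (B i))))//.
    by apply/funext => n /=; rewrite sum_fine// => i _; exact: fin_num_measure.
  rewrite (_ : (fun n => _) = EFin \o (fun n => \sum_(0 <= i < n) fine (beta (B i)) -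
     \sum_(0 <= i < n) fine (alpha (B i)))); last first.
    apply/funext => n /=; rewrite -sumrB -sumEFin; apply: eq_bigr => i _.
    exact: fE.
  by apply: cvg_EFin; [exact: nearW|apply: cvgB; exact: cv].
pose nu0 : {measure set X -> \bar R} := HB.pack f (isMeasure.Build _ _ _ f f0 fge fsa).
have fin : fin_num_fun nu0 by move=> A mA; rewrite [nu0 A]fE.
pose nu : {finite_measure set X -> \bar R} :=
  HB.pack (Measure.sort nu0) (Measure_isFinite.Build _ _ _ (Measure.sort nu0) fin).
exists nu => A mA; rewrite [nu A]fE// -[alpha A]fineK ?fa// -EFinD addrC subrK fineK//.
exact: fb.
Qed.

End FiniteMeasureDifference.

(** * Integrals of matrix-valued functions *)

Section MatrixIntegral.
Context d (X : measurableType d) (R : realType).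
Context {p q : nat}.
Variables (D : set X).
Hypothesis mD : measurable D.
Implicit Types f : X -> 'M[R]_(p, q).

Definition mxintegrable (mu : {measure set X -> \bar R}) f :=
  (forall i j, measurable_fun D (fun x => f x i j)) /\
  (\int[mu]_(x in D) (enorm (f x))%:E < +oo)%E.

Variable mu : {measure set X -> \bar R}.

Lemma mxintegrable_coord f i j : mxintegrable mu f ->
  mu.-integrable D (EFin \o (fun x => f x i j)).
Proof.
move=> [mf fi]; apply/integrableP; split; first exact/measurable_EFinP.
apply: le_lt_trans fi; apply: ge0_le_integral => //.
- by apply/measurable_EFinP; apply: measurableT_comp.
- by apply/measurable_EFinP; exact: measurable_enorm.
- by move=> x _; rewrite lee_fin ler_coord_enorm.
Qed.

Lemma mxintegrable_enorm f : mxintegrable mu f ->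
  mu.-integrable D (EFin \o (fun x => enorm (f x))).
Proof.
move=> [mf fi]; apply/integrableP; split.
  by apply/measurable_EFinP; exact: measurable_enorm.
apply: le_lt_trans fi; apply: ge0_le_integral => //.
- apply/measurable_EFinP; apply: measurableT_comp => //; exact: measurable_enorm.
- by apply/measurable_EFinP; exact: measurable_enorm.
- by move=> x _ /=; rewrite lee_fin ger0_norm ?enorm_ge0.
Qed.

Lemma measurable_coordB f (g : X -> 'M[R]_(p, q)) : (forall i j, measurable_fun D (fun x => f x i j)) ->
  (forall i j, measurable_fun D (fun x => g x i j)) ->
  forall i j, measurable_fun D (fun x => (f x - g x) i j).
Proof.
by move=> mf mg i j; under eq_fun do rewrite !mxE; exact: measurable_funB.
Qed.

Lemma mxintegrableB f g : mxintegrable mu f -> mxintegrable mu g ->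
  mxintegrable mu (fun x => f x - g x).
Proof.
move=> hf hg; have [[mf fi] [mg gi]] := (hf, hg).
split; first exact: measurable_coordB.
apply: (@le_lt_trans _ _ (\int[mu]_(x in D) ((enorm (f x))%:E + (enorm (g x))%:E)))%E.
  apply: ge0_le_integral => //.
  - by move=> x _; rewrite lee_fin enorm_ge0.
  - apply/measurable_EFinP; apply: measurable_enorm; exact: measurable_coordB.
  - by apply: emeasurable_funD; apply/measurable_EFinP; exact: measurable_enorm.
  - by move=> x _; rewrite -EFinD lee_fin ler_enormB.
rewrite ge0_integralD//; first by rewrite lte_add_pinfty.
- by move=> x _; rewrite lee_fin enorm_ge0.
- by apply/measurable_EFinP; exact: measurable_enorm.
- by move=> x _; rewrite lee_fin enorm_ge0.
- by apply/measurable_EFinP; exact: measurable_enorm.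
Qed.

Lemma mxRintegralB f g : mxintegrable mu f -> mxintegrable mu g ->
  mxRintegral mu D (fun x => f x - g x) = mxRintegral mu D f - mxRintegral mu D g.
Proof.
move=> hf hg; apply/matrixP => i j; rewrite !mxE -RintegralB//.
- by apply: eq_Rintegral => x _; rewrite !mxE.
- exact: mxintegrable_coord.
- exact: mxintegrable_coord.
Qed.

(** Test the integral V against itself: |V|^2 is the integral of the inner
    product of V with f, which is at most |V| times the integral of |f|. *)
Lemma enorm_mxRintegral f : mxintegrable mu f ->
  ((enorm (mxRintegral mu D f))%:E <= \int[mu]_(x in D) (enorm (f x))%:E)%E.
Proof.
move=> hf; have ie := mxintegrable_enorm hf.
rewrite -[leRHS]fineK; last exact: (integrable_fin_num mD ie).
rewrite lee_fin -/(Rintegral mu D (fun x => enorm (f x))).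
set V := mxRintegral _ _ _.
have [V0|V0] := eqVneq (enorm V) 0.
  by rewrite V0; apply: Rintegral_ge0 => x _; exact: enorm_ge0.
have Vpos : 0 < enorm V by rewrite lt_def V0 enorm_ge0.
rewrite -(ler_pM2l Vpos) -expr2 sqr_enorm -RintegralZl//.
have ic i j := mxintegrable_coord i j hf.
have icz i j : mu.-integrable D (EFin \o (fun x => V i j * f x i j)).
  exact: (integrableZl mD (V i j) (ic i j)).
have irow i : mu.-integrable D (EFin \o (fun x => \sum_j V i j * f x i j)).
  exact: integrable_sumR.
have -> : mxdot V V = \int[mu]_(x in D) mxdot V (f x).
  rewrite [RHS]Rintegral_sum//.
  apply: eq_bigr => i _; rewrite Rintegral_sum//.
  by apply: eq_bigr => j _; rewrite RintegralZl// mxE.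
apply: le_Rintegral => //.
- exact: integrable_sumR.
- exact: (integrableZl mD (enorm V) ie).
- by move=> x _; exact: mxdot_le.
Qed.

End MatrixIntegral.

Lemma mxintegrable_le d (X : measurableType d) (R : realType) p q (D : set X)
    (mu nu : {measure set X -> \bar R}) (f : X -> 'M[R]_(p, q)) :
  measurable D -> (forall A, measurable A -> mu A <= nu A)%E ->
  mxintegrable D nu f -> mxintegrable D mu f.
Proof.
move=> mD mn [mf fi]; split => //; apply: le_lt_trans fi.
rewrite 2!(integral_mkcond D); apply: ge0_le_measure_integral => //.
- by move=> x; rewrite patchE; case: ifP => // _; rewrite lee_fin enorm_ge0.
- apply/(measurable_restrictT _ mD)/measurable_EFinP; exact: measurable_enorm.
Qed.

Lemma mxRintegral_measure_add d (X : measurableType d) (R : realType) p q (D : set X)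
    (mu nu la : {measure set X -> \bar R}) (f : X -> 'M[R]_(p, q)) :
  measurable D -> (forall A, measurable A -> la A = mu A + nu A)%E ->
  mxintegrable D la f ->
  mxRintegral la D f = mxRintegral mu D f + mxRintegral nu D f.
Proof.
move=> mD lE hf.
have hm : mxintegrable D mu f.
  by apply: mxintegrable_le hf => // A mA; rewrite lE// leeDl.
have hn : mxintegrable D nu f.
  by apply: mxintegrable_le hf => // A mA; rewrite lE// leeDr.
apply/matrixP => i j; rewrite !mxE /Rintegral.
have im := mxintegrable_coord mD i j hm; have inn := mxintegrable_coord mD i j hn.
rewrite (_ : (\int[la]_(x in D) _ = \int[mu]_(x in D) (f x i j)%:E + \int[nu]_(x in D) (f x i j)%:E)%E).
  by rewrite fineD//; exact: integrable_fin_num.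
rewrite -integral_measure_add//.
by apply: eq_measure_integral => A mA _; exact: (etrans (lE A mA) (esym (measure_addE mu nu A))).
Qed.

(** * The delay operator along a path *)

Section DelayOperator.
Context {R : realType}.
Variable T : \bar R.
Local Notation leb := (@lebesgue_measure R).
Implicit Types (beta : {finite_measure set \bar R -> \bar R}) (k : \bar R -> R).

Definition horizon : set (\bar R) := [set t | (0 <= t <= T)%E].

Lemma measurable_horizon : measurable horizon.
Proof. exact: measurable_time. Qed.

Lemma measurable_past : measurable (past T).
Proof. exact: emeasurable_itv. Qed.

Lemma measurable_delay_sum k : measurable_fun setT k ->
  measurable_fun setT (fun z : measurableTypeR R * \bar R => k (z.1%:E + z.2)%E).
Proof.
move=> mk; apply: (measurableT_comp (f := k)) => //.
apply: emeasurable_funD; last exact: measurable_snd.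
by apply: (measurableT_comp (@EFin_measurable R setT)); exact: measurable_fst.
Qed.

Lemma delay_restrict_joint k : measurable_fun setT k ->
  measurable_fun setT (fun z : measurableTypeR R * \bar R =>
    ((fun r => k (z.1%:E + r)%E) \_ (past T)) z.2).
Proof.
move=> mk.
have -> : (fun z : measurableTypeR R * \bar R =>
    ((fun r => k (z.1%:E + r)%E) \_ (past T)) z.2) =
  (fun z => k (z.1%:E + z.2)%E) \_ (setT `*` past T).
  apply/funext => z; rewrite !patchE; congr (if _ then _ else _).
  by apply/idP/idP; rewrite !inE => // -[].
apply/(measurable_restrictT _ (measurableX measurableT measurable_past)).
by apply: measurable_funTS; exact: measurable_delay_sum.
Qed.

Lemma delay_integral_measurable_ge0 k beta : measurable_fun setT k ->
  (forall t, 0 <= k t) ->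
  measurable_fun [set: measurableTypeR R]
    (fun s => \int[beta]_(r in past T) (k (s%:E + r)%E)%:E)%E.
Proof.
move=> mk k0.
rewrite (_ : (fun s => _) = fubini_F beta (fun z : measurableTypeR R * \bar R =>
    (((fun r => k (z.1%:E + r)%E) \_ (past T)) z.2)%:E)).
  apply: measurable_fun_fubini_tonelli_F => [|z].
    by apply/measurable_EFinP; exact: delay_restrict_joint.
  by rewrite lee_fin patchE; case: ifP.
apply/funext => s; rewrite /fubini_F [LHS]integral_mkcond.
by apply: eq_integral => r _; rewrite !patchE; case: ifP.
Qed.

(** By Tonelli the left side is the integral over r of the integral of k(s + r)
    in s, and each of these is at most the integral of k by translation
    invariance. At r = -oo every delayed time is -oo, where k vanishes. *)
Lemma delay_integral_le k beta : measurable_fun setT k -> (forall t, 0 <= k t) ->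
  (forall t, ~ horizon t -> k t = 0) ->
  (\int[leb]_(s in rtime 0 T) \int[beta]_(r in past T) (k (s%:E + r)%E)%:E <=
   beta (past T) * \int[leb]_(s in rtime 0 T) (k s%:E)%:E)%E.
Proof.
move=> mk k0 kT.
pose f (z : measurableTypeR R * \bar R) :=
  (((fun r => k (z.1%:E + r)%E) \_ (past T)) z.2)%:E.
have mf : measurable_fun setT f by apply/measurable_EFinP; exact: delay_restrict_joint.
have f0 z : (0 <= f z)%E by rewrite lee_fin patchE; case: ifP.
have mkE : measurable_fun [set: measurableTypeR R] (fun s : R => (k s%:E)%:E).
  apply/measurable_EFinP; apply: (measurableT_comp (f := k)) => //.
apply: (@le_trans _ _ (\int[leb]_s \int[beta]_r f (s, r))%E).
  have mF : measurable_fun [set: measurableTypeR R] (fun s => \int[beta]_r f (s, r))%E.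
    exact: measurable_fun_fubini_tonelli_F.
  apply: (@le_trans _ _ (\int[leb]_(s in rtime 0 T) \int[beta]_r f (s, r))%E).
    rewrite le_eqVlt; apply/orP; left; apply/eqP; apply: eq_integral => s _.
    rewrite integral_mkcond; apply: eq_integral => r _.
    by rewrite /f !patchE/=; case: ifP.
  apply: ge0_subset_integral => //; first exact: measurable_rtime.
  by move=> s _; apply: integral_ge0 => r _.
have -> : (\int[leb]_s \int[beta]_r f (s, r) = \int[beta]_r \int[leb]_s f (s, r))%E.
  exact: (@fubini_tonelli _ _ (measurableTypeR R) _ R leb beta f).
set C := (\int[leb]_(s in rtime 0 T) (k s%:E)%:E)%E.
have C0 : (0 <= C)%E by apply: integral_ge0 => s _; rewrite lee_fin.
have kC : (\int[leb]_s (k s%:E)%:E = C)%E.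
  rewrite /C [RHS]integral_mkcond; apply: eq_integral => s _; rewrite patchE.
  case: ifPn => // /negP sT; rewrite kT//.
  by move=> sT'; apply: sT; rewrite inE.
move: C C0 kC => C C0 kC.
apply: (@le_trans _ _ (\int[beta]_(r in past T) (cst C r))%E); last first.
  by rewrite (integral_cst _ measurable_past) muleC.
rewrite [leRHS]integral_mkcond; apply: ge0_le_integral => //.
- by move=> r _; apply: integral_ge0 => s _; exact: f0.
- exact: (@measurable_fun_fubini_tonelli_G _ _ (measurableTypeR R) _ R leb f).
- apply/(measurable_restrictT _ measurable_past); exact: measurable_cst.
move=> r _; rewrite patchE; case: ifPn => [|/negP rp]; last first.
  rewrite integral0_eq// => s _; rewrite /f/= patchE ifF//.
  exact/negP.
rewrite inE => rp; have fE s : f (s, r) = (k (s%:E + r)%E)%:E.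
  by rewrite /f/= patchE ifT// inE.
under eq_integral do rewrite fE.
move: rp; rewrite /past/= in_itv/= => /andP[_]; case: r {fE} => [r _|//|_].
  rewrite (@ge0_integral_shift R r (fun s => (k s%:E)%:E)) ?kC// => s.
  by rewrite lee_fin.
by rewrite integral0_eq// => s _; rewrite addeNy kT.
Qed.

End DelayOperator.

(** Stated separately because the carrier of Lebesgue measure is an alias of
    the reals, with its own sigma-algebra. *)
Instance lebesgue_ae_filter (R : realType) :
  Filter (nbhs (almost_everywhere (@lebesgue_measure R))).
Proof. exact: (@ae_filter_ringOfSetsType _ (measurableTypeR R)). Qed.

Section DelayPath.
Context {R : realType}.
Variable T : \bar R.
Local Notation leb := (@lebesgue_measure R).
Implicit Types (beta : {finite_measure set \bar R -> \bar R}) (k : \bar R -> R).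

(** The integral is the difference of those of the positive and negative parts. *)
Lemma delay_integral_measurable k beta : measurable_fun setT k ->
  measurable_fun [set: measurableTypeR R]
    (fun s => \int[beta]_(r in past T) (k (s%:E + r)%E)%:E)%E.
Proof.
move=> mk; under eq_fun do rewrite integralE.
apply: emeasurable_funB.
  under eq_fun => s.
    under eq_integral => r _.
      rewrite (_ : _^\+%E r = (Num.max (k (s%:E + r)%E) 0)%:E); last first.
        by rewrite funeposE -EFin_max.
      over.
    over.
  apply: (@delay_integral_measurable_ge0 R T (fun t => Num.max (k t) 0) beta).
    by apply: measurable_maxr => //; exact: measurable_cst.
  by move=> t; rewrite le_max lexx orbT.
under eq_fun => s.
  under eq_integral => r _.
    rewrite (_ : _^\-%E r = (Num.max (- k (s%:E + r)%E) 0)%:E); last first.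
      by rewrite funenegE -EFin_max.
    over.
  over.
apply: (@delay_integral_measurable_ge0 R T (fun t => Num.max (- k t) 0) beta).
  apply: measurable_maxr; last exact: measurable_cst.
  exact: measurableT_comp.
by move=> t; rewrite le_max lexx orbT.
Qed.

Context {p q : nat}.
Variable h : \bar R -> R.
Hypothesis mh : measurable_fun (horizon T) h.
Implicit Types x : \bar R -> 'M[R]_(p, q).

Definition path_measurable x :=
  forall i j, measurable_fun (horizon T) (fun t => x t i j).

Definition delayed x (t : \bar R) := zero_ext h t *: zero_ext x t.

(** [delay_term] along a single path. *)
Definition delay x beta (t : \bar R) : 'M[R]_(p, q) :=
  mxRintegral beta (past T) (fun r => delayed x (t + r)%E).

(** The norm of [delayed], cut off at T. The cut is invisible to the delay
    operator, whose times s + r never exceed T. *)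
Definition weight x : \bar R -> R := (fun t => `|h t| * enorm (x t)) \_ (horizon T).

Lemma past_time s r : rtime 0 T s -> past T r -> (s%:E + r <= T)%E.
Proof.
rewrite /rtime /past/= in_itv/= => /andP[_ sT] /andP[_ r0].
by rewrite -[leRHS]adde0 leeD.
Qed.

Lemma delayed_entry x s r i j : rtime 0 T s -> past T r ->
  delayed x (s%:E + r)%E i j = ((fun t => h t * x t i j) \_ (horizon T)) (s%:E + r)%E.
Proof.
move=> sT rT; have srT := past_time sT rT.
rewrite /delayed mxE patchE /zero_ext; case: ifPn => sr.
  by rewrite ifT// inE /horizon/= sr.
by rewrite mul0r ifF//; apply/negP; rewrite inE /horizon/= (negbTE sr).
Qed.

Lemma delayed_weight x s r : rtime 0 T s -> past T r ->
  enorm (delayed x (s%:E + r)%E) = weight x (s%:E + r)%E.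
Proof.
move=> sT rT; have srT := past_time sT rT.
rewrite /delayed /weight enormZ patchE /zero_ext; case: ifPn => sr.
  by rewrite ifT// inE /horizon/= sr.
by rewrite normr0 mul0r ifF//; apply/negP; rewrite inE /horizon/= (negbTE sr).
Qed.

Lemma weight_ge0 x t : 0 <= weight x t.
Proof. by rewrite /weight patchE; case: ifP => // _; rewrite mulr_ge0 ?enorm_ge0. Qed.

Lemma weight_out x t : ~ horizon T t -> weight x t = 0.
Proof. by move=> tT; rewrite /weight patchE ifF//; apply/negP; rewrite inE. Qed.

Lemma weight_in x s : rtime 0 T s -> weight x s%:E = `|h s%:E| * enorm (x s%:E).
Proof. by move=> sT; rewrite /weight patchE ifT// inE. Qed.

Lemma measurable_weight x : path_measurable x -> measurable_fun setT (weight x).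
Proof.
move=> mx; apply/(measurable_restrictT _ (measurable_horizon T)).
apply: measurable_funM; first exact: measurableT_comp.
exact: measurable_enorm.
Qed.

Lemma path_measurableB x y : path_measurable x -> path_measurable y ->
  path_measurable (fun t => x t - y t).
Proof.
by move=> mx my i j; under eq_fun do rewrite !mxE; exact: measurable_funB.
Qed.

Lemma delayed_measurable x s i j : path_measurable x -> rtime 0 T s ->
  measurable_fun (past T) (fun r => delayed x (s%:E + r)%E i j).
Proof.
move=> mx sT.
apply: (eq_measurable_fun (fun r =>
   ((fun t => h t * x t i j) \_ (horizon T)) (s%:E + r)%E)).
  by move=> r; rewrite inE => rT; rewrite -delayed_entry.
apply: measurable_funTS; apply: (measurableT_comp (f := _ \_ _)).
  apply/(measurable_restrictT _ (measurable_horizon T)).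
  exact: measurable_funM.
exact: emeasurable_funD.
Qed.

Lemma delay_measurable x beta i j : path_measurable x ->
  measurable_fun (rtime 0 T : set (measurableTypeR R)) (fun s => delay x beta s%:E i j).
Proof.
move=> mx.
apply: (eq_measurable_fun (fun s : measurableTypeR R => fine (\int[beta]_(r in past T)
   (((fun t => h t * x t i j) \_ (horizon T)) (s%:E + r)%E)%:E)%E)).
  move=> s; rewrite inE => sT; rewrite /delay mxE /Rintegral; congr fine.
  by apply: eq_integral => r; rewrite inE => rT; rewrite delayed_entry.
apply: measurable_funTS; apply: (measurableT_comp (fine_measurable measurableT)).
apply: delay_integral_measurable.
apply/(measurable_restrictT _ (measurable_horizon T)).
exact: measurable_funM.
Qed.

Lemma delayed_weight_integral x beta s : rtime 0 T s ->
  (\int[beta]_(r in past T) (enorm (delayed x (s%:E + r)%E))%:E =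
   \int[beta]_(r in past T) (weight x (s%:E + r)%E)%:E)%E.
Proof.
by move=> sT; apply: eq_integral => r; rewrite inE => rT; rewrite delayed_weight.
Qed.

Definition weighted_norm x : \bar R :=
  (\int[leb]_(s in rtime 0 T) (`|h s%:E| * enorm (x s%:E))%:E)%E.

Lemma weight_delay_le x beta : path_measurable x ->
  (\int[leb]_(s in rtime 0 T) \int[beta]_(r in past T) (weight x (s%:E + r)%E)%:E <=
   beta (past T) * weighted_norm x)%E.
Proof.
move=> mx.
have -> : (weighted_norm x = \int[leb]_(s in rtime 0 T) (weight x s%:E)%:E)%E.
  by apply: eq_integral => s; rewrite inE => sT; rewrite weight_in.
apply: delay_integral_le; [exact: measurable_weight|exact: weight_ge0|].
exact: weight_out.
Qed.

Lemma weight_delay_measurable x beta : path_measurable x ->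
  measurable_fun (rtime 0 T : set (measurableTypeR R))
    (fun s => \int[beta]_(r in past T) (weight x (s%:E + r)%E)%:E)%E.
Proof.
move=> mx; apply: measurable_funTS.
by apply: delay_integral_measurable_ge0; [exact: measurable_weight|exact: weight_ge0].
Qed.

(** The integral over s of the delay integrals is finite by [weight_delay_le],
    so almost all of them are. *)
Lemma delayed_mxintegrable x beta : path_measurable x -> (weighted_norm x < +oo)%E ->
  {ae leb, forall s, rtime 0 T s ->
     mxintegrable (past T) beta (fun r => delayed x (s%:E + r)%E)}.
Proof.
move=> mx fx.
have ii : leb.-integrable (rtime 0 T)
    (fun s => \int[beta]_(r in past T) (weight x (s%:E + r)%E)%:E)%E.
  apply/integrableP; split; first exact: weight_delay_measurable.
  have -> : (\int[leb]_(s in rtime 0 T)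
      `|\int[beta]_(r in past T) (weight x (s%:E + r)%E)%:E| =
    \int[leb]_(s in rtime 0 T)
      \int[beta]_(r in past T) (weight x (s%:E + r)%E)%:E)%E.
    apply: eq_integral => s _; rewrite gee0_abs//.
    by apply: integral_ge0 => r _; rewrite lee_fin weight_ge0.
  apply: le_lt_trans (weight_delay_le beta mx) _.
  by rewrite lte_mul_pinfty//; exact: fin_num_measure (measurable_past T).
apply: filterS (integrable_ae (measurable_rtime 0 T) ii) => s fs sT.
split; first by move=> i j; exact: delayed_measurable.
rewrite delayed_weight_integral//.
by have := fs sT; rewrite fin_numE => /andP[_]; rewrite -ltey.
Qed.

Lemma delay_bound x beta : path_measurable x -> (weighted_norm x < +oo)%E ->
  (\int[leb]_(s in rtime 0 T) (enorm (delay x beta s%:E))%:E <=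
   beta (past T) * weighted_norm x)%E.
Proof.
move=> mx fx; apply: le_trans (weight_delay_le beta mx).
apply: ae_ge0_le_integral => //.
- exact: measurable_rtime.
- by move=> s _; rewrite lee_fin enorm_ge0.
- apply/measurable_EFinP; apply: measurable_enorm => i j; exact: delay_measurable.
- by move=> s _; apply: integral_ge0 => r _; rewrite lee_fin weight_ge0.
- exact: weight_delay_measurable.
apply: filterS (delayed_mxintegrable beta mx fx) => s hs sT.
rewrite -delayed_weight_integral//.
by apply: enorm_mxRintegral; [exact: measurable_past|exact: hs].
Qed.

(** Here nu is the total variation of alpha - beta, one of the two measures
    dominating the other. *)
Definition measure_gap (alpha beta nu : {finite_measure set \bar R -> \bar R}) :=
  (forall A, measurable A -> alpha A = beta A + nu A)%E \/
  (forall A, measurable A -> beta A = alpha A + nu A)%E.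

(** Write D_alpha x - D_beta y = D_alpha (x - y) + (D_alpha y - D_beta y). The
    second term is D_nu y up to sign. *)
Lemma delay_gap (x y : \bar R -> 'M[R]_(p, q)) (alpha beta nu : {finite_measure set \bar R -> \bar R}) :
  measure_gap alpha beta nu ->
  path_measurable x -> path_measurable y ->
  (weighted_norm x < +oo)%E -> (weighted_norm y < +oo)%E ->
  (\int[leb]_(s in rtime 0 T) (enorm (delay x alpha s%:E - delay y beta s%:E))%:E <=
   alpha (past T) * weighted_norm (fun t => x t - y t)%R +
   nu (past T) * weighted_norm y)%E.
Proof.
move=> gap mx my fx fy.
have mxy := path_measurableB mx my.
apply: le_trans; last first.
  apply: leeD; [exact: (weight_delay_le alpha mxy)|exact: (weight_delay_le nu my)].
rewrite -ge0_integralD//; last 5 first.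
- exact: measurable_rtime.
- by move=> s _; apply: integral_ge0 => r _; rewrite lee_fin weight_ge0.
- exact: weight_delay_measurable.
- by move=> s _; apply: integral_ge0 => r _; rewrite lee_fin weight_ge0.
- exact: weight_delay_measurable.
apply: ae_ge0_le_integral => //.
- exact: measurable_rtime.
- by move=> s _; rewrite lee_fin enorm_ge0.
- apply/measurable_EFinP; apply: measurable_enorm.
  by apply: measurable_coordB => i j; exact: delay_measurable.
- by move=> s _; rewrite adde_ge0//; apply: integral_ge0 => r _; rewrite lee_fin weight_ge0.
- by apply: emeasurable_funD; exact: weight_delay_measurable.
have Hxa := delayed_mxintegrable alpha mx fx.
have Hya := delayed_mxintegrable alpha my fy.
have Hyb := delayed_mxintegrable beta my fy.
apply: filterS3 Hxa Hya Hyb => s hxa hya hyb sT.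
have {}hxa := hxa sT; have {}hya := hya sT; have {}hyb := hyb sT.
have mP := measurable_past T.
rewrite -delayed_weight_integral// -delayed_weight_integral//.
have deltaE r : delayed (fun t => x t - y t) (s%:E + r)%E =
   delayed x (s%:E + r)%E - delayed y (s%:E + r)%E.
  rewrite /delayed -scalerBr; congr (_ *: _).
  by rewrite /zero_ext; case: ifP => //; rewrite subr0.
under [X in (_ <= X + _)%E]eq_integral do rewrite deltaE.
set fx' := fun r => delayed x (s%:E + r)%E.
set fy' := fun r => delayed y (s%:E + r)%E.
have -> : delay x alpha s%:E - delay y beta s%:E =
    mxRintegral alpha (past T) (fun r => fx' r - fy' r) +
    (mxRintegral alpha (past T) fy' - mxRintegral beta (past T) fy').
  by rewrite mxRintegralB// addrA subrK.
apply: (@le_trans _ _ ((enorm (mxRintegral alpha (past T) (fun r => fx' r - fy' r)))%:E +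
   (enorm (mxRintegral nu (past T) fy'))%:E)%E).
  rewrite -EFinD lee_fin (le_trans (ler_enormD _ _))// lerD2l.
  case: gap => gap.
    by rewrite (mxRintegral_measure_add mP gap hya) addrAC subrr add0r.
  by rewrite (mxRintegral_measure_add mP gap hyb) opprD addrA subrr add0r enormN.
apply: leeD; apply: enorm_mxRintegral => //; first exact: mxintegrableB.
case: gap => gap.
  have le A : measurable A -> (nu A <= alpha A)%E by move=> mA; rewrite (gap A mA) leeDr.
  exact: (mxintegrable_le mP le hya).
have le A : measurable A -> (nu A <= beta A)%E by move=> mA; rewrite (gap A mA) leeDr.
exact: (mxintegrable_le mP le hyb).
Qed.

End DelayPath.

(** * The driver along delayed paths *)

(** It suffices to test measurability on the generating rectangles. *)
Lemma measurable_prod_sigma_comp (U V : Type) (D : set U) (G : set (set U))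
    (E : set V) (H : set (set V)) d (S : measurableType d) (A : set S)
    (a : S -> U) (b : S -> V) :
  measurable A -> A `<=` a @^-1` D -> A `<=` b @^-1` E ->
  (forall B, G B -> measurable (A `&` a @^-1` B)) ->
  (forall B, H B -> measurable (A `&` b @^-1` B)) ->
  forall C, prod_sigma D G E H C -> measurable (A `&` (fun s => (a s, b s)) @^-1` C).
Proof.
move=> mA aD bE ma mb.
apply: smallest_sub => [|_ [B [B' [GB HB ->]]]]; last first.
  have := measurableI _ _ (ma _ GB) (mb _ HB).
  by congr (measurable _); apply/seteqP; split => s /= [];
    [move=> [? ?] [? ?]; split|move=> ? [? ?]; split].
split => [|B mB|B mB] /=.
- by rewrite preimage_set0 setI0.
- have := measurableD mA mB; congr (measurable _).
  apply/seteqP; split => s /= [As nB].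
    by split => //; split; [split; [exact: aD|exact: bE]|move=> Bs; exact: nB].
  by split => // -[_ Bs]; case: nB.
- by rewrite preimage_bigcup setI_bigcupr; exact: bigcup_measurable.
Qed.

Section DriverComposition.
Context {R : realType} {disp : measure_display} {Omega : measurableType disp}.
Variables (P : probability Omega R) (T : \bar R).
Variable F : \bar R -> set (set Omega).
Context {d m : nat}.
Variable W : R -> Omega -> 'cV[R]_d.
Hypothesis hT : (0 < T)%E.
Hypothesis hW : brownian_basis P T F W.
Variable g : Omega -> \bar R -> 'cV[R]_m -> 'M[R]_(m, d) -> 'cV[R]_m.
Hypothesis hg : driver_measurable T F g.

(** The base map a is general so as to cover both (w, s), for the driver at
    (0, 0), and s alone at a fixed w, for the driver along delayed paths. *)
Lemma driver_measurable_comp dS (S : measurableType dS) (A : set S)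
    (a : S -> Omega * \bar R) (y : S -> 'cV[R]_m) (z : S -> 'M[R]_(m, d)) i j :
  measurable A -> measurable_fun A a -> A `<=` a @^-1` time_domain T ->
  (forall i j, measurable_fun A (fun s => y s i j)) ->
  (forall i j, measurable_fun A (fun s => z s i j)) ->
  measurable_fun A (fun s => g (a s).1 (a s).2 (y s) (z s) i j).
Proof.
move=> mA ma aT my mz _ B mB.
have := @measurable_prod_sigma_comp _ _ _ _ _ _ _ S A (fun s => (a s, y s)) z mA _ _ _
  (measurable_of_coord mA mz) _ (measurable_wrt_coord i j hg mB).
rewrite [X in _ -> _ -> _ -> measurable X](_ : _ =
  A `&` (fun s => g (a s).1 (a s).2 (y s) (z s) i j) @^-1` B); last first.
  apply/seteqP; split => s /= [As]; first by case=> _.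
  move=> Bs; split => //; split => //; split => //; split => //.
  by have := aT s As.
apply => //.
- by move=> s As; split => //; exact: aT.
apply: measurable_prod_sigma_comp => //; last exact: measurable_of_coord.
by move=> C /(predictable_sigma_measurable hT hW) mC; exact: ma.
Qed.

End DriverComposition.

Definition time_measurable {R : realType} (T : \bar R) p q (x : R -> 'M[R]_(p, q)) :=
  forall i j,
    measurable_fun (rtime 0 T : set (measurableTypeR R)) (fun s => x s i j).

Section DriverPath.
Context {R : realType}.
Variable T : \bar R.
Context {m d : nat}.
Local Notation leb := (@lebesgue_measure R).
Local Notation time := (rtime 0 T : set (measurableTypeR R)).
Variable g : R -> 'cV[R]_m -> 'M[R]_(m, d) -> 'cV[R]_m.
Variable K : R.
Hypothesis K0 : 0 < K.
Hypothesis mg : forall y z, time_measurable T y ->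
  time_measurable T z ->
  time_measurable T (fun s => g s (y s) (z s)).
Hypothesis lip : {ae leb, forall s, rtime 0 T s -> forall y y' z z',
  enorm (g s y z - g s y' z') <= K * (enorm (y - y') + enorm (z - z'))}.

Definition total_norm p q (y : R -> 'M[R]_(p, q)) : \bar R :=
  (\int[leb]_(s in rtime 0 T) (enorm (y s))%:E)%E.

Lemma total_norm_ge0 p q (y : R -> 'M[R]_(p, q)) : (0 <= total_norm y)%E.
Proof. by apply: integral_ge0 => s _; rewrite lee_fin enorm_ge0. Qed.

Lemma total_driver_gap y y' z z' :
  time_measurable T y ->
  time_measurable T z ->
  time_measurable T y' ->
  time_measurable T z' ->
  (total_norm (fun s => g s (y s) (z s) - g s (y' s) (z' s))%R <=
   K%:E * (total_norm (fun s => y s - y' s)%R + total_norm (fun s => z s - z' s)%R))%E.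
Proof.
move=> my mz my' mz'.
have mt := @measurable_rtime R 0%E T.
have mdy := measurable_coordB my my'; have mdz := measurable_coordB mz mz'.
have mey : measurable_fun time (fun s => (enorm (y s - y' s))%:E).
  by apply/measurable_EFinP; exact: measurable_enorm.
have mez : measurable_fun time (fun s => (enorm (z s - z' s))%:E).
  by apply/measurable_EFinP; exact: measurable_enorm.
rewrite /total_norm -ge0_integralD//; last 2 first.
- by move=> s _; rewrite lee_fin enorm_ge0.
- by move=> s _; rewrite lee_fin enorm_ge0.
rewrite -ge0_integralZl_EFin ?(ltW K0)//; last 2 first.
- by move=> s _; rewrite adde_ge0// lee_fin enorm_ge0.
- exact: emeasurable_funD.
apply: ae_ge0_le_integral => //.
- by move=> s _; rewrite lee_fin enorm_ge0.
- apply/measurable_EFinP; apply: measurable_enorm; apply: measurable_coordB; exact: mg.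
- by move=> s _; rewrite mule_ge0 ?adde_ge0 ?lee_fin ?enorm_ge0// ltW.
- by apply: measurable_funeM; exact: emeasurable_funD.
by apply: filterS lip => s ls sT; rewrite -EFinD -EFinM lee_fin ls.
Qed.

Hypothesis g0 : (total_norm (fun s => g s 0 0) < +oo)%E.

(** The Lipschitz bound compares g(y, z) with g(0, 0). *)
Lemma total_driver y z :
  time_measurable T y ->
  time_measurable T z ->
  (total_norm y < +oo)%E -> (total_norm z < +oo)%E ->
  mxintegrable time leb (fun s => g s (y s) (z s)).
Proof.
move=> my mz fy fz.
have m0 p q : time_measurable T (fun=> 0 : 'M[R]_(p, q)).
  by move=> i j; exact: measurable_cst.
have mt := @measurable_rtime R 0%E T.
have ig0 : mxintegrable time leb (fun s => g s 0 0).
  by split => //; apply: (mg (y := fun=> 0) (z := fun=> 0)).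
have igd : mxintegrable time leb (fun s => g s 0 0 - g s (y s) (z s)).
  split.
    by apply: measurable_coordB; [apply: (mg (y := fun=> 0) (z := fun=> 0))|apply: mg].
  apply: (le_lt_trans (total_driver_gap (m0 _ _) (m0 _ _) my mz)).
  rewrite lte_mul_pinfty ?lee_fin ?(ltW K0)// lte_add_pinfty//.
    rewrite (_ : total_norm _ = total_norm y)//.
    by apply: eq_integral => s _; rewrite sub0r enormN.
  rewrite (_ : total_norm _ = total_norm z)//.
  by apply: eq_integral => s _; rewrite sub0r enormN.
have [mm ff] := mxintegrableB mt ig0 igd.
split; first exact: mg.
by apply: le_lt_trans ff; under [leRHS]eq_integral do rewrite subKr.
Qed.

Lemma driver_tail_gap t y y' z z' : (0 <= t)%E ->
  time_measurable T y ->
  time_measurable T z ->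
  time_measurable T y' ->
  time_measurable T z' ->
  (total_norm y < +oo)%E -> (total_norm z < +oo)%E ->
  (total_norm y' < +oo)%E -> (total_norm z' < +oo)%E ->
  ((enorm (mxRintegral leb (rtime t T) (fun s => g s (y s) (z s)) -
           mxRintegral leb (rtime t T) (fun s => g s (y' s) (z' s))))%:E <=
   K%:E * (total_norm (fun s => y s - y' s)%R + total_norm (fun s => z s - z' s)%R))%E.
Proof.
move=> t0 my mz my' mz' fy fz fy' fz'.
have mt := @measurable_rtime R 0%E T; have mtt := @measurable_rtime R t T.
have tsub : rtime t T `<=` rtime 0 T.
  by move=> s /andP[ts sT]; rewrite /rtime/= sT (le_trans t0 ts).
have sub (f : R -> 'cV[R]_m) : mxintegrable time leb f ->
    mxintegrable (rtime t T : set (measurableTypeR R)) leb f.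
  move=> [mf ff]; split; first by move=> i j; exact: measurable_funS (mf i j).
  apply: le_lt_trans ff; apply: ge0_subset_integral => //.
  - by apply/measurable_EFinP; exact: measurable_enorm.
  - by move=> s _; rewrite lee_fin enorm_ge0.
have i1 := total_driver my mz fy fz; have i2 := total_driver my' mz' fy' fz'.
rewrite -(@mxRintegralB _ (measurableTypeR R) R _ _ _ mtt leb _ _ (sub _ i1) (sub _ i2)).
apply: (le_trans (@enorm_mxRintegral _ (measurableTypeR R) R _ _ _ mtt leb _
  (mxintegrableB mtt (sub _ i1) (sub _ i2)))).
apply: le_trans (total_driver_gap my mz my' mz').
apply: ge0_subset_integral => //.
- by apply/measurable_EFinP; apply: measurable_enorm; apply: measurable_coordB; exact: mg.
- by move=> s _; rewrite lee_fin enorm_ge0.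
Qed.

Variables (u v : \bar R -> R).
Hypothesis mu : measurable_fun (horizon T) u.
Hypothesis mv : measurable_fun (horizon T) v.
Variables (yn y : \bar R -> 'cV[R]_m) (zn z : \bar R -> 'M[R]_(m, d)).
Hypotheses (myn : path_measurable T yn) (my : path_measurable T y).
Hypotheses (mzn : path_measurable T zn) (mz : path_measurable T z).
Hypotheses (fyn : (weighted_norm T u yn < +oo)%E) (fy : (weighted_norm T u y < +oo)%E).
Hypotheses (fzn : (weighted_norm T v zn < +oo)%E) (fz : (weighted_norm T v z < +oo)%E).

(** The Lipschitz property reduces the gap of the drivers to the gaps of the
    two delay terms, which [delay_gap] bounds. The estimate is uniform in t. *)
Lemma driver_delay_gap t
    (alpha1 beta1 nu1 alpha2 beta2 nu2 : {finite_measure set \bar R -> \bar R}) :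
  measure_gap alpha1 beta1 nu1 -> measure_gap alpha2 beta2 nu2 -> (0 <= t)%E ->
  ((enorm (mxRintegral leb (rtime t T)
             (fun s => g s (delay T u yn alpha1 s%:E) (delay T v zn alpha2 s%:E)) -
           mxRintegral leb (rtime t T)
             (fun s => g s (delay T u y beta1 s%:E) (delay T v z beta2 s%:E))))%:E <=
   K%:E * ((alpha1 (past T) * weighted_norm T u (fun s => yn s - y s)%R +
            nu1 (past T) * weighted_norm T u y) +
           (alpha2 (past T) * weighted_norm T v (fun s => zn s - z s)%R +
            nu2 (past T) * weighted_norm T v z)))%E.
Proof.
move=> gap1 gap2 t0.
have fin p q (h : \bar R -> R) (x : \bar R -> 'M[R]_(p, q)) (b : {finite_measure set \bar R -> \bar R}) :
    measurable_fun (horizon T) h -> path_measurable T x -> (weighted_norm T h x < +oo)%E ->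
    (total_norm (fun s => delay T h x b s%:E) < +oo)%E.
  move=> mh mx fx; apply: (le_lt_trans (delay_bound mh b mx fx)).
  by rewrite lte_mul_pinfty//; exact: fin_num_measure (measurable_past T).
apply: le_trans (driver_tail_gap t0 _ _ _ _ _ _ _ _) _ => //;
  try by [move=> i j; exact: delay_measurable|exact: fin].
apply: lee_wpmul2l; first by rewrite lee_fin ltW.
by apply: leeD; exact: delay_gap.
Qed.

End DriverPath.

Section WeightedNormBounds.
Context {R : realType}.
Variable T : \bar R.
Context {p q : nat}.
Local Notation leb := (@lebesgue_measure R).
Variable h : \bar R -> R.
Hypothesis mh : measurable_fun (horizon T) h.
Variable x : \bar R -> 'M[R]_(p, q).
Hypothesis mx : path_measurable T x.

Lemma measurable_fun_real (f : \bar R -> R) :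
  measurable_fun (horizon T) f ->
  measurable_fun (rtime 0 T : set (measurableTypeR R)) (fun s => f s%:E).
Proof.
move=> mf; apply: (@measurable_comp _ _ _ _ _ _ (horizon T) f _ EFin) => //.
- exact: measurable_horizon.
- by move=> _ [s sT <-].
Qed.

Lemma weighted_norm_sup (c : R) : (L1norm T h < +oo)%E -> 0 <= c ->
  (forall t, horizon T t -> enorm (x t) <= c) ->
  (weighted_norm T h x <= (fine (L1norm T h) * c)%:E)%E.
Proof.
move=> h1 c0 xc.
have mhr := measurable_fun_real mh.
have mt := @measurable_rtime R 0%E T.
have L0 : (0 <= L1norm T h)%E by apply: integral_ge0 => s _; rewrite lee_fin.
rewrite EFinM fineK ?ge0_fin_numE// muleC -ge0_integralZl_EFin//; last first.
  by apply/measurable_EFinP; apply: measurableT_comp.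
apply: ge0_le_integral => //.
- by move=> s _; rewrite lee_fin mulr_ge0 ?enorm_ge0.
- apply/measurable_EFinP; apply: measurable_funM; first exact: measurableT_comp.
  by apply: measurable_enorm => i j; exact: measurable_fun_real (mx i j).
- by apply: measurable_funeM; apply/measurable_EFinP; apply: measurableT_comp.
- by move=> s sT; rewrite -EFinM lee_fin mulrC ler_wpM2r ?xc.
Qed.

Lemma weighted_norm_cauchy_schwarz : (L2norm T h < +oo)%E ->
  (\int[leb]_(s in rtime 0 T) (enorm (x s%:E) ^+ 2)%:E < +oo)%E ->
  (weighted_norm T h x <= (fine (L2norm T h) *
    Num.sqrt (fine (\int[leb]_(s in rtime 0 T) (enorm (x s%:E) ^+ 2)%:E)))%:E)%E.
Proof.
move=> h2 x2.
have mhr := measurable_fun_real mh.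
have mt := @measurable_rtime R 0%E T.
have mxr i j := measurable_fun_real (mx i j).
pose f : measurableTypeR R -> R := (fun s => `|h s%:E|) \_ (rtime 0 T).
pose k : measurableTypeR R -> R := (fun s => enorm (x s%:E)) \_ (rtime 0 T).
have mf : measurable_fun setT f.
  by apply/(measurable_restrictT _ mt); apply: measurableT_comp.
have mk : measurable_fun setT k.
  by apply/(measurable_restrictT _ mt); apply: measurable_enorm => i j; exact: mxr.
have restr (a b : R -> R) : (\int[leb]_s (((a \_ (rtime 0 T)) s * (b \_ (rtime 0 T)) s)%:E) =
    \int[leb]_(s in rtime 0 T) (a s * b s)%:E)%E.
  rewrite [RHS]integral_mkcond; apply: eq_integral => s _.
  by rewrite !patchE; case: ifP => // _; rewrite mul0r.
have fE : (\int[leb]_s (f s ^+ 2)%:E = \int[leb]_(s in rtime 0 T) ((h s%:E) ^+ 2)%:E)%E.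
  under eq_integral do rewrite expr2.
  rewrite restr; apply: eq_integral => s _.
  by rewrite -expr2 real_normK ?num_real.
have kE : (\int[leb]_s (k s ^+ 2)%:E = \int[leb]_(s in rtime 0 T) (enorm (x s%:E) ^+ 2)%:E)%E.
  by under eq_integral do rewrite expr2; rewrite restr; under eq_integral do rewrite -expr2.
have H2 : (0 <= \int[leb]_(s in rtime 0 T) ((h s%:E) ^+ 2)%:E)%E.
  by apply: integral_ge0 => s _; rewrite lee_fin sqr_ge0.
have sf : sqint leb f by split => //; rewrite fE; exact: poweR_half_lty.
have sk : sqint leb k by split => //; rewrite kE.
have -> : (weighted_norm T h x = \int[leb]_s (f s * k s)%:E)%E by rewrite restr.
have ifk := sqint_mul sf sk.
rewrite -(fineK (integrable_fin_num measurableT ifk)) lee_fin.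
have -> : fine (L2norm T h) = Num.sqrt (\int[leb]_s (f s ^+ 2)).
  rewrite /Rintegral fE /L2norm -[in LHS](@fineK _ (\int[leb]_(s in _) _)%E); last first.
    by rewrite ge0_fin_numE//; exact: poweR_half_lty.
  by rewrite poweR_EFin powR12_sqrt// fine_ge0.
rewrite -sqrtrM; last by apply: Rintegral_ge0 => s _; exact: sqr_ge0.
rewrite -kE -/(Rintegral leb setT (fun s => k s ^+ 2)).
have := sqint_cauchy_schwarz sf sk.
rewrite -(@ler_sqrt _ (_ ^+ 2)); last first.
  by rewrite mulr_ge0//; apply: Rintegral_ge0 => s _; exact: sqr_ge0.
by rewrite sqrtr_sqr; apply: le_trans; exact: ler_norm.
Qed.

End WeightedNormBounds.

(** * Second moments of suprema and energies *)

Section ExtendedSquares.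
Context {R : realType}.
Implicit Types x y : \bar R.

Lemma expe2_fine x : (0 <= x)%E -> (x < +oo)%E -> (x ^+ 2 = (fine x ^+ 2)%:E)%E.
Proof. by case: x => // r _ _; rewrite -EFin_expe. Qed.

Lemma expe2_lty x : (0 <= x)%E -> (x ^+ 2 < +oo)%E -> (x < +oo)%E.
Proof. by case: x => [r _ _|_|//]; rewrite ?ltry// expe2 mulyy. Qed.

End ExtendedSquares.

Section ProcessNorms.
Context {R : realType} {disp : measure_display} {Omega : measurableType disp}.
Variables (P : probability Omega R) (T : \bar R).
Hypothesis hT : (0 < T)%E.
Hypothesis cP : measure_is_complete P.

Lemma integral_ae_lty (f : Omega -> \bar R) : measurable_fun setT f ->
  (forall w, 0 <= f w)%E -> (\int[P]_w f w < +oo)%E -> {ae P, forall w, (f w < +oo)%E}.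
Proof.
move=> mf f0 fi.
have ii : P.-integrable setT f.
  by apply/integrableP; split => //; under eq_integral do rewrite gee0_abs//.
apply: filterS (integrable_ae measurableT ii) => w /(_ Logic.I).
by rewrite fin_numE => /andP[_]; rewrite -ltey.
Qed.

Section Supremum.
Context {p q : nat}.
Variable X : \bar R -> Omega -> 'M[R]_(p, q).
Hypothesis mX : forall t i j, (0 <= t <= T)%E -> measurable_fun setT (fun w => X t w i j).
Hypothesis cX : continuous_paths P T X.
Hypothesis fX : (\int[P]_w (path_sup T X w ^+ 2) < +oo)%E.

Let mS : measurable_fun setT (path_sup T X).
Proof. exact: (path_sup_measurable hT cP). Qed.

Let mS2 : measurable_fun setT (fun w => path_sup T X w ^+ 2)%E.
Proof. by under eq_fun do rewrite expe2; exact: emeasurable_funM. Qed.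

Lemma path_sup_ae : {ae P, forall w, (path_sup T X w < +oo)%E}.
Proof.
apply: filterS (integral_ae_lty mS2 _ fX) => [w|w].
  by move=> Hw; apply: expe2_lty => //; exact: path_sup_ge0.
by rewrite expe_ge0// path_sup_ge0.
Qed.

Lemma path_sup_fine : (\int[P]_w (path_sup T X w ^+ 2) =
  \int[P]_w ((fine (path_sup T X w)) ^+ 2)%:E)%E.
Proof.
apply: ae_eq_integral => //.
  by apply: measurable_sqr; exact: (measurableT_comp (fine_measurable measurableT)).
by apply: filterS path_sup_ae => w Hw _; rewrite -expe2_fine// path_sup_ge0.
Qed.

Lemma path_sup_sqint : sqint P (fun w => fine (path_sup T X w)).
Proof.
split; first exact: (measurableT_comp (fine_measurable measurableT)).
by rewrite -path_sup_fine.
Qed.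

Lemma path_sup_Rintegral : (\int[P]_w (path_sup T X w ^+ 2) =
  (\int[P]_w (fine (path_sup T X w) ^+ 2))%:E)%E.
Proof.
by rewrite path_sup_fine integral_EFin_Rintegral//; exact: sqint_sqr path_sup_sqint.
Qed.

Lemma enorm_le_path_sup w t : (path_sup T X w < +oo)%E -> (0 <= t <= T)%E ->
  enorm (X t w) <= fine (path_sup T X w).
Proof.
move=> Sw tT; rewrite -lee_fin fineK; first exact: path_sup_ge.
by rewrite ge0_fin_numE// path_sup_ge0.
Qed.

Lemma process_coord_sqint t i j : (0 <= t <= T)%E -> sqint P (fun w => X t w i j).
Proof.
move=> tT; apply: (ae_sqint_le (mX i j tT) path_sup_sqint).
apply: filterS path_sup_ae => w Sw.
rewrite [leRHS]ger0_norm ?fine_ge0 ?path_sup_ge0//.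
exact: le_trans (ler_coord_enorm _ _ _) (enorm_le_path_sup Sw tT).
Qed.

End Supremum.

Lemma continuous_pathsB p q (X Y : \bar R -> Omega -> 'M[R]_(p, q)) :
  continuous_paths P T X -> continuous_paths P T Y ->
  continuous_paths P T (fun t w => X t w - Y t w).
Proof.
move=> cX cY; apply: filterS2 cX cY => w cX cY t.
by apply: cvgB; [exact: cX|exact: cY].
Qed.

Lemma path_sup_diff_lty p q (X Y : \bar R -> Omega -> 'M[R]_(p, q)) :
  (forall t i j, (0 <= t <= T)%E -> measurable_fun setT (fun w => X t w i j)) ->
  (forall t i j, (0 <= t <= T)%E -> measurable_fun setT (fun w => Y t w i j)) ->
  continuous_paths P T X -> continuous_paths P T Y ->
  (\int[P]_w (path_sup T X w ^+ 2) < +oo)%E ->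
  (\int[P]_w (path_sup T Y w ^+ 2) < +oo)%E ->
  (\int[P]_w (path_sup T (fun t w => X t w - Y t w)%R w ^+ 2) < +oo)%E.
Proof.
move=> mX mY cX cY fX fY.
have [ms2 s2] := sqintD (path_sup_sqint mX cX fX) (path_sup_sqint mY cY fY).
have mD : measurable_fun setT (path_sup T (fun t w => X t w - Y t w)).
  apply: (path_sup_measurable hT cP); last exact: continuous_pathsB.
  by move=> t i j tT; under eq_fun do rewrite !mxE; apply: measurable_funB;
     [exact: mX|exact: mY].
apply: le_lt_trans s2; apply: ae_ge0_le_integral => //.
- by move=> w _; rewrite expe_ge0// path_sup_ge0.
- by under eq_fun do rewrite expe2; exact: emeasurable_funM.
- by move=> w _; rewrite lee_fin sqr_ge0.
- exact: measurable_sqr.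
apply: filterS2 (path_sup_ae mX cX fX) (path_sup_ae mY cY fY) => w Xw Yw _.
set s := fine _ + fine _.
have s0 : 0 <= s by rewrite addr_ge0// fine_ge0// path_sup_ge0.
have le_s : (path_sup T (fun t w => X t w - Y t w)%R w <= s%:E)%E.
  apply: ge_ereal_sup => _ [t tT <-]; rewrite lee_fin.
  by rewrite (le_trans (ler_enormB _ _))// lerD// enorm_le_path_sup.
have S0 := path_sup_ge0 hT (fun t w => X t w - Y t w) w.
have Slt := le_lt_trans le_s (ltry s).
rewrite expe2_fine// lee_fin ler_sqr ?nnegrE ?fine_ge0//.
by rewrite -lee_fin fineK// ge0_fin_numE.
Qed.

(** The squared L2(dt) norm of a path, whose mean is [sqH2]. *)
Definition energy p q (Z : \bar R -> Omega -> 'M[R]_(p, q)) (w : Omega) : \bar R :=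
  (\int[lebesgue_measure]_(s in rtime 0 T) (enorm (Z s%:E w) ^+ 2)%:E)%E.

Section Energy.
Context {p q : nat}.
Variable Z : \bar R -> Omega -> 'M[R]_(p, q).
Hypothesis mZ : jointly_measurable T Z.
Hypothesis fZ : (sqH2 P T Z < +oo)%E.

Lemma energy_ge0 w : (0 <= energy Z w)%E.
Proof. by apply: integral_ge0 => s _; rewrite lee_fin sqr_ge0. Qed.

Lemma energy_measurable : measurable_fun setT (energy Z).
Proof.
apply: (iterated_integral_measurable
  (f := fun x : Omega * measurableTypeR R => (enorm (Z x.2%:E x.1) ^+ 2)%:E)).
  by apply/measurable_EFinP; exact: measurable_sum_sqr.
by move=> x; rewrite lee_fin sqr_ge0.
Qed.

Lemma energy_ae : {ae P, forall w, (energy Z w < +oo)%E}.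
Proof. exact: (integral_ae_lty energy_measurable energy_ge0). Qed.

Lemma energy_fine :
  (sqH2 P T Z = \int[P]_w (Num.sqrt (fine (energy Z w)) ^+ 2)%:E)%E.
Proof.
apply: ae_eq_integral => //.
- exact: energy_measurable.
- apply: measurable_sqr; apply: measurableT_comp.
    by apply: continuous_measurable_fun; exact: sqrt_continuous.
  by apply: (measurableT_comp (fine_measurable measurableT)); exact: energy_measurable.
- apply: filterS energy_ae => w Ew _; rewrite sqr_sqrtr ?fine_ge0 ?energy_ge0//.
  by rewrite fineK// ge0_fin_numE// energy_ge0.
Qed.

Lemma energy_sqint : sqint P (fun w => Num.sqrt (fine (energy Z w))).
Proof.
split; last by rewrite -energy_fine.
apply: measurableT_comp.
  by apply: continuous_measurable_fun; exact: sqrt_continuous.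
by apply: (measurableT_comp (fine_measurable measurableT)); exact: energy_measurable.
Qed.

Lemma energy_Rintegral :
  (sqH2 P T Z = (\int[P]_w (Num.sqrt (fine (energy Z w)) ^+ 2))%:E)%E.
Proof. by rewrite energy_fine integral_EFin_Rintegral//; exact: sqint_sqr energy_sqint. Qed.

End Energy.

Lemma sqH2_diff_lty p q (Z Z' : \bar R -> Omega -> 'M[R]_(p, q)) :
  jointly_measurable T Z -> jointly_measurable T Z' ->
  (sqH2 P T Z < +oo)%E -> (sqH2 P T Z' < +oo)%E ->
  (sqH2 P T (fun t w => Z t w - Z' t w)%R < +oo)%E.
Proof.
move=> mZ mZ' fZ fZ'.
apply: le_lt_trans (@sqH2_lin2 _ _ _ P T _ _ _ Z Z' 2 2 _ mZ mZ' _ _ _) _ => //.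
- exact: jointly_measurableB.
- by move=> t w; have := sqr_enormD (Z t w) (- Z' t w); rewrite enormN.
- move: (sqH2 P T Z) (sqH2 P T Z') fZ fZ' => a b fa fb.
  by apply: lte_add_pinfty; apply: lte_mul_pinfty.
Qed.

(** The measure of a product set is the integral of the measures of its
    sections, so almost all sections of a null set are null. *)
Lemma ae_product_section (Q : Omega -> R -> Prop) :
  {ae (P \x lebesgue_measure)%E, forall x : Omega * R, Q x.1 x.2} ->
  {ae P, forall w, {ae lebesgue_measure, forall s, Q w s}}.
Proof.
move=> [N [mN N0 QN]].
pose f (w : Omega) := (@lebesgue_measure R) (xsection N w).
have mf : measurable_fun setT f.
  exact: (@measurable_fun_xsection _ _ _ (measurableTypeR R) R lebesgue_measure N).
have f0 : (\int[P]_w `|f w| = 0)%E.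
  rewrite -[RHS]N0; by apply: eq_integral => w _; rewrite gee0_abs.
have [/(_ f0) H _] := ae_eq_integral_abs P measurableT mf.
apply: filterS H => w /(_ Logic.I) fw0.
exists (xsection N w); split => //; first exact: measurable_xsection.
by move=> s Qs; rewrite /xsection/= inE; exact: (QN (w, s)).
Qed.

End ProcessNorms.

(** * The stability estimate *)

Section Numerics.
Context {R : realType}.

Lemma small_coef (K : R) (a L : \bar R) : 0 < K -> (0 <= a)%E -> (0 <= L)%E ->
  a \is a fin_num -> L \is a fin_num ->
  ((K ^+ 2)%:E * a ^+ 2 * L ^+ 2 <= (25^-1)%:E)%E ->
  0 <= K * fine a * fine L <= 5^-1.
Proof.
move=> K0 + + fa fL; rewrite -(fineK fa) -(fineK fL) /=.
move: (fine a) (fine L) => {fa fL}a {}L; rewrite !lee_fin => a0 L0.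
move=> H; have {}H : (K * a * L) ^+ 2 <= 25^-1 by rewrite !exprMn (expr2 a) (expr2 L).
have c0 : 0 <= K * a * L by rewrite !mulr_ge0// ltW.
rewrite c0/= -ler_sqr ?nnegrE ?invr_ge0//; apply: (le_trans H).
by rewrite exprVn (_ : (5 : R) ^+ 2 = 25)//; ring.
Qed.

(** Since c1 and c2 are at most 1/5, the hypotheses give
    A + B <= 5 I <= 4/5 (A + B) + 20 E. *)
Lemma contraction_bound (A B I E c1 c2 : R) : 0 <= A -> 0 <= B ->
  0 <= c1 <= 5^-1 -> 0 <= c2 <= 5^-1 ->
  A <= 4 * I -> B <= I -> I <= 4 * (c1 ^+ 2 * A + c2 ^+ 2 * B + E) ->
  A + B <= 100 * E.
Proof.
move=> A0 B0 /andP[c10 c11] /andP[c20 c21] AI BI IE.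
have sq (c : R) : 0 <= c -> c <= 5^-1 -> c ^+ 2 <= 25^-1.
  move=> c0 c5; have : c ^+ 2 <= 5^-1 ^+ 2 by rewrite ler_sqr ?nnegrE ?invr_ge0.
  by rewrite exprVn (_ : (5 : R) ^+ 2 = 25)//; ring.
have h1 : c1 ^+ 2 * A <= 25^-1 * A by rewrite ler_wpM2r// sq.
have h2 : c2 ^+ 2 * B <= 25^-1 * B by rewrite ler_wpM2r// sq.
lra.
Qed.

End Numerics.

Section FourSquares.
Context d (X : measurableType d) (R : realType) (mu : {measure set X -> \bar R}).

Lemma Rintegral_sqr_four (a b c e : R) (f g h k : X -> R) :
  sqint mu f -> sqint mu g -> sqint mu h -> sqint mu k ->
  \int[mu]_x ((a * f x + b * g x + (c * h x + e * k x)) ^+ 2) <=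
  4 * (a ^+ 2 * (\int[mu]_x (f x ^+ 2)) + c ^+ 2 * (\int[mu]_x (h x ^+ 2)) +
       (b ^+ 2 * (\int[mu]_x (g x ^+ 2)) + e ^+ 2 * (\int[mu]_x (k x ^+ 2)))).
Proof.
move=> f2 g2 h2 k2.
have scal (r : R) (x : X -> R) : sqint mu x ->
    mu.-integrable setT (EFin \o (fun t => r ^+ 2 * x t ^+ 2)).
  by move=> x2; exact: (integrableZl measurableT (r ^+ 2) (sqint_sqr x2)).
have i1 := scal a _ f2; have i2 := scal b _ g2.
have i3 := scal c _ h2; have i4 := scal e _ k2.
have i13 := integrableD measurableT i1 i3.
have i24 := integrableD measurableT i2 i4.
have iall := integrableD measurableT i13 i24.
rewrite -!RintegralZl//; try exact: sqint_sqr.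
rewrite -RintegralD// -[X in _ <= 4 * (_ + X)]RintegralD// -RintegralD//.
rewrite -RintegralZl//; apply: le_Rintegral => //.
- by apply: sqint_sqr; apply: sqintD; apply: sqintD; exact: sqintZ.
- exact: (integrableZl measurableT 4 iall).
move=> x _.
have := sqr_ge0 (a * f x - b * g x); have := sqr_ge0 (a * f x - c * h x).
have := sqr_ge0 (a * f x - e * k x); have := sqr_ge0 (b * g x - c * h x).
have := sqr_ge0 (b * g x - e * k x); have := sqr_ge0 (c * h x - e * k x).
rewrite -!exprMn.
by move: (a * f x) (b * g x) (c * h x) (e * k x) => *; nra.
Qed.

End FourSquares.

Section Stability.
Context {R : realType}.
Variables (T : \bar R) (hT : (0 < T)%E).
Context {m d : nat} {disp : measure_display} {Omega : measurableType disp}.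
Variables (P : probability Omega R) (F : \bar R -> set (set Omega)).
Variables (W : R -> Omega -> 'cV[R]_d) (hW : brownian_basis P T F W).
Variables (u v : \bar R -> R).
Hypothesis hu : measurable_fun [set t | (0 <= t <= T)%E] u.
Hypothesis hv : measurable_fun [set t | (0 <= t <= T)%E] v.
Hypotheses (hu1 : (L1norm T u < +oo)%E) (hv2 : (L2norm T v < +oo)%E).
Variable g : Omega -> \bar R -> 'cV[R]_m -> 'M[R]_(m, d) -> 'cV[R]_m.
Hypothesis hg : driver_measurable T F g.
Hypothesis hg0 : (\int[P]_w (\int[lebesgue_measure]_(s in rtime 0 T)
            (enorm (g w s%:E 0 0))%:E) ^+ 2 < +oo)%E.
Variable K : R.
Hypotheses (hK : 0 < K) (hlip : driver_lipschitz P T K g).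
Variable xi : Omega -> 'cV[R]_m.

Lemma driver_zero_ae :
  {ae P, forall w, (total_norm T (fun s => g w s%:E 0 0) < +oo)%E}.
Proof.
pose G w := total_norm T (fun s => g w s%:E 0 0).
have mG : measurable_fun setT G.
  apply: (iterated_integral_measurable
    (f := fun x : Omega * measurableTypeR R => (enorm (g x.1 x.2%:E 0 0))%:E)).
    apply/measurable_EFinP; apply: measurable_enorm => i j.
    apply: (driver_measurable_comp hT hW hg
      (a := fun x : Omega * measurableTypeR R => (x.1, x.2%:E))
      (y := fun=> 0) (z := fun=> 0)).
    - exact: measurable_realtime_domain.
    - apply: measurable_funTS; apply: measurable_fun_pair => //=.
      by apply: (measurableT_comp (@EFin_measurable R setT)); exact: measurable_snd.
    - by move=> [w s] [_ sT]; split.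
    - by move=> k l; exact: measurable_cst.
    - by move=> k l; exact: measurable_cst.
  by move=> x; rewrite lee_fin enorm_ge0.
have G0 w : (0 <= G w)%E by exact: total_norm_ge0.
apply: filterS (@integral_ae_lty _ _ _ P (fun w => G w ^+ 2)%E _ _ _) => //.
- by move=> w; exact: expe2_lty.
- by under eq_fun do rewrite expe2; exact: emeasurable_funM.
- by move=> w; rewrite expe_ge0.
Qed.

Lemma driver_path_measurable w (y : R -> 'cV[R]_m) (z : R -> 'M[R]_(m, d)) :
  time_measurable T y -> time_measurable T z ->
  time_measurable T (fun s => g w s%:E (y s) (z s)).
Proof.
move=> my mz i j.
apply: (driver_measurable_comp hT hW hg
  (a := fun s : measurableTypeR R => (w, s%:E))) => //.
- exact: measurable_rtime.
- by apply: measurable_funTS; apply: measurable_fun_pair => //.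
Qed.

Variables (alpha1 alpha2 beta1 beta2 nu1 nu2 : {finite_measure set \bar R -> \bar R}).
Hypotheses (gap1 : measure_gap alpha1 beta1 nu1) (gap2 : measure_gap alpha2 beta2 nu2).
Hypothesis small1 :
  ((K ^+ 2)%:E * alpha1 (past T) ^+ 2 * L1norm T u ^+ 2 <= (25^-1)%:E)%E.
Hypothesis small2 :
  ((K ^+ 2)%:E * alpha2 (past T) ^+ 2 * L2norm T v ^+ 2 <= (25^-1)%:E)%E.
Variables (Yn Y : \bar R -> Omega -> 'cV[R]_m) (Zn Z : \bar R -> Omega -> 'M[R]_(m, d)).
Hypothesis hYZn : delay_bsde_solution P T F W u v g xi alpha1 alpha2 Yn Zn.
Hypothesis hYZ : delay_bsde_solution P T F W u v g xi beta1 beta2 Y Z.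

Definition mass (b : {finite_measure set \bar R -> \bar R}) : R := fine (b (past T)).

Lemma massE (b : {finite_measure set \bar R -> \bar R}) : b (past T) = (mass b)%:E.
Proof. by rewrite fineK//; exact: fin_num_measure (measurable_past T). Qed.

Lemma mass_ge0 b : 0 <= mass b.
Proof. exact: fine_ge0. Qed.

Let U := fine (L1norm T u).
Let V := fine (L2norm T v).
Let dY t w := Yn t w - Y t w.
Let dZ t w := Zn t w - Z t w.
Let c1 := K * mass alpha1 * U.
Let c2 := K * mass alpha2 * V.
Let e1 := K * mass nu1 * U.
Let e2 := K * mass nu2 * V.
Let sup p q (X : \bar R -> Omega -> 'M[R]_(p, q)) w := fine (path_sup T X w).
Let rms p q (X : \bar R -> Omega -> 'M[R]_(p, q)) w := Num.sqrt (fine (energy T X w)).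

(** The random variable that dominates the difference of the generators. The
    coefficients c1 and c2 are small; e1 and e2 vanish with the masses of nu1
    and nu2, and multiply norms of the fixed solution (Y, Z). *)
Let B w := c1 * sup dY w + e1 * sup Y w + (c2 * rms dZ w + e2 * rms Z w).

Let pYn : predictable T F Yn. Proof. by have [[]] := hYZn. Qed.
Let pY : predictable T F Y. Proof. by have [[]] := hYZ. Qed.
Let cYn : continuous_paths P T Yn. Proof. by have [[]] := hYZn. Qed.
Let cY : continuous_paths P T Y. Proof. by have [[]] := hYZ. Qed.
Let pZn : predictable T F Zn. Proof. by have [_ []] := hYZn. Qed.
Let pZ : predictable T F Z. Proof. by have [_ []] := hYZ. Qed.
Let jZn := predictable_jointly hT hW pZn.
Let jZ := predictable_jointly hT hW pZ.

Lemma S2norm_lty p q (X : \bar R -> Omega -> 'M[R]_(p, q)) : (S2norm P T X < +oo)%E ->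
  (\int[P]_w (path_sup T X w ^+ 2) < +oo)%E.
Proof.
move=> H; apply: poweR_half_lty => //.
by apply: integral_ge0 => w _; rewrite expe_ge0// path_sup_ge0.
Qed.

Lemma H2norm_lty p q (X : \bar R -> Omega -> 'M[R]_(p, q)) : (H2norm P T X < +oo)%E ->
  (sqH2 P T X < +oo)%E.
Proof. by move=> H; apply: poweR_half_lty => //; exact: sqH2_ge0. Qed.

Let fYn : (\int[P]_w (path_sup T Yn w ^+ 2) < +oo)%E.
Proof. by apply: S2norm_lty; have [[]] := hYZn. Qed.
Let fY : (\int[P]_w (path_sup T Y w ^+ 2) < +oo)%E.
Proof. by apply: S2norm_lty; have [[]] := hYZ. Qed.
Let fZn : (sqH2 P T Zn < +oo)%E.
Proof. by apply: H2norm_lty; have [_ []] := hYZn. Qed.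
Let fZ : (sqH2 P T Z < +oo)%E.
Proof. by apply: H2norm_lty; have [_ []] := hYZ. Qed.

Let cP : measure_is_complete P := bb_complete hW.

Let mpred p q (X : \bar R -> Omega -> 'M[R]_(p, q)) : predictable T F X ->
  forall t i j, (0 <= t <= T)%E -> measurable_fun setT (fun w => X t w i j).
Proof.
by move=> pX t i j tT; apply: (adapted_measurable hW tT); exact: (predictable_adapted hW).
Qed.

Let mdY t i j : (0 <= t <= T)%E -> measurable_fun setT (fun w => dY t w i j).
Proof.
by move=> tT; under eq_fun do rewrite !mxE; apply: measurable_funB; exact: mpred.
Qed.
Let cdY : continuous_paths P T dY. Proof. exact: continuous_pathsB. Qed.
Let fdY : (\int[P]_w (path_sup T dY w ^+ 2) < +oo)%E.
Proof. by apply: path_sup_diff_lty => //; exact: mpred. Qed.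
Let jdZ : jointly_measurable T dZ. Proof. exact: jointly_measurableB. Qed.
Let fdZ : (sqH2 P T dZ < +oo)%E. Proof. exact: sqH2_diff_lty. Qed.

Let gen (Y' : \bar R -> Omega -> 'cV[R]_m) (Z' : \bar R -> Omega -> 'M[R]_(m, d))
    (b1 b2 : {finite_measure set \bar R -> \bar R}) t w :=
  mxRintegral lebesgue_measure (rtime t T)
    (fun s => g w s%:E (delay_term T u Y' b1 s%:E w) (delay_term T v Z' b2 s%:E w)).

(** For almost every w, [driver_delay_gap] applies to the paths at w; the
    weighted norms are bounded by a supremum for the integrable weight u, and
    by Cauchy-Schwarz for the square-integrable weight v. One null set serves
    all t. *)
Lemma generator_gap : {ae P, forall w, forall t, (0 <= t)%E ->
  enorm (gen Yn Zn alpha1 alpha2 t w - gen Y Z beta1 beta2 t w) <= B w}.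
Proof.
have H1 : {ae P, forall w, [/\ (path_sup T Yn w < +oo)%E, (path_sup T Y w < +oo)%E &
    (path_sup T dY w < +oo)%E]}.
  apply: filterS3 (path_sup_ae hT cP (mpred pYn) cYn fYn)
    (path_sup_ae hT cP (mpred pY) cY fY) (path_sup_ae hT cP mdY cdY fdY) => w ? ? ?.
  by split.
have H2 : {ae P, forall w, [/\ (energy T Zn w < +oo)%E, (energy T Z w < +oo)%E &
    (energy T dZ w < +oo)%E]}.
  apply: filterS3 (energy_ae jZn fZn) (energy_ae jZ fZ) (energy_ae jdZ fdZ) => w ? ? ?.
  by split.
have H3 : {ae P, forall w, (total_norm T (fun s => g w s%:E 0 0) < +oo)%E /\
   {ae lebesgue_measure, forall s, rtime 0 T s -> forall y y' z z',
      enorm (g w s%:E y z - g w s%:E y' z') <= K * (enorm (y - y') + enorm (z - z'))}}.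
  have L := @ae_product_section _ _ _ P (fun w s => rtime 0 T s -> forall y y' z z',
      enorm (g w s%:E y z - g w s%:E y' z') <=
      K * (enorm (y - y') + enorm (z - z'))) hlip.
  by apply: filterS2 driver_zero_ae L => w ? ?; split.
apply: filterS3 H1 H2 H3 => w [sYn sY sdY] [eZn eZ edZ] [g0 lip] t t0.
have pm p q (X : \bar R -> Omega -> 'M[R]_(p, q)) : predictable T F X ->
    path_measurable T (X ^~ w).
  by move=> pX i j; exact: (predictable_path hT hW).
have wsup (X : \bar R -> Omega -> 'cV[R]_m) : path_measurable T (X ^~ w) ->
    (path_sup T X w < +oo)%E -> (weighted_norm T u (X ^~ w) <= (U * sup X w)%:E)%E.
  move=> mX sX; apply: weighted_norm_sup => //.
    by rewrite fine_ge0// path_sup_ge0.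
  by move=> s sT; exact: enorm_le_path_sup.
have wene (X : \bar R -> Omega -> 'M[R]_(m, d)) : path_measurable T (X ^~ w) ->
    (energy T X w < +oo)%E -> (weighted_norm T v (X ^~ w) <= (V * rms X w)%:E)%E.
  by move=> mX eX; exact: weighted_norm_cauchy_schwarz.
have mdYw : path_measurable T (dY ^~ w) by apply: path_measurableB; exact: pm.
have mdZw : path_measurable T (dZ ^~ w) by apply: path_measurableB; exact: pm.
have H := @driver_delay_gap R T m d (fun s => g w s%:E) K hK (driver_path_measurable w)
  lip g0 u v hu hv (Yn ^~ w) (Y ^~ w) (Zn ^~ w) (Z ^~ w) (pm _ _ _ pYn) (pm _ _ _ pY)
  (pm _ _ _ pZn) (pm _ _ _ pZ)
  (le_lt_trans (wsup _ (pm _ _ _ pYn) sYn) (ltry _))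
  (le_lt_trans (wsup _ (pm _ _ _ pY) sY) (ltry _))
  (le_lt_trans (wene _ (pm _ _ _ pZn) eZn) (ltry _))
  (le_lt_trans (wene _ (pm _ _ _ pZ) eZ) (ltry _))
  t alpha1 beta1 nu1 alpha2 beta2 nu2 gap1 gap2 t0.
rewrite -lee_fin; apply: (le_trans H).
rewrite !massE.
have bnd (b : {finite_measure set \bar R -> \bar R}) (x : \bar R) (y : R) :
    (x <= y%:E)%E -> ((mass b)%:E * x <= (mass b * y)%:E)%E.
  by move=> xy; rewrite EFinM; apply: lee_wpmul2l => //; rewrite lee_fin mass_ge0.
apply: (@le_trans _ _ (K%:E * ((mass alpha1 * (U * sup dY w))%:E +
    (mass nu1 * (U * sup Y w))%:E + ((mass alpha2 * (V * rms dZ w))%:E +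
    (mass nu2 * (V * rms Z w))%:E)))%E).
  apply: lee_wpmul2l; first by rewrite lee_fin ltW.
  apply: leeD; apply: leeD; apply: bnd.
  - exact: (wsup dY).
  - by apply: wsup => //; exact: pm.
  - exact: (wene dZ).
  - by apply: wene => //; exact: pm.
by rewrite -!EFinD -EFinM lee_fin /B /c1 /c2 /e1 /e2 le_eqVlt; apply/orP; left; apply/eqP; ring.
Qed.

Let B2 : sqint P B.
Proof.
apply: sqintD; apply: sqintD; apply: sqintZ.
- exact: (path_sup_sqint hT cP mdY cdY fdY).
- exact: (path_sup_sqint hT cP (mpred pY) cY fY).
- exact: energy_sqint.
- exact: energy_sqint.
Qed.

(** Subtracting the equations, dY_t plus the difference dI_t of the stochastic
    integrals over [t, T] has norm at most B. As dI_t is orthogonal to the past,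
    Doob's inequality bounds the supremum of dY, and the isometry at time 0
    bounds dZ, by the second moment of B. This moment contains small multiples
    of the same two quantities, which are absorbed. *)
Lemma stability_estimate :
  (\int[P]_w (path_sup T dY w ^+ 2) <=
    (100 * (e1 ^+ 2 * (\int[P]_w (sup Y w ^+ 2)) +
            e2 ^+ 2 * (\int[P]_w (rms Z w ^+ 2))))%:E)%E /\
  (sqH2 P T dZ <=
    (100 * (e1 ^+ 2 * (\int[P]_w (sup Y w ^+ 2)) +
            e2 ^+ 2 * (\int[P]_w (rms Z w ^+ 2))))%:E)%E.
Proof.
have exI Y' Z' b1 b2 : delay_bsde_solution P T F W u v g xi b1 b2 Y' Z' ->
    exists I : \bar R -> Omega -> 'cV[R]_m, forall t, (0 <= t <= T)%E ->
      is_ito_integral P T F W t T Z' (I t) /\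
      {ae P, forall w, Y' t w = xi w + gen Y' Z' b1 b2 t w - I t w}.
  move=> [_ _ sol].
  have /choice[I HI] : forall t, exists It : Omega -> 'cV[R]_m, (0 <= t <= T)%E ->
      is_ito_integral P T F W t T Z' It /\
      {ae P, forall w, Y' t w = xi w + gen Y' Z' b1 b2 t w - It w}.
    move=> t; have [tT|tT] := boolP (0 <= t <= T)%E; last by exists (fun=> 0).
    by have [It h1 h2] := sol t tT; exists It.
  by exists I.
have [In HIn] := exI _ _ _ _ hYZn; have [J HJ] := exI _ _ _ _ hYZ.
pose dI t w := In t w - J t w.
have adY t : (0 <= t <= T)%E -> forall i, adapted F t (fun w => dY t w i ord0).
  move=> tT i.
  rewrite (_ : (fun w => _) = (fun w => Yn t w i ord0 - Y t w i ord0)).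
    by apply: (adaptedB hW tT); exact: (predictable_adapted hW).
  by apply/funext => w; rewrite !mxE.
have y2 t : (0 <= t <= T)%E -> forall i, sqint P (fun w => dY t w i ord0).
  by move=> tT i; exact: (process_coord_sqint hT cP mdY cdY fdY).
have dIE t i : (fun w => dI t w i ord0) = (fun w => In t w i ord0 - J t w i ord0).
  by apply/funext => w; rewrite !mxE.
have In2 t i : (0 <= t <= T)%E -> sqint P (fun w => In t w i ord0).
  by move=> tT; have [h _] := HIn t tT; exact: (ito_integral_sqint hW tT h).
have J2 t i : (0 <= t <= T)%E -> sqint P (fun w => J t w i ord0).
  by move=> tT; have [h _] := HJ t tT; exact: (ito_integral_sqint hW tT h).
have dI2 t : (0 <= t <= T)%E -> forall i, sqint P (fun w => dI t w i ord0).
  by move=> tT i; rewrite dIE; apply: sqintB; [exact: In2|exact: J2].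
have dIorth t : (0 <= t <= T)%E -> forall i psi, adapted F t psi -> sqint P psi ->
    \int[P]_w (psi w * dI t w i ord0) = 0.
  move=> tT i psi apsi psi2; have [hI _] := HIn t tT; have [hJ _] := HJ t tT.
  rewrite (_ : (fun w => _) =
      (fun w => psi w * In t w i ord0 - psi w * J t w i ord0)); last first.
    by apply/funext => w; rewrite !mxE mulrBr.
  rewrite RintegralB//; last 2 first.
    by apply: sqint_mul => //; exact: In2.
    by apply: sqint_mul => //; exact: J2.
  rewrite (ito_integral_orthogonal hW tT hI i apsi psi2).
  by rewrite (ito_integral_orthogonal hW tT hJ i apsi psi2) subr0.
have yIB t : (0 <= t <= T)%E -> {ae P, forall w, enorm (dY t w + dI t w) <= B w}.
  move=> tT; have [_ eIn] := HIn t tT; have [_ eJ] := HJ t tT.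
  apply: filterS3 eIn eJ generator_gap => w eIn eJ gg.
  have t0 : (0 <= t)%E by case/andP: tT.
  apply: le_trans (gg t t0); rewrite /dY /dI eIn eJ.
  rewrite le_eqVlt; apply/orP; left; apply/eqP; congr enorm.
  by apply/matrixP => i j; rewrite !mxE; ring.
set I2 := \int[P]_w (B w ^+ 2).
have supI : (\int[P]_w (path_sup T dY w ^+ 2) <= (4 * I2)%:E)%E.
  apply: (path_sup_bound hT cP (fun t i => mdY (t := t) i ord0) cdY).
    by move=> s sT; exact: (runmax_sqint y2 sT).
  by move=> s sT; exact: (doob_finite hW adY y2 dI2 dIorth B2 yIB sT).
have eneI : (sqH2 P T dZ <= I2%:E)%E.
  apply: le_trans (initial_orthogonality hT adY y2 dI2 dIorth B2 yIB).
  have T0 : (0 <= (0 : \bar R) <= T)%E by apply/andP; split => //; exact: ltW.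
  have [hI _] := HIn 0%E T0; have [hJ _] := HJ 0%E T0.
  exact: (ito_isometry_le hT hW jZn jZ hI hJ).
have supE := path_sup_Rintegral hT cP mdY cdY fdY.
have eneE := energy_Rintegral jdZ fdZ.
have S2 := path_sup_sqint hT cP mdY cdY fdY.
have SY2 := path_sup_sqint hT cP (mpred pY) cY fY.
have E2 := energy_sqint jdZ fdZ.
have EZ2 := energy_sqint jZ fZ.
have four : I2 <= _ := Rintegral_sqr_four c1 e1 c2 e2 S2 SY2 E2 EZ2.
have c1P : 0 <= c1 <= 5^-1.
  have L0 : (0 <= L1norm T u)%E by apply: integral_ge0 => s _; rewrite lee_fin.
  apply: small_coef => //; first exact: fin_num_measure (measurable_past T).
  by rewrite ge0_fin_numE.
have c2P : 0 <= c2 <= 5^-1.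
  have L0 : (0 <= L2norm T v)%E by exact: poweR_ge0.
  apply: small_coef => //; first exact: fin_num_measure (measurable_past T).
  by rewrite ge0_fin_numE.
rewrite supE lee_fin in supI; rewrite eneE lee_fin in eneI.
have A0 : 0 <= \int[P]_w (fine (path_sup T dY w) ^+ 2).
  by apply: Rintegral_ge0 => w _; exact: sqr_ge0.
have B0 : 0 <= \int[P]_w (Num.sqrt (fine (energy T dZ w)) ^+ 2).
  by apply: Rintegral_ge0 => w _; exact: sqr_ge0.
have := contraction_bound A0 B0 c1P c2P supI eneI four.
by rewrite supE eneE !lee_fin => H; split; apply: le_trans H; rewrite ?lerDl ?lerDr.
Qed.

End Stability.

(** * Vanishing of the coefficients *)

Section Gap.
Context {R : realType}.
Variable T : \bar R.
Implicit Types alpha beta nu : {finite_measure set \bar R -> \bar R}.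

Lemma measure_gap_exists alpha beta : measure_le alpha beta \/ measure_le beta alpha ->
  exists nu, measure_gap alpha beta nu.
Proof.
by case=> /finite_measure_difference[nu E]; exists nu; [right|left].
Qed.

Lemma mass_gap alpha beta nu : measure_gap alpha beta nu ->
  mass T nu = `|mass T alpha - mass T beta|.
Proof.
have mP := measurable_past T.
case=> /(_ _ mP) /eqP; rewrite !massE -EFinD eqe => /eqP ->.
  by rewrite addrAC subrr add0r ger0_norm// mass_ge0.
by rewrite opprD addrA subrr add0r normrN ger0_norm// mass_ge0.
Qed.

Lemma gap_coef_cvg (K L : R) (an nun : nat -> {finite_measure set \bar R -> \bar R})
    (a : {finite_measure set \bar R -> \bar R}) :
  an n (past T) @[n --> \oo] --> a (past T) ->
  (forall n, measure_gap (an n) a (nun n)) ->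
  K * mass T (nun n) * L @[n --> \oo] --> (0 : R).
Proof.
rewrite massE => /fine_cvg ca gap.
have cn : mass T (nun n) @[n --> \oo] --> (0 : R).
  under eq_fun do rewrite (mass_gap (gap _)).
  have -> : (0 : R) = `|mass T a - mass T a| by rewrite subrr normr0.
  by apply: cvg_norm; apply: cvgB; [exact: ca|exact: cvg_cst].
have -> : (0 : R) = K * 0 * L by rewrite mulr0 mul0r.
by apply: cvgM; [apply: cvgM => //; exact: cvg_cst|exact: cvg_cst].
Qed.

End Gap.

Theorem theorem2p4 (R : realType) (T : \bar R) (hT : (0 < T)%E)
  (m d : nat) (hm : (0 < m)%N) (hd : (0 < d)%N)
  (disp : measure_display) (Omega : measurableType disp)
  (P : probability Omega R) (F : \bar R -> set (set Omega))
  (W : R -> Omega -> 'cV[R]_d) (hW : brownian_basis P T F W)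
  (u v : \bar R -> R)
  (hu : measurable_fun [set t | (0 <= t <= T)%E] u)
  (hv : measurable_fun [set t | (0 <= t <= T)%E] v)
  (hu1 : (L1norm T u < +oo)%E) (hv2 : (L2norm T v < +oo)%E)
  (g : Omega -> \bar R -> 'cV[R]_m -> 'M[R]_(m, d) -> 'cV[R]_m)
  (hg : driver_measurable T F g)
  (hg0 : (\int[P]_w (\int[lebesgue_measure]_(s in rtime 0 T)
            (enorm (g w s%:E 0 0))%:E) ^+ 2 < +oo)%E)
  (K : R) (hK : 0 < K) (hlip : driver_lipschitz P T K g)
  (xi : Omega -> 'cV[R]_m)
  (hxi : measurable_wrt setT (F T) (@borel 'cV[R]_m) xi)
  (hxi2 : (rvL2norm P xi < +oo)%E)
  (an1 an2 : nat -> {finite_measure set \bar R -> \bar R})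
  (a1 a2 : {finite_measure set \bar R -> \bar R})
  (san1 : forall n, supported_on (an1 n) (past T))
  (san2 : forall n, supported_on (an2 n) (past T))
  (sa1 : supported_on a1 (past T)) (sa2 : supported_on a2 (past T))
  (small1 : forall n,
    ((K ^+ 2)%:E * an1 n (past T) ^+ 2 * L1norm T u ^+ 2 <= (25^-1)%:E)%E)
  (small2 : forall n,
    ((K ^+ 2)%:E * an2 n (past T) ^+ 2 * L2norm T v ^+ 2 <= (25^-1)%:E)%E)
  (cvg1 : an1 n (past T) @[n --> \oo] --> a1 (past T))
  (cvg2 : an2 n (past T) @[n --> \oo] --> a2 (past T))
  (mono1 : (forall n, measure_le (an1 n) a1) \/
           (forall n, measure_le a1 (an1 n)))
  (mono2 : (forall n, measure_le (an2 n) a2) \/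
           (forall n, measure_le a2 (an2 n)))
  (Yn : nat -> \bar R -> Omega -> 'cV[R]_m)
  (Zn : nat -> \bar R -> Omega -> 'M[R]_(m, d))
  (Y : \bar R -> Omega -> 'cV[R]_m) (Z : \bar R -> Omega -> 'M[R]_(m, d))
  (hYZn : forall n,
    delay_bsde_solution P T F W u v g xi (an1 n) (an2 n) (Yn n) (Zn n))
  (hYZ : delay_bsde_solution P T F W u v g xi a1 a2 Y Z) :
  S2norm P T (fun t w => Yn n t w - Y t w) @[n --> \oo] --> 0%E /\
  H2norm P T (fun t w => Zn n t w - Z t w) @[n --> \oo] --> 0%E.
Proof.
have gapE (an : nat -> {finite_measure set \bar R -> \bar R}) a :
    (forall n, measure_le (an n) a) \/ (forall n, measure_le a (an n)) ->
    exists nun, forall n, measure_gap (an n) a (nun n).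
  move=> mono; suff /choice[nun H] : forall n, exists nu, measure_gap (an n) a nu.
    by exists nun.
  by move=> n; apply: measure_gap_exists; case: mono => mono; [left|right].
have [nu1 gap1] := gapE _ _ mono1; have [nu2 gap2] := gapE _ _ mono2.
have est n := stability_estimate hT hW hu hv hu1 hv2 hg hg0 hK hlip (gap1 n) (gap2 n)
  (small1 n) (small2 n) (hYZn n) hYZ.
pose e1 n := K * mass T (nu1 n) * fine (L1norm T u).
pose e2 n := K * mass T (nu2 n) * fine (L2norm T v).
have ce1 : e1 n @[n --> \oo] --> (0 : R)  by exact: gap_coef_cvg cvg1 gap1.
have ce2 : e2 n @[n --> \oo] --> (0 : R)  by exact: gap_coef_cvg cvg2 gap2.
pose AY := \int[P]_w (fine (path_sup T Y w) ^+ 2).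
pose AZ := \int[P]_w (Num.sqrt (fine (energy T Z w)) ^+ 2).
pose C n := 100 * (e1 n ^+ 2 * AY + e2 n ^+ 2 * AZ).
(* only the coefficients depend on n, the norms of Y and Z are fixed *)
have cC : C n @[n --> \oo] --> (0 : R).
  have -> : (0 : R) = 100 * (0 * 0 * AY + 0 * 0 * AZ) by ring.
  rewrite /C; apply: cvgM; first exact: cvg_cst.
  by apply: cvgD; apply: cvgM; try exact: cvg_cst; apply: cvgM.
have small (x : nat -> \bar R) : (forall n, x n <= (C n)%:E)%E ->
    forall e : R, 0 < e -> \forall n \near \oo, (x n <= e%:E)%E.
  move=> xC e e0; apply: filterS (cvgr_lt _ cC _ e0) => n Cn.
  by rewrite (le_trans (xC n))// lee_fin ltW.
split; apply: poweR_half_cvg.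
- move=> n; apply: integral_ge0 => w _; rewrite expe2.
  by apply: mule_ge0; exact: (path_sup_ge0 hT (fun t w => Yn n t w - Y t w)).
- by apply: small => n; case: (est n).
- by move=> n; exact: (sqH2_ge0 P T (fun t w => Zn n t w - Z t w)).
- by apply: small => n; case: (est n).
Qed.
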